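(* Let $M$ be a closed surface immersed in the unit sphere $\mathbb{S}^N$ with parallel mean curvature vector. Assume that $$\frac53+\frac{11}3H^2\le S\le\frac95+\frac{19}5H^2$$ on $M$. If $$S_{\max}-S_{\min}<\varepsilon_0(1+H^2),$$ then $S\equiv\frac53+\frac{11}3H^2$ or $S\equiv\frac95+\frac{19}5H^2$.
   Context: $\mathbb{S}^N$ is the unit sphere in $\mathbb{R}^{N+1}$. A closed surface is a compact connected smooth $2$-manifold without boundary, here with a smooth immersion into $\mathbb{S}^N$ and the induced Riemannian metric $g$. $h$ is the second fundamental form, $S=|h|^2$, $S_{\max}=\sup_MS$, $S_{\min}=\inf_MS$, $\mathbf{H}=\frac12\operatorname{tr}_g h$ is the mean curvature vector field, $H=|\mathbf{H}|$. ''Parallel mean curvature vector'' means $\nabla^\perp\mathbf{H}=0$ for the normal connection; then $H$ is constant. Constants: $S_+$ is the unique zero in $(\frac53,\frac95)$ of $1125x^3-3375x^2+9790x-13122$, explicitly $$S_+=1+\sqrt[3]{\frac{75357+\sqrt{12014474010}}{30375}}+\sqrt[3]{\frac{75357-\sqrt{12014474010}}{30375}},$$ and $$\varepsilon_0=\frac{120S_+(3S_+-4)(9-5S_+)}{2225S_+^2-420S_+-1701}\approx0.0046196.$$ *)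

(* Defs.v *)
From HB Require Import structures.
From mathcomp Require Import all_boot all_order all_algebra.
From mathcomp Require Import all_classical all_reals all_analysis.
From mathcomp Require Import ring lra.

Set Implicit Arguments.
Unset Strict Implicit.
Unset Printing Implicit Defensive.

Import Order.TTheory GRing.Theory Num.Theory.
Import numFieldNormedType.Exports.

Local Open Scope classical_set_scope.
Local Open Scope ring_scope.

Section Smoothness.
Variable R : realType.

Definition partial (m n : nat) (a : 'I_m) (f : 'rV[R]_m -> 'rV[R]_n)
  : 'rV[R]_m -> 'rV[R]_n := fun x => 'D_(delta_mx 0 a) f x.

(* Meaningful for open U: the derivatives at a point of U are the two-sided
   ones of f, which depend only on the values of f near that point. *)
Fixpoint C_on (k m n : nat) (U : set 'rV[R]_m) (f : 'rV[R]_m -> 'rV[R]_n)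
  : Prop :=
  match k with
  | 0 => forall x, U x -> {for x, continuous f}
  | k'.+1 => (forall x, U x -> differentiable f x) /\
             (forall a : 'I_m, C_on k' U (partial a f))
  end.

Definition smooth_on (m n : nat) (U : set 'rV[R]_m)
  (f : 'rV[R]_m -> 'rV[R]_n) : Prop := forall k, C_on k U f.

End Smoothness.

(* A smooth atlas of dimension 2, given by local parametrizations
   par i : dom i -> M with inverses coord i.  The values of par i outside
   dom i and of coord i outside par i @` dom i are irrelevant.  The atlas
   need not be maximal: any atlas determines the smooth structure.  The
   function chart_at picks, for each point, one chart around it. *)
Record surface_atlas (R : realType) (M : topologicalType) := SurfaceAtlas {
  chart : Type ;
  dom : chart -> set 'rV[R]_2 ;
  par : chart -> 'rV[R]_2 -> M ;
  coord : chart -> M -> 'rV[R]_2 ;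
  chart_at : M -> chart ;
  dom_open : forall i, open (dom i) ;
  image_open : forall i, open (par i @` dom i) ;
  parK : forall i x, dom i x -> coord i (par i x) = x ;
  par_continuous : forall i x, dom i x -> {for x, continuous (par i)} ;
  coord_continuous : forall i p, (par i @` dom i) p ->
    {for p, continuous (coord i)} ;
  chart_atP : forall p, (par (chart_at p) @` dom (chart_at p)) p ;
  transition_smooth : forall i j,
    smooth_on (dom i `&` par i @^-1` (par j @` dom j)) (coord j \o par i)
}.

(* Second countability follows from compactness and the charts. *)
Definition closed_surface (M : topologicalType) : Prop :=
  [/\ [set: M] !=set0, hausdorff_space M, compact [set: M]
    & connected [set: M]].

Section Geometry.
Variables (R : realType) (N : nat).

Definition dotv (u v : 'rV[R]_N.+1) : R := \sum_j u 0 j * v 0 j.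

(* The unit sphere S^N in R^(N+1). *)
Definition sphere : set 'rV[R]_N.+1 := [set u | dotv u u = 1].

(* Geometry of a parametrized surface F : R^2 -> S^N, at a parameter x. *)
Section Local.
Variable F : 'rV[R]_2 -> 'rV[R]_N.+1.

Definition metric (x : 'rV[R]_2) : 'M[R]_2 :=
  \matrix_(a, b) dotv (partial a F x) (partial b F x).

Definition metric_inv (x : 'rV[R]_2) : 'M[R]_2 := invmx (metric x).

(* Orthogonal projection of v onto the normal space of F at x in S^N: remove
   the component tangent to the surface and the one along the position vector
   F x, which is the unit normal of the sphere in R^(N+1). *)
Definition normal_part (x : 'rV[R]_2) (v : 'rV[R]_N.+1) : 'rV[R]_N.+1 :=
  v - \sum_a \sum_b (metric_inv x a b * dotv v (partial b F x)) *: partial a F x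
    - dotv v (F x) *: F x.

(* h(e_a, e_b) is the normal part of the sphere's covariant derivative of e_b
   along e_a, and that derivative is the sphere-tangential part of the flat
   one. *)
Definition second_ff (x : 'rV[R]_2) (a b : 'I_2) : 'rV[R]_N.+1 :=
  normal_part x (partial a (partial b F) x).

Definition second_ff_sqnorm (x : 'rV[R]_2) : R :=
  \sum_a \sum_b \sum_c \sum_d metric_inv x a c * metric_inv x b d *
    dotv (second_ff x a b) (second_ff x c d).

Definition mean_curvature_vec (x : 'rV[R]_2) : 'rV[R]_N.+1 :=
  2^-1 *: \sum_a \sum_b metric_inv x a b *: second_ff x a b.

End Local.

Section Global.
Variables (M : topologicalType) (A : surface_atlas R M).
Variable f : M -> 'rV[R]_N.+1.

Definition smooth_immersion_in_sphere : Prop :=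
  [/\ forall p, sphere (f p),
      forall i : chart A, smooth_on (dom i) (f \o par i)
    & forall (i : chart A) x, dom i x -> row_free ('J (f \o par i) x)].

(* S, the mean curvature vector and its length do not depend on the chart
   used to compute them; chart_at provides one at each point. *)
Definition S_ (p : M) : R :=
  second_ff_sqnorm (f \o par (chart_at A p)) (coord (chart_at A p) p).

Definition Hvec (p : M) : 'rV[R]_N.+1 :=
  mean_curvature_vec (f \o par (chart_at A p)) (coord (chart_at A p) p).

Definition H_ (p : M) : R := Num.sqrt (dotv (Hvec p) (Hvec p)).

Definition S_max : R := sup (range S_).
Definition S_min : R := inf (range S_).

(* Normal covariant derivative of a normal field xi along the a-th coordinate
   vector of chart i, at the point of parameter x. *)
Definition normal_derivative (xi : M -> 'rV[R]_N.+1) (i : chart A)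
    (a : 'I_2) (x : 'rV[R]_2) : 'rV[R]_N.+1 :=
  normal_part (f \o par i) x (partial a (xi \o par i) x).

Definition parallel_mean_curvature : Prop :=
  forall (i : chart A) (a : 'I_2) x, dom i x ->
    normal_derivative Hvec i a x = 0.

End Global.
End Geometry.

Section Constants.
Variable R : realType.

Definition cubic (x : R) : R :=
  1125 * x ^+ 3 - 3375 * x ^+ 2 + 9790 * x - 13122.

Definition S_plus : R :=
  xget 0 [set x : R | 5 / 3 < x < 9 / 5 /\ cubic x = 0].

Definition eps0 : R :=
  120 * S_plus * (3 * S_plus - 4) * (9 - 5 * S_plus) /
  (2225 * S_plus ^+ 2 - 420 * S_plus - 1701).

Lemma cubic_inj (x y : R) : cubic x = cubic y -> x = y.
Proof.
rewrite /cubic => e; apply/eqP; rewrite -subr_eq0; apply/eqP.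
have : (x - y) * (1125 * ((x - 1) ^+ 2 + (x - 1) * (y - 1) + (y - 1) ^+ 2)
                  + 6415) = 0.
  have -> : (x - y) * (1125 * ((x - 1) ^+ 2 + (x - 1) * (y - 1) + (y - 1) ^+ 2)
      + 6415) = (1125 * x ^+ 3 - 3375 * x ^+ 2 + 9790 * x - 13122)
      - (1125 * y ^+ 3 - 3375 * y ^+ 2 + 9790 * y - 13122) by ring.
  by rewrite e subrr.
move/eqP; rewrite mulf_eq0 => /orP[/eqP //|/eqP].
have := sqr_ge0 (x - 1 + (y - 1)); have := sqr_ge0 (x - 1).
have := sqr_ge0 (y - 1); rewrite !expr2; nra.
Qed.

Lemma S_plusP : 5 / 3 < S_plus < 9 / 5 /\ cubic S_plus = 0.
Proof.
rewrite /S_plus; apply: (@xgetPex _ 0 [set x : R | 5 / 3 < x < 9 / 5 /\ cubic x = 0]).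
pose p : {poly R} := 1125 *: 'X^3 - 3375 *: 'X^2 + 9790 *: 'X - 13122%:P.
have pE x : p.[x] = cubic x by rewrite /p /cubic !hornerE.
have [||x /andP[x1 x2] /rootP px] := @poly_ivt R p (5 / 3) (9 / 5).
- lra.
- by rewrite !pE /cubic; apply/andP; split; lra.
rewrite pE in px; exists x; split => //.
rewrite !lt_neqAle x1 x2 !andbT; apply/andP; split; apply/eqP => e.
  by move: px; rewrite -e /cubic; lra.
by move: px; rewrite e /cubic; lra.
Qed.

End Constants.

(* Main.v *)
(* Let Z be the complex null unit frame of a chart given by Gram-Schmidt.  For a
   surface with parallel mean curvature vector |H| is constant and the Hopf
   differential Q = (H, h(Z, Z)) is holomorphic; as the curvature
   K = 1 + |H|^2 - |h(Z, Z)|^2 is positive, the maximum principle for |Q|^2 gives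
   Q = 0.  Multiplying the frame by (1 + |H|^2)^(-1/2) then reduces everything to
   the equations of a minimal surface in a unit sphere, with t = |h(Z, Z)|^2 in
   [5/6, 9/10] and S = 2 (1 + |H|^2) t + 2 |H|^2.

   Let r, N and tau be the squared norms of psi3 (the part of the covariant
   derivative of h(Z, Z) orthogonal to it), of its derivative eta, and of the part
   psi4 of eta orthogonal to psi3.  The maximum principle for t^3 r and for
   N + 6 r + 8 t bounds r and N.  At a minimum of r + 50 t the oscillation bound
   on t excludes that r has a zero.  Hence w = t r tau is defined everywhere, and
   w lap w - |Dw|^2 >= w^2 (9 - 10 t) >= 0.  By Hopf's strong maximum principle
   either w is a positive constant, and t = 9/10, or w = 0; in the latter case
   1 / (t r) is subharmonic, hence constant, and t = 5/6. *)

From HB Require Import structures.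
From mathcomp Require Import all_boot all_order all_algebra.
From mathcomp Require Import all_classical all_reals all_analysis.
From mathcomp Require Import ring lra.
Require Import Defs.

Set Implicit Arguments.
Unset Strict Implicit.
Unset Printing Implicit Defensive.

Import Order.TTheory GRing.Theory Num.Theory.
Import numFieldNormedType.Exports.

Local Open Scope classical_set_scope.
Local Open Scope ring_scope.

(** * Smooth functions on open sets of coordinate space *)

Section Smooth.
Variables (R : realType) (m : nat).
Implicit Types (U V : set 'rV[R]_m) (f g : 'rV[R]_m -> R).

(** The engine is a telescoping sum. In the scaled frame, with lap half the Laplacian, lap log t = 2
    - 3 t + r / t, lap log r = 3 (1 - t) - r / t + tau / r and lap log tau >= 4 (1 - t) - tau / r.
    The three add up to 9 - 10 t; if tau = 0, the first two add up to 5 - 6 t. On [5/6, 9/10] both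
    have a sign and vanish only at an end, which gives the two cases. Zeros of tau are harmless: w
    itself is used instead of its logarithm, and the strong maximum principle is applied where w >
    0. Zeros of r are the real obstacle, since psi4, and with it tau, is obtained by dividing by r.
    The pinching constant enters as [eps0 < 1 / 210], an oscillation of t of at most 1/420. In
    general there is no global frame, and M may be non-orientable; only real quantities of weight 0
    are passed from chart to chart, and they survive both rotation and conjugation of Z. The
    curvature identities are proved in any commutative ring with a conjugation and a derivation,
    instantiated by complexified rings of smooth functions on open sets of M, and evaluated at a
    point only for the inequalities. *)

Definition pd (a : 'I_m) f : 'rV[R]_m -> R := fun x => 'D_(delta_mx 0 a) f x.

Fixpoint Ck k U f : Prop :=
  match k with
  | 0 => forall x, U x -> {for x, continuous f}
  | k'.+1 => (forall x, U x -> differentiable f x) /\ (forall a, Ck k' U (pd a f))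
  end.

Lemma CkW k U f : Ck k.+1 U f -> Ck k U f.
Proof.
elim: k f => [|k IH] f [df pf] //=.
  by move=> x /df/differentiable_continuous.
by split=> // a; apply: IH; exact: pf.
Qed.

Lemma Ck_sub k U V f : V `<=` U -> Ck k U f -> Ck k V f.
Proof.
move=> VU; elim: k f => [|k IH] f /=; first by move=> h x /VU/h.
by move=> [df pf]; split=> [x /VU/df|a]//; exact: IH.
Qed.

Lemma eq_near_open U f g x : open U -> (forall y, U y -> f y = g y) -> U x ->
  \near x, f x = g x.
Proof. by move=> oU fg Ux; near=> y; apply: fg; near: y; exact: open_nbhs_nbhs. Unshelve. all: by end_near. Qed.

Lemma eq_pd U f g a : open U -> (forall y, U y -> f y = g y) ->
  forall x, U x -> pd a f x = pd a g x.
Proof. by move=> oU fg x Ux; apply: near_eq_derive; exact: eq_near_open oU fg Ux. Qed.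

(** Differentiability is local: [eq_differentiable] writes [g = f + (g - f)], where the second
    summand vanishes near x and so has differential zero. *)
Lemma near0_differentiable f x : (\near x, f x = 0) -> differentiable f x.
Proof.
move=> f0; have fx : f x = 0 by exact: nbhs_singleton f0.
have h : \forall y \near (0 : 'rV[R]_m), f (y + x) = 0.
  by move: f0; rewrite (near_shift 0); apply: filterS => y /=; rewrite subr0.
have e : f \o shift x = cst (f x) + \0 +o_ 0 id.
  apply/eqaddoP => _/posnumP[eps]; apply: filterS h => y h.
  by rewrite !fctE /= h fx !(addr0, subr0) normr0 mulr_ge0.
have d0 : 'd f x = \0 :> (_ -> _).
  by apply: diff_unique => // y; exact: cst_continuous.
apply/diff_locallyP; rewrite d0; split => // y; exact: cst_continuous.
Qed.

Lemma eq_differentiable U f g x : open U -> (forall y, U y -> f y = g y) -> U x ->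
  differentiable f x -> differentiable g x.
Proof.
move=> oU fg Ux df; have -> : g = f + (g - f) by apply/funext => y; rewrite !fctE addrC subrK.
apply: differentiableD => //; apply: near0_differentiable.
by have := eq_near_open oU fg Ux; apply: filterS => y; rewrite !fctE => ->; rewrite subrr.
Qed.

Lemma eq_continuous_at U f g x : open U -> (forall y, U y -> f y = g y) -> U x ->
  {for x, continuous f} -> {for x, continuous g}.
Proof.
move=> oU fg Ux cf; rewrite /prop_for /continuous_at -(fg _ Ux).
apply: cvg_trans cf.
apply: (@near_eq_cvg _ _ (nbhs x)).
by have := eq_near_open oU fg Ux; apply: filterS => y ->.
Qed.

Lemma eq_Ck k U f g : open U -> (forall y, U y -> f y = g y) -> Ck k U f -> Ck k U g.
Proof.
move=> oU; elim: k f g => [|k IH] f g fg /=.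
  by move=> cf x Ux; apply: (eq_continuous_at oU fg Ux); exact: cf.
move=> [df pf]; split=> [x Ux|a]; first exact: (eq_differentiable oU fg Ux (df x Ux)).
by apply: IH (pf a); exact: eq_pd.
Qed.

Lemma pdD f g a x : differentiable f x -> differentiable g x ->
  pd a (f \+ g) x = pd a f x + pd a g x.
Proof. by move=> df dg; rewrite /pd -deriveD //; exact: diff_derivable. Qed.

Lemma pdN f a x : differentiable f x -> pd a (\- f) x = - pd a f x.
Proof. by move=> df; rewrite /pd -deriveN //; exact: diff_derivable. Qed.

Lemma pdM f g a x : differentiable f x -> differentiable g x ->
  pd a (f \* g) x = f x * pd a g x + g x * pd a f x.
Proof. by move=> df dg; rewrite /pd [LHS]deriveM //; exact: diff_derivable. Qed.

Lemma pd_cst c a x : pd a (cst c) x = 0.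
Proof. by rewrite /pd derive_cst. Qed.

Lemma Ck_cst k U c : Ck k U (cst c).
Proof.
elim: k c => [|k IH] c /=; first by move=> x _; exact: cst_continuous.
split=> [x _|a]; first exact: differentiable_cst.
rewrite (_ : pd a _ = cst 0); first exact: IH.
by apply/funext => x; rewrite pd_cst.
Qed.

Lemma CkD k U f g : open U -> Ck k U f -> Ck k U g -> Ck k U (f \+ g).
Proof.
move=> oU; elim: k f g => [|k IH] f g /=.
  by move=> cf cg x Ux; apply: continuousD; [exact: cf|exact: cg].
move=> [df pf] [dg pg]; split=> [x Ux|a].
  by apply: differentiableD; [exact: df|exact: dg].
apply: eq_Ck (IH _ _ (pf a) (pg a)) => // x Ux.
by rewrite pdD //; [exact: df|exact: dg].
Qed.

Lemma CkN k U f : open U -> Ck k U f -> Ck k U (\- f).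
Proof.
move=> oU; elim: k f => [|k IH] f /=.
  by move=> cf x Ux; apply: continuousN; exact: cf.
move=> [df pf]; split=> [x Ux|a]; first by apply: differentiableN; exact: df.
by apply: eq_Ck (IH _ (pf a)) => // x Ux; rewrite pdN //; exact: df.
Qed.

Lemma CkM k U f g : open U -> Ck k U f -> Ck k U g -> Ck k U (f \* g).
Proof.
move=> oU; elim: k f g => [|k IH] f g.
  by move=> cf cg x Ux; apply: continuousM; [exact: cf|exact: cg].
move=> Cf Cg; have [df pf] := Cf; have [dg pg] := Cg; split=> [x Ux|a].
  by apply: differentiableM; [exact: df|exact: dg].
have h : Ck k U ((f \* pd a g) \+ (g \* pd a f)).
  by apply: CkD => //; apply: IH; [exact: CkW|exact: pg|exact: CkW|exact: pf].
by apply: eq_Ck h => // x Ux; rewrite pdM //; [exact: df|exact: dg].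
Qed.

Definition smooth U f := forall k, Ck k U f.

Lemma pdV f a x : f x != 0 -> differentiable f x ->
  pd a (fun y => (f y)^-1) x = - (f x) ^- 2 * pd a f x.
Proof. by move=> f0 df; rewrite /pd [LHS]deriveV //; exact: diff_derivable. Qed.

Lemma CkV k U f : open U -> (forall x, U x -> f x != 0) -> Ck k U f ->
  Ck k U (fun x => (f x)^-1).
Proof.
move=> oU f0; elim: k => [|k IH] Cf.
  by move=> x Ux; apply: continuousV; [exact: f0|exact: Cf].
have [df pf] := Cf; have {}IH := IH (CkW Cf); split=> [x Ux|a].
  by apply: differentiableV; [exact: df|exact: f0].
have h : Ck k U ((\- ((fun x => (f x)^-1) \* (fun x => (f x)^-1))) \* pd a f).
  by apply: CkM => //; [apply: CkN => //; exact: CkM|exact: pf].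
apply: eq_Ck h => // x Ux /=; rewrite pdV ?f0 //; last exact: df.
by rewrite -exprVn expr2.
Qed.

Lemma differentiable_sqrt f x : 0 < f x -> differentiable f x ->
  differentiable (fun y => Num.sqrt (f y)) x.
Proof.
move=> f0 df; apply: (differentiable_comp df); apply/derivable1_diffP.
exact: (@ex_derive _ _ _ _ _ _ _ (is_derive1_sqrt f0)).
Qed.

Lemma pd_sqrt f a x : 0 < f x -> differentiable f x ->
  pd a (fun y => Num.sqrt (f y)) x = (2 * Num.sqrt (f x))^-1 * pd a f x.
Proof.
move=> f0 df.
have ds := is_derive1_sqrt f0.
have dS : differentiable (@Num.sqrt R) (f x) by apply/derivable1_diffP; exact: (@ex_derive _ _ _ _ _ _ _ ds).
rewrite /pd deriveE; last exact: (differentiable_comp df dS).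
rewrite (diff_comp df dS) /= deriv1E; last exact: (@ex_derive _ _ _ _ _ _ _ ds).
by rewrite derive1E (@derive_val _ _ _ _ _ _ _ ds) -deriveE // [RHS]mulrC.
Qed.

(** The derivative is [pd a f] divided by twice the square root itself, so the induction on the
    order of differentiability feeds on its own conclusion. *)
Lemma smooth_sqrt U f : open U -> (forall x, U x -> 0 < f x) -> smooth U f ->
  smooth U (fun x => Num.sqrt (f x)).
Proof.
move=> oU f0 sf; elim=> [|k IH].
  move=> x Ux; apply: continuous_comp; first exact: (sf 0%N).
  exact: sqrt_continuous.
have df := (sf 1%N).1; split=> [x Ux|a].
  by apply: differentiable_sqrt; [exact: f0|exact: df].
have h : Ck k U ((fun x => (2 * Num.sqrt (f x))^-1) \* pd a f).
  apply: CkM => //; last exact: (sf k.+1).2.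
  apply: CkV => [//|x Ux|]; first by rewrite mulf_neq0 // gt_eqF // sqrtr_gt0 f0.
  exact: (CkM oU (@Ck_cst k U 2)).
by apply: eq_Ck h => // x Ux /=; rewrite pd_sqrt ?f0 //; exact: df.
Qed.

Lemma smooth_pd U f a : smooth U f -> smooth U (pd a f).
Proof. by move=> sf k; exact: (sf k.+1).2. Qed.

Lemma smooth_differentiable U f x : smooth U f -> U x -> differentiable f x.
Proof. by move=> sf; exact: (sf 1%N).1. Qed.

Lemma smooth_continuous U f x : smooth U f -> U x -> {for x, continuous f}.
Proof. by move=> sf; exact: (sf 0%N). Qed.

End Smooth.

(** * Components of vector-valued maps and the chain rule *)

Section Coordinates.
Variables (R : realType).

Lemma C_onW m n k (U : set 'rV[R]_m) (F : 'rV[R]_m -> 'rV[R]_n) :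
  C_on k.+1 U F -> C_on k U F.
Proof.
elim: k F => [|k IH] F [df pf] //=.
  by move=> x /df/differentiable_continuous.
by split=> // a; apply: IH; exact: pf.
Qed.

Lemma C_on_coord m n k (U : set 'rV[R]_m) (F : 'rV[R]_m -> 'rV[R]_n) j :
  open U -> C_on k U F -> Ck k U (fun x => F x 0 j).
Proof.
move=> oU; elim: k F => [|k IH] F /=.
  move=> cF x Ux; apply: (@continuous_comp _ _ _ F (fun M : 'rV_n => M 0 j)).
    exact: cF.
  exact: differentiable_continuous (differentiable_coord _ _ _).
move=> [dF pF]; split=> [x Ux|a].
  apply: (@differentiable_comp _ _ _ _ F (fun M : 'rV_n => M 0 j)); first exact: dF.
  exact: differentiable_coord.
apply: eq_Ck (IH _ (pF a)) => // x Ux.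
by rewrite /partial derive_mx ?mxE //; apply: diff_derivable; exact: dF.
Qed.

Lemma row_delta m (v : 'rV[R]_m) : v = \sum_b v 0 b *: delta_mx 0 b.
Proof. by rewrite [LHS]row_sum_delta. Qed.

Lemma pd_chain m n (F : 'rV[R]_m -> 'rV[R]_n) (f : 'rV[R]_n -> R) a x :
  differentiable F x -> differentiable f (F x) ->
  pd a (f \o F) x = \sum_b pd a (fun y => F y 0 b) x * pd b f (F x).
Proof.
move=> dF df; rewrite /pd deriveE; last exact: differentiable_comp.
rewrite diff_comp //= -(deriveE _ dF) [X in 'd f _ X]row_delta linear_sum /=.
apply: eq_bigr => b _; rewrite linearZ /= -(deriveE _ df); congr (_ *: _).
by rewrite derive_mx ?mxE //; exact: diff_derivable.
Qed.

Lemma Ck_sum m (I : finType) k (U : set 'rV[R]_m) (G : I -> 'rV[R]_m -> R) :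
  open U -> (forall i, Ck k U (G i)) -> Ck k U (fun x => \sum_i G i x).
Proof.
move=> oU h; have -> : (fun x => \sum_i G i x) = \sum_i G i.
  by apply/funext => x; rewrite fct_sumE.
by elim/big_ind : _ => [|f g|//]; [exact: Ck_cst|exact: CkD].
Qed.

Lemma Ck_comp m n k (U : set 'rV[R]_m) (V : set 'rV[R]_n)
    (F : 'rV[R]_m -> 'rV[R]_n) (f : 'rV[R]_n -> R) :
  open U -> (forall x, U x -> V (F x)) ->
  C_on k U F -> Ck k V f -> Ck k U (f \o F).
Proof.
move=> oU UV; elim: k f => [|k IH] f.
  move=> cF cf x Ux; apply: continuous_comp; first exact: cF.
  by apply: cf; exact: UV.
move=> CF Cf; have [dF pF] := CF; have [df pf] := Cf; split=> [x Ux|a].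
  by apply: differentiable_comp; [exact: dF|apply: df; exact: UV].
have CF' : C_on k U F by exact: C_onW.
have h : Ck k U (fun x => \sum_b pd a (fun y => F y 0 b) x * pd b f (F x)).
  apply: Ck_sum => // b; apply: CkM => //; last exact: IH CF' (pf b).
  exact: (C_on_coord b oU CF).2.
apply: eq_Ck h => // x Ux; rewrite pd_chain //; [exact: dF|apply: df; exact: UV].
Qed.

End Coordinates.

(** * Mean value theorem along lines and symmetry of second derivatives *)

Section Lines.
Variables (R : realType) (m : nat).
Implicit Types (U : set 'rV[R]_m) (f : 'rV[R]_m -> R) (x y v : 'rV[R]_m).

Lemma is_derive_line f y v (s : R) : differentiable f (y + s *: v) ->
  is_derive s 1 (fun s => f (y + s *: v)) ('D_v f (y + s *: v)).
Proof.
move=> df.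
have e : (fun h : R => h^-1 *: (f (y + (h *: (1 : R) + s) *: v) - f (y + s *: v))) =
    (fun h : R => h^-1 *: (f (h *: v + (y + s *: v)) - f (y + s *: v))).
  apply/funext => h; congr (_ *: (f _ - _)).
  have -> : h *: (1 : R) = h by exact: mulr1.
  by rewrite scalerDl addrCA.
apply: DeriveDef; last by rewrite /derive e.
by rewrite /derivable e; exact: diff_derivable.
Qed.

Lemma MVT_line f y v (h : R) : 0 < h ->
  (forall s, 0 <= s <= h -> differentiable f (y + s *: v)) ->
  exists2 s, 0 < s < h & f (y + h *: v) - f y = 'D_v f (y + s *: v) * h.
Proof.
move=> h0 df.
have [||s] := @MVT R (fun s => f (y + s *: v)) (fun s => 'D_v f (y + s *: v)) 0 h h0.
- move=> s; rewrite in_itv /= => /andP[s0 sh]; apply: is_derive_line.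
  by apply: df; rewrite !ltW.
- apply: derivable_within_continuous => s; rewrite in_itv /= => hs.
  exact: (@ex_derive _ _ _ _ _ _ _ (is_derive_line (df s hs))).
by rewrite in_itv /= scale0r addr0 subr0 => hs e; exists s.
Qed.

Lemma derive_dir f x v : differentiable f x -> 'D_v f x = \sum_a v 0 a * pd a f x.
Proof.
move=> df; rewrite deriveE // [X in 'd f _ X]row_delta linear_sum /=.
by apply: eq_bigr => a _; rewrite linearZ /= -(deriveE _ df).
Qed.

Lemma near_cube U x u w : nbhs x U ->
  exists2 e : R, 0 < e & forall s t, `|s| <= e -> `|t| <= e -> U (x + s *: u + t *: w).
Proof.
move=> /nbhs_ballP[r /= r0 rU].
exists (r / 2 / (`|u| + `|w| + 1)).
  by rewrite !divr_gt0 // ltr_wpDl // addr_ge0.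
move=> s t hs ht; apply: rU; rewrite -ball_normE /= -addrA opprD addNKr normrN.
apply: (@le_lt_trans _ _ (r / 2)); last by rewrite ltr_pdivrMr // ltr_pMr // ltr1n.
apply: le_trans (ler_normD _ _) _; rewrite !normrZ.
set k := `|u| + `|w| + 1; have k0 : 0 < k by rewrite ltr_wpDl // addr_ge0.
apply: (@le_trans _ _ (r / 2 / k * (`|u| + `|w|))).
  by rewrite mulrDr lerD // ler_wpM2r.
by rewrite mulrAC ler_pdivrMr // ler_pM2l ?divr_gt0 // lerDl.
Qed.

Lemma derive_translate f c u x : 'D_u (fun y => f (y + c)) x = 'D_u f (x + c).
Proof.
have E : (fun h : R => h^-1 *: (((fun y => f (y + c)) \o shift x) (h *: u) - f (x + c))) =
    (fun h => h^-1 *: ((f \o shift (x + c)) (h *: u) - f (x + c))).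
  by apply/funext => h /=; rewrite addrA.
by rewrite /derive E.
Qed.

(** Two uses of the mean value theorem: along u for the increment of f over [h *: w], then along w
    for the derivative of f along u. *)
Lemma second_diff f U x u w (h : R) : open U -> smooth U f -> 0 < h ->
  (forall s t, 0 <= s <= h -> 0 <= t <= h -> U (x + s *: u + t *: w)) ->
  (forall y, U y -> differentiable ('D_u f) y) ->
  exists s t, [/\ 0 < s < h, 0 < t < h &
    f (x + h *: u + h *: w) - f (x + h *: w) - (f (x + h *: u) - f x) =
    'D_w ('D_u f) (x + s *: u + t *: w) * (h * h)].
Proof.
move=> oU sf h0 hU dU; have dff y : U y -> differentiable f y by exact: smooth_differentiable.
pose g y := f (y + h *: w) - f y.
have hh : 0 <= h <= h by apply/andP; split => //; exact: ltW.
have h00 : (0 : R) <= 0 <= h by apply/andP; split => //; exact: ltW.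
have dsh s : 0 <= s <= h -> differentiable (fun y => f (y + h *: w)) (x + s *: u).
  move=> hs; apply: (@differentiable_comp _ _ _ _ (fun y => y + h *: w) f).
    by apply: differentiableD => //; exact: differentiable_cst.
  by apply: dff; exact: hU.
have dU0 s : 0 <= s <= h -> U (x + s *: u).
  by move=> hs; have := hU s 0 hs h00; rewrite scale0r addr0.
have [s hs es] : exists2 s, 0 < s < h &
    g (x + h *: u) - g x = 'D_u g (x + s *: u) * h.
  apply: (@MVT_line g x u h h0) => s hs; apply: differentiableB; first exact: dsh.
  by apply: dff; exact: dU0.
have hs' : 0 <= s <= h by case/andP: hs => *; rewrite !ltW.
have [t ht et] : exists2 t, 0 < t < h & 'D_u f (x + s *: u + h *: w) - 'D_u f (x + s *: u)
    = 'D_w ('D_u f) (x + s *: u + t *: w) * h.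
  by apply: (@MVT_line ('D_u f) (x + s *: u) w h h0) => t ht; apply: dU; exact: hU.
exists s, t; split; [exact: hs|exact: ht|].
move: es; rewrite /g [X in _ = X -> _](_ : _ = ('D_u f (x + s *: u + h *: w) - 'D_u f (x + s *: u)) * h).
  by rewrite et => e1; rewrite mulrA -e1 [RHS]addrAC !opprB !addrA; move: (f _) (f _) (f _) (f _) => *; ring.
rewrite (_ : 'D_u g (x + s *: u) = 'D_u f (x + s *: u + h *: w) - 'D_u f (x + s *: u)) //.
rewrite [LHS]deriveB; last 2 first.
- exact/diff_derivable/dsh.
- exact/diff_derivable/dff/dU0.
by rewrite derive_translate.
Qed.

End Lines.

Section Schwarz.
Variables (R : realType) (m : nat).
Implicit Types (U : set 'rV[R]_m) (f : 'rV[R]_m -> R) (x y v : 'rV[R]_m).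

(** Both orders of differentiation compute the same second difference, so the two mixed derivatives
    agree at suitable points of an arbitrarily small square around x; their continuity does the
    rest. *)
Lemma schwarz U f x a b : open U -> smooth U f -> U x ->
  pd a (pd b f) x = pd b (pd a f) x.
Proof.
move=> oU sf Ux; apply/eqP; rewrite -subr_eq0 -normr_eq0 eq_le normr_ge0 andbT.
apply/ler_addgt0Pr => e e0; rewrite add0r (splitr e).
have e20 : 0 < e / 2 by rewrite divr_gt0.
pose u := delta_mx 0 a : 'rV[R]_m; pose w := delta_mx 0 b : 'rV[R]_m.
have nr c d : nbhs x [set y | `|pd c (pd d f) x - pd c (pd d f) y| < e / 2].
  have /cvgrPdist_lt/(_ _ e20) : {for x, continuous (pd c (pd d f))}.
    by apply: (@smooth_continuous _ _ U) => //; do 2!apply: smooth_pd.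
  by [].
have nU : nbhs x U by exact: open_nbhs_nbhs.
have [h1 h10 H1] := near_cube u w (filterI nU (filterI (nr a b) (nr b a))).
have h1' s : 0 <= s <= h1 -> `|s| <= h1 by case/andP => s0 sh; rewrite ger0_norm.
have H s t : 0 <= s <= h1 -> 0 <= t <= h1 -> U (x + s *: u + t *: w).
  by move=> hs ht; have [] := H1 s t (h1' _ hs) (h1' _ ht).
have H' s t : 0 <= s <= h1 -> 0 <= t <= h1 -> U (x + s *: w + t *: u).
  by move=> hs ht; rewrite addrAC; exact: H.
have dp c y : U y -> differentiable (pd c f) y.
  by move=> Uy; apply: (@smooth_differentiable _ _ U) => //; exact: smooth_pd.
have [s [t [/andP[s0 sh] /andP[t0 th] E]]] := second_diff oU sf h10 H (dp a).
have [s' [t' [/andP[s0' sh'] /andP[t0' th'] E']]] := second_diff oU sf h10 H' (dp b).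
have {E'}E : pd b (pd a f) (x + s *: u + t *: w) = pd a (pd b f) (x + t' *: u + s' *: w).
  apply: (@mulIf _ (h1 * h1)); first by rewrite mulf_neq0 // gt_eqF.
  rewrite -[LHS]E [x + t' *: u + _]addrAC -[RHS]E' [x + h1 *: w + _]addrAC.
  ring.
have wk r : 0 < r -> r < h1 -> `|r| <= h1 by move=> *; rewrite ger0_norm ltW.
have [_ [_ A1]] := H1 s t (wk _ s0 sh) (wk _ t0 th).
have [_ [A2 _]] := H1 t' s' (wk _ t0' th') (wk _ s0' sh').
rewrite /= in A1 A2; rewrite E in A1.
clear -A1 A2; move: A1 A2.
move: (pd a (pd b f) x) (pd b (pd a f) x) (pd a (pd b f) _) (e / 2) => p q r d A1 A2.
rewrite -(subrKA r); apply: le_trans (ler_normD _ _) _; apply: lerD; first exact: ltW.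
by rewrite distrC ltW.
Qed.

End Schwarz.

(** * First and second derivative tests at a maximum *)

Section MaxTest.
Variables (R : realType) (m : nat).
Implicit Types (U : set 'rV[R]_m) (f : 'rV[R]_m -> R) (x y v : 'rV[R]_m).

Lemma near_line x v U : nbhs x U ->
  exists2 e : R, 0 < e & forall s, `|s| <= e -> U (x + s *: v).
Proof.
move=> /(near_cube v v)[e e0 H]; exists e => // s hs.
by have := H s 0 hs; rewrite normr0 scale0r addr0; apply; exact: ltW.
Qed.

Lemma max_derive_dir U f x v : open U -> smooth U f -> U x ->
  (forall y, U y -> f y <= f x) -> 'D_v f x = 0.
Proof.
move=> oU sf Ux mx; have [e e0 H] := near_line v (open_nbhs_nbhs (conj oU Ux)).
have He (s : R) : s \in `]-e, e[ -> U (x + s *: v).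
  by rewrite in_itv /= => /andP[s1 s2]; apply: H; rewrite ler_norml !ltW.
have dl (s : R) : s \in `]-e, e[ -> is_derive s 1 (fun s => f (x + s *: v)) ('D_v f (x + s *: v)).
  by move=> hs; apply: is_derive_line; apply: smooth_differentiable sf (He _ hs).
have i0 : (0 : R) \in `]-e, e[ by rewrite in_itv /= oppr_lt0 e0.
have M : is_derive (0 : R) 1 (fun s => f (x + s *: v)) 0.
  apply: (@derive1_at_max _ _ (- e) e) => //.
  - by rewrite ltW // gtrN.
  - by move=> t ht; exact: (@ex_derive _ _ _ _ _ _ _ (dl t ht)).
  - by move=> t ht; rewrite scale0r addr0; apply: mx; exact: He.
have := @derive_val _ _ _ _ _ _ _ (dl 0 i0); rewrite (@derive_val _ _ _ _ _ _ _ M).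
by rewrite scale0r addr0.
Qed.

Lemma max_pd U f x a : open U -> smooth U f -> U x ->
  (forall y, U y -> f y <= f x) -> pd a f x = 0.
Proof. by move=> oU sf Ux mx; exact: (max_derive_dir _ oU sf Ux mx). Qed.

Lemma smooth_dir U f v : open U -> smooth U f -> smooth U ('D_v f).
Proof.
move=> oU sf k; apply: (@eq_Ck _ _ _ _ (fun x => \sum_a v 0 a * pd a f x)) => //.
  by move=> y Uy; rewrite (derive_dir v (smooth_differentiable sf Uy)).
apply: Ck_sum => // a; apply: (CkM oU (@Ck_cst _ _ _ _ _)).
exact: smooth_pd sf k.
Qed.

(** A positive second derivative would stay positive on a short segment from x; as the first
    derivative vanishes at x, the mean value theorem applied twice makes f larger at the end of the
    segment. *)
Lemma max_derive2 U f x v : open U -> smooth U f -> U x ->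
  (forall y, U y -> f y <= f x) -> 'D_v ('D_v f) x <= 0.
Proof.
move=> oU sf Ux mx; rewrite leNgt; apply/negP => P.
have sg : smooth U ('D_v ('D_v f)) by exact: (smooth_dir v oU (smooth_dir v oU sf)).
have nP : nbhs x [set y | 0 < 'D_v ('D_v f) y].
  have c : {for x, continuous ('D_v ('D_v f))} by exact: smooth_continuous sg Ux.
  exact: (cvgr_gt ('D_v ('D_v f) x) c).
have [e e0 H] := near_line v (filterI (open_nbhs_nbhs (conj oU Ux)) nP).
have H' s : 0 <= s <= e -> U (x + s *: v) /\ 0 < 'D_v ('D_v f) (x + s *: v).
  by move=> /andP[s0 se]; apply: H; rewrite ger0_norm.
have df y : U y -> differentiable f y by exact: smooth_differentiable.
have dg y : U y -> differentiable ('D_v f) y.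
  by apply: smooth_differentiable; exact: smooth_dir.
have [|s hs E] := @MVT_line _ _ f x v e e0.
  by move=> s /H'[/df].
have /andP[s0 se] := hs.
have [s' hs' E'] : exists2 s', 0 < s' < s & 'D_v f (x + s *: v) - 'D_v f x = 'D_v ('D_v f) (x + s' *: v) * s.
  apply: (@MVT_line _ _ ('D_v f) x v s s0) => r /andP[r0 rs]; have [] := H' r; first by rewrite r0 (le_trans rs) // ltW.
  by move=> /dg.
have := max_derive_dir v oU sf Ux mx => d0.
move: E'; rewrite d0 subr0 => E'.
have /andP[s0' ss'] := hs'.
have [_ p'] : U (x + s' *: v) /\ 0 < 'D_v ('D_v f) (x + s' *: v).
  by apply: H'; rewrite ltW //= ltW // (lt_trans ss').
have : 0 < f (x + e *: v) - f x by rewrite E E' !mulr_gt0.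
rewrite subr_gt0 ltNge => /negP; apply; apply: mx.
by have [] := H' e _ => //; rewrite lexx ltW.
Qed.

End MaxTest.

(** * Rings of smooth functions on the surface *)

Lemma C_on_sub (R : realType) m n k (U V : set 'rV[R]_m) (F : 'rV[R]_m -> 'rV[R]_n) :
  V `<=` U -> C_on k U F -> C_on k V F.
Proof.
move=> VU; elim: k F => [|k IH] F /=; first by move=> h x /VU/h.
by move=> [df pf]; split=> [x /VU/df|a]//; exact: IH.
Qed.

Section Functions.
Variables (R : realType) (M : topologicalType) (At : surface_atlas R M).

Definition img (i : chart At) : set M := par i @` dom i.

Lemma coordK i p : img i p -> par i (coord i p) = p.
Proof. by move=> [x dx <-]; rewrite parK. Qed.

Lemma coord_dom i p : img i p -> dom i (coord i p).
Proof. by move=> [x dx <-]; rewrite parK. Qed.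

Lemma par_img i x : dom i x -> img i (par i x). Proof. by exists x. Qed.

Definition rdom (i : chart At) (O : set M) : set 'rV[R]_2 :=
  dom i `&` par i @^-1` O.

Lemma rdom_open i (O : set M) : open O -> open (rdom i O).
Proof.
move=> oO; rewrite openE => x [dx Ox].
have h1 : nbhs x (dom i) by apply: open_nbhs_nbhs; split => //; exact: dom_open.
have h2 : nbhs (par i x) O by exact: open_nbhs_nbhs.
exact: filterI h1 (par_continuous dx h2).
Qed.

Lemma coord_rdom i (O : set M) p : img i p -> O p -> rdom i O (coord i p).
Proof. by move=> ip Op; split; [exact: coord_dom|rewrite /= coordK]. Qed.

Record opens := Opens { oset :> set M ; oset_open : open oset }.

Definition msmooth (O : set M) (u : M -> R) : Prop :=
  forall i, smooth (rdom i O) (u \o par i).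

(* Vanishing outside O makes equality on O the same as Leibniz equality. *)
Record sfun (W : opens) := SFun {
  sval :> M -> R ;
  sfun_smooth : msmooth (oset W) sval ;
  sfun_out : forall p, ~ oset W p -> sval p = 0 }.

Section Algebra.
Variable W : opens.
Implicit Types u v : sfun W.
Local Notation O := (oset W).

Lemma sfun_eq u v : (forall p, O p -> u p = v p) -> u = v.
Proof.
case: u v => [u su u0] [v sv v0] /= e.
have uv : u = v.
  apply/funext => p; have [/e//|np] := pselect (O p); by rewrite u0 // v0.
by subst v; congr SFun; exact: Prop_irrelevance.
Qed.

Let ro i : open (rdom i O). Proof. exact/rdom_open/oset_open. Qed.

Lemma sfun_Ck u i k : Ck k (rdom i O) (u \o par i).
Proof. exact: sfun_smooth. Qed.

Lemma sfun_sm u i : smooth (rdom i O) (u \o par i).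
Proof. exact: sfun_smooth. Qed.

(** Extension by zero, as [sfun_out] demands. *)
Definition rst (u : M -> R) p : R := if `[< O p >] then u p else 0.

Lemma rstE (u : M -> R) p : O p -> rst u p = u p.
Proof. by move=> Op; rewrite /rst asboolT. Qed.

Lemma rst_out (u : M -> R) p : ~ O p -> rst u p = 0.
Proof. by move=> Op; rewrite /rst asboolF. Qed.

Lemma msmooth_eq (u v : M -> R) : (forall p, O p -> u p = v p) ->
  msmooth O u -> msmooth O v.
Proof.
move=> e su i k; apply: eq_Ck (su i k) => // x [_ Ox] /=; exact: e.
Qed.

(* The operations are kept opaque: unfolding them down to limits makes
   unification diverge. *)
Lemma mk_sfun_spec (u : M -> R) : msmooth O u ->
  {v : sfun W | forall p, O p -> v p = u p}.
Proof.
move=> su.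
exists (SFun (msmooth_eq (fun p Op => esym (rstE u Op)) su) (fun p => @rst_out u p)).
by move=> p Op; exact: rstE.
Qed.

Definition mk_sfun (u : M -> R) (su : msmooth O u) : sfun W := proj1_sig (mk_sfun_spec su).

Lemma mk_sfunE (u : M -> R) (su : msmooth O u) p : O p -> mk_sfun su p = u p.
Proof. exact: (proj2_sig (mk_sfun_spec su)). Qed.

Lemma msmooth_cst c : msmooth O (cst c).
Proof. by move=> i k; exact: Ck_cst. Qed.
Lemma msmooth_add u v : msmooth O (fun p => u p + v p).
Proof. by move=> i k; exact: (CkD (@ro i) (sfun_Ck u i k) (sfun_Ck v i k)). Qed.
Lemma msmooth_opp u : msmooth O (fun p => - u p).
Proof. by move=> i k; exact: (CkN (@ro i) (sfun_Ck u i k)). Qed.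
Lemma msmooth_mul u v : msmooth O (fun p => u p * v p).
Proof. by move=> i k; exact: (CkM (@ro i) (sfun_Ck u i k) (sfun_Ck v i k)). Qed.

Lemma sf_cst_spec c : {w : sfun W | forall p, O p -> w p = c}.
Proof. by exists (mk_sfun (msmooth_cst c)) => p Op; rewrite mk_sfunE. Qed.
Lemma sf_add_spec u v : {w : sfun W | forall p, O p -> w p = u p + v p}.
Proof. by exists (mk_sfun (msmooth_add u v)) => p Op; rewrite mk_sfunE. Qed.
Lemma sf_opp_spec u : {w : sfun W | forall p, O p -> w p = - u p}.
Proof. by exists (mk_sfun (msmooth_opp u)) => p Op; rewrite mk_sfunE. Qed.
Lemma sf_mul_spec u v : {w : sfun W | forall p, O p -> w p = u p * v p}.
Proof. by exists (mk_sfun (msmooth_mul u v)) => p Op; rewrite mk_sfunE. Qed.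

Definition sfC c := proj1_sig (sf_cst_spec c).
Definition sf_add u v := proj1_sig (sf_add_spec u v).
Definition sf_opp u := proj1_sig (sf_opp_spec u).
Definition sf_mul u v := proj1_sig (sf_mul_spec u v).

Lemma sfCE c p : O p -> sfC c p = c.
Proof. exact: (proj2_sig (sf_cst_spec c)). Qed.
Lemma sf_addE u v p : O p -> sf_add u v p = u p + v p.
Proof. exact: (proj2_sig (sf_add_spec u v)). Qed.
Lemma sf_oppE u p : O p -> sf_opp u p = - u p.
Proof. exact: (proj2_sig (sf_opp_spec u)). Qed.
Lemma sf_mulE u v p : O p -> sf_mul u v p = u p * v p.
Proof. exact: (proj2_sig (sf_mul_spec u v)). Qed.

HB.instance Definition _ := gen_eqMixin (sfun W).
HB.instance Definition _ := gen_choiceMixin (sfun W).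

Fact sf_addA : associative sf_add. Proof. by move=> *; apply: sfun_eq => p Op; rewrite !(sfCE _ Op, sf_addE _ _ Op, sf_oppE _ Op, sf_mulE _ _ Op); rewrite addrA. Qed.
Fact sf_addC : commutative sf_add. Proof. by move=> *; apply: sfun_eq => p Op; rewrite !(sfCE _ Op, sf_addE _ _ Op, sf_oppE _ Op, sf_mulE _ _ Op); rewrite addrC. Qed.
Fact sf_add0 : left_id (sfC 0) sf_add. Proof. by move=> *; apply: sfun_eq => p Op; rewrite !(sfCE _ Op, sf_addE _ _ Op, sf_oppE _ Op, sf_mulE _ _ Op); rewrite add0r. Qed.
Fact sf_addN : left_inverse (sfC 0) sf_opp sf_add. Proof. by move=> *; apply: sfun_eq => p Op; rewrite !(sfCE _ Op, sf_addE _ _ Op, sf_oppE _ Op, sf_mulE _ _ Op); rewrite addNr. Qed.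
HB.instance Definition _ :=
  GRing.isZmodule.Build (sfun W) sf_addA sf_addC sf_add0 sf_addN.

Fact sf_mulA : associative sf_mul. Proof. by move=> *; apply: sfun_eq => p Op; rewrite !(sfCE _ Op, sf_addE _ _ Op, sf_oppE _ Op, sf_mulE _ _ Op); rewrite mulrA. Qed.
Fact sf_mulC : commutative sf_mul. Proof. by move=> *; apply: sfun_eq => p Op; rewrite !(sfCE _ Op, sf_addE _ _ Op, sf_oppE _ Op, sf_mulE _ _ Op); rewrite mulrC. Qed.
Fact sf_mul1 : left_id (sfC 1) sf_mul. Proof. by move=> *; apply: sfun_eq => p Op; rewrite !(sfCE _ Op, sf_addE _ _ Op, sf_oppE _ Op, sf_mulE _ _ Op); rewrite mul1r. Qed.
Fact sf_mulD : left_distributive sf_mul sf_add. Proof. by move=> *; apply: sfun_eq => p Op; rewrite !(sfCE _ Op, sf_addE _ _ Op, sf_oppE _ Op, sf_mulE _ _ Op); rewrite mulrDl. Qed.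
HB.instance Definition _ :=
  GRing.Zmodule_isComPzRing.Build (sfun W) sf_mulA sf_mulC sf_mul1 sf_mulD.

Lemma sfunD u v p : O p -> (u + v) p = u p + v p. Proof. exact: sf_addE. Qed.
Lemma sfunN u p : O p -> (- u) p = - u p. Proof. exact: sf_oppE. Qed.
Lemma sfunM u v p : O p -> (u * v) p = u p * v p. Proof. exact: sf_mulE. Qed.
Lemma sfun0 p : O p -> (0 : sfun W) p = 0. Proof. exact: sfCE. Qed.
Lemma sfun1 p : O p -> (1 : sfun W) p = 1. Proof. exact: sfCE. Qed.

Lemma msmooth_inv u : (forall p, O p -> u p != 0) -> msmooth O (fun p => (u p)^-1).
Proof.
move=> u0 i k; apply: (@CkV _ _ k _ (u \o par i) (@ro i)); last exact: sfun_smooth.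
by move=> x [_ Ox]; exact: u0.
Qed.

Lemma msmooth_sqrt u : (forall p, O p -> 0 < u p) -> msmooth O (fun p => Num.sqrt (u p)).
Proof.
move=> u0 i; apply: (@smooth_sqrt _ _ _ (u \o par i) (@ro i)); last exact: sfun_smooth.
by move=> x [_ Ox]; exact: u0.
Qed.

Section Partial.
Variable i : chart At.
Hypothesis Oi : O `<=` img i.

(** Read in another chart j, this function is a coordinate derivative in chart i composed with the
    transition map, hence smooth. *)
Lemma msmooth_pd a u : msmooth O (fun p => pd a (u \o par i) (coord i p)).
Proof.
move=> j k; have sp : smooth (rdom i O) (pd a (u \o par i)).
  exact/smooth_pd/sfun_sm.
apply: (@Ck_comp _ _ _ _ (rdom j O) (rdom i O) (coord i \o par j)) (sp k) => //.
  by move=> x [dx Ox]; apply: coord_rdom => //; exact: Oi.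
by apply: C_on_sub (transition_smooth j i k) => x [dx Ox]; split => //; exact: Oi.
Qed.

Lemma sf_pd_spec a u :
  {v : sfun W | forall p, O p -> v p = pd a (u \o par i) (coord i p)}.
Proof. by exists (mk_sfun (msmooth_pd a u)) => p; exact: mk_sfunE. Qed.

Definition sf_pd a u := proj1_sig (sf_pd_spec a u).

Lemma sf_pdE a u p : O p -> sf_pd a u p = pd a (u \o par i) (coord i p).
Proof. exact: (proj2_sig (sf_pd_spec a u)). Qed.

Lemma sfun_diff u p : O p -> differentiable (u \o par i) (coord i p).
Proof.
move=> Op; apply: smooth_differentiable (sfun_sm u i) _.
by apply: coord_rdom => //; exact: Oi.
Qed.

Lemma sf_pdD a u v : sf_pd a (u + v) = sf_pd a u + sf_pd a v.
Proof.
apply: sfun_eq => p Op; rewrite sfunD // !sf_pdE // -pdD; try exact: sfun_diff.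
apply: (eq_pd _ (@ro i)); last by apply: coord_rdom => //; exact: Oi.
by move=> x [dx Ox]; exact: (sfunD u v Ox).
Qed.

Lemma sf_pdM a u v : sf_pd a (u * v) = sf_pd a u * v + u * sf_pd a v.
Proof.
apply: sfun_eq => p Op; rewrite sfunD // !sfunM // !sf_pdE //.
transitivity (pd a ((u \o par i) \* (v \o par i)) (coord i p)).
  apply: (eq_pd _ (@ro i)); last by apply: coord_rdom => //; exact: Oi.
  by move=> x [dx Ox]; exact: (sfunM u v Ox).
rewrite pdM /=; try exact: sfun_diff.
by rewrite coordK; [ring|exact: Oi].
Qed.

Lemma sf_pdC a b u : sf_pd a (sf_pd b u) = sf_pd b (sf_pd a u).
Proof.
have rp p : O p -> rdom i O (coord i p).
  by move=> Op; apply: coord_rdom => //; exact: Oi.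
have e c d p : O p -> sf_pd c (sf_pd d u) p = pd c (pd d (u \o par i)) (coord i p).
  move=> Op; rewrite sf_pdE //.
  apply: (eq_pd c (@ro i) _ (rp p Op)) => x [dx Ox].
  have e := sf_pdE d u Ox.
  by rewrite /comp e (parK dx).
apply: sfun_eq => p Op.
have s := schwarz a b (@ro i) (sfun_sm u i) (rp p Op).
exact (etrans (e a b p Op) (etrans s (esym (e b a p Op)))).
Qed.

End Partial.
End Algebra.
End Functions.

(** * Calculus in a moving frame *)

Section Dot.
Variables (C : comPzRingType) (n : nat).
Implicit Types u v : 'rV[C]_n.
Definition dot u v : C := \sum_j u 0 j * v 0 j.
Lemma dotC u v : dot u v = dot v u.
Proof. by apply: eq_bigr => j _; rewrite mulrC. Qed.
Lemma dotDl u v w : dot (u + v) w = dot u w + dot v w.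
Proof. by rewrite -big_split; apply: eq_bigr => j _; rewrite !mxE mulrDl. Qed.
Lemma dotDr u v w : dot u (v + w) = dot u v + dot u w.
Proof. by rewrite dotC dotDl !(dotC u). Qed.
Lemma dotZl a u v : dot (a *: u) v = a * dot u v.
Proof. by rewrite mulr_sumr; apply: eq_bigr => j _; rewrite !mxE mulrA. Qed.
Lemma dotZr a u v : dot u (a *: v) = a * dot u v.
Proof. by rewrite dotC dotZl dotC. Qed.
Lemma dotNl u v : dot (- u) v = - dot u v.
Proof. by rewrite -scaleN1r dotZl mulN1r. Qed.
Lemma dotNr u v : dot u (- v) = - dot u v.
Proof. by rewrite -scaleN1r dotZr mulN1r. Qed.
End Dot.

Section Frame.
Variables (C : comPzRingType) (cj D : C -> C).

Record conj_derivation : Prop := ConjDerivation {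
  cjD : forall a b, cj (a + b) = cj a + cj b ;
  cjM : forall a b, cj (a * b) = cj a * cj b ;
  cjK : forall a, cj (cj a) = a ;
  derD : forall a b, D (a + b) = D a + D b ;
  derM : forall a b, D (a * b) = D a * b + a * D b }.
Hypothesis CD : conj_derivation.

(** The derivation along the conjugate of Z. *)
Definition Db a := cj (D (cj a)).

Lemma cj0 : cj 0 = 0.
Proof. by apply: (addIr (cj 0)); rewrite -(cjD CD) !add0r. Qed.
Lemma cjN a : cj (- a) = - cj a.
Proof. by apply: (addIr (cj a)); rewrite -(cjD CD) !addNr cj0. Qed.
Lemma cj1 : cj 1 = 1.
Proof. by rewrite -[RHS](cjK CD) -[cj 1 in RHS]mul1r (cjM CD) (cjK CD) mulr1. Qed.
Lemma cjMn a k : cj (a *+ k) = cj a *+ k.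
Proof. by elim: k => [|k IH]; rewrite ?cj0 // !mulrS (cjD CD) IH. Qed.
Lemma der0 : D 0 = 0.
Proof. by apply: (addIr (D 0)); rewrite -(derD CD) !add0r. Qed.
Lemma derN a : D (- a) = - D a.
Proof. by apply: (addIr (D a)); rewrite -(derD CD) !addNr der0. Qed.
Lemma derMn a k : D (a *+ k) = D a *+ k.
Proof. by elim: k => [|k IH]; rewrite ?der0 // !mulrS (derD CD) IH. Qed.
Lemma der1 : D 1 = 0.
Proof. by apply: (addIr (D 1)); rewrite add0r -[in RHS](mulr1 1) (derM CD) mulr1 mul1r. Qed.
Lemma DbD a b : Db (a + b) = Db a + Db b.
Proof. by rewrite /Db (cjD CD) (derD CD) (cjD CD). Qed.
Lemma DbM a b : Db (a * b) = Db a * b + a * Db b.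
Proof. by rewrite /Db (cjM CD) (derM CD) (cjD CD) !(cjM CD) !(cjK CD). Qed.
Lemma Db0 : Db 0 = 0. Proof. by rewrite /Db cj0 der0 cj0. Qed.
Lemma DbN a : Db (- a) = - Db a. Proof. by rewrite /Db cjN derN cjN. Qed.
Lemma Db1 : Db 1 = 0. Proof. by rewrite /Db cj1 der1 cj0. Qed.
Lemma DbMn a k : Db (a *+ k) = Db a *+ k.
Proof. by rewrite /Db cjMn derMn cjMn. Qed.
Lemma cjDer a : cj (D a) = Db (cj a). Proof. by rewrite /Db (cjK CD). Qed.
Lemma cjDb a : cj (Db a) = D (cj a). Proof. by rewrite /Db (cjK CD). Qed.

Definition cjE := ((cjD CD), cjN, (cjM CD), (cjK CD), cj0, cj1, cjMn, cjDer, cjDb).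
Definition derE := ((derD CD), derN, (derM CD), der0, der1, derMn).
Definition DbE := (DbD, DbN, DbM, Db0, Db1, DbMn).

Section Weights.
Variable rho : C.
Hypothesis comm : forall a, D (Db a) - Db (D a) = rho * Db a - cj rho * D a.

(* D is the derivation along a unit null frame Z and rho its structure function.
   A quantity of weight w is multiplied by lam ^ w when Z is replaced by lam Z;
   dd and db are the resulting covariant derivatives, frK is the Gauss curvature
   and lap half the Laplacian. *)
Definition dd w a := D a + rho *+ w * a.
Definition db w a := Db a - cj rho *+ w * a.
Definition frK := Db rho + D (cj rho) - (rho * cj rho) *+ 2.
Definition lap a := db 1 (D a).

Lemma dd0 a : dd 0 a = D a. Proof. by rewrite /dd mulr0n mul0r addr0. Qed.

(** Ricci identity: the curvature acts on a quantity through its weight. Successors keep all weights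
    that occur natural numbers, as [db] lowers the weight. *)
Lemma comm_w w a : db w.+2 (dd w.+1 a) = dd w (db w.+1 a) + (frK *+ w.+1) * a.
Proof.
have := comm a; rewrite /db /dd /frK !(derE, DbE) => e.
apply/eqP; rewrite -subr_eq0; apply/eqP.
transitivity (- (D (Db a) - Db (D a) - (rho * Db a - cj rho * D a))).
  by ring.
by rewrite e subrr oppr0.
Qed.

Lemma comm_0 a : db 1 (D a) = Db (D a) - cj rho * D a.
Proof. by rewrite /db mulr1n. Qed.

(** Conjugation exchanges the two orders of differentiation, and [comm] says that with the
    connection terms they agree. *)
Lemma cj_lap a : cj (lap a) = lap (cj a).
Proof.
have := comm (cj a); rewrite /lap !comm_0 !cjE => e.
apply/eqP; rewrite -subr_eq0 -{}[X in _ == X]oppr0; apply/eqP.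
transitivity (D (Db (cj a)) - Db (D (cj a)) - (rho * Db (cj a) - cj rho * D (cj a))); first by ring.
by rewrite e subrr oppr0.
Qed.

Lemma lapD a b : lap (a + b) = lap a + lap b.
Proof. by rewrite /lap !comm_0 !(derE, DbE); ring. Qed.
Lemma lapM a b : lap (a * b) = lap a * b + a * lap b + D a * Db b + Db a * D b.
Proof. by rewrite /lap !comm_0 !(derE, DbE); ring. Qed.

Lemma ddM k l a b : dd (k + l) (a * b) = dd k a * b + a * dd l b.
Proof. by rewrite /dd !derE; ring. Qed.
Lemma dbM k l a b : db (k + l) (a * b) = db k a * b + a * db l b.
Proof. by rewrite /db !DbE; ring. Qed.
Lemma ddD k a b : dd k (a + b) = dd k a + dd k b.
Proof. by rewrite /dd !derE; ring. Qed.
Lemma dbD k a b : db k (a + b) = db k a + db k b.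
Proof. by rewrite /db !DbE; ring. Qed.

Section Vectors.
Variable n : nat.
Implicit Types u v : 'rV[C]_n.
Definition vc u : 'rV[C]_n := map_mx cj u.
Definition vD u : 'rV[C]_n := map_mx D u.
Definition vdd w u : 'rV[C]_n := map_mx (dd w) u.
Definition vdb w u : 'rV[C]_n := map_mx (db w) u.
Definition hm u v : C := dot u (vc v).

Lemma vcK u : vc (vc u) = u.
Proof. by apply/rowP => j; rewrite !mxE (cjK CD). Qed.
Lemma vcD u v : vc (u + v) = vc u + vc v.
Proof. by apply/rowP => j; rewrite !mxE (cjD CD). Qed.
Lemma vcN u : vc (- u) = - vc u.
Proof. by apply/rowP => j; rewrite !mxE cjN. Qed.
Lemma vcZ a u : vc (a *: u) = cj a *: vc u.
Proof. by apply/rowP => j; rewrite !mxE (cjM CD). Qed.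

Lemma cj_sum (I : finType) (F : I -> C) : cj (\sum_i F i) = \sum_i cj (F i).
Proof. by apply: big_morph => [a b|]; rewrite ?(cjD CD) ?cj0. Qed.
Lemma D_sum (I : finType) (F : I -> C) : D (\sum_i F i) = \sum_i D (F i).
Proof. by apply: big_morph => [a b|]; rewrite ?(derD CD) ?der0. Qed.
Lemma cj_dot u v : cj (dot u v) = dot (vc u) (vc v).
Proof. by rewrite /dot cj_sum; apply: eq_bigr => j _; rewrite (cjM CD) !mxE. Qed.
Lemma D_dot u v : D (dot u v) = dot (vD u) v + dot u (vD v).
Proof.
by rewrite /dot D_sum -big_split; apply: eq_bigr => j _; rewrite (derM CD) !mxE.
Qed.

Lemma hmDl u v w : hm (u + v) w = hm u w + hm v w.
Proof. exact: dotDl. Qed.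
Lemma hmZl a u v : hm (a *: u) v = a * hm u v.
Proof. exact: dotZl. Qed.
Lemma hmNl u v : hm (- u) v = - hm u v.
Proof. exact: dotNl. Qed.
Lemma hmDr u v w : hm w (u + v) = hm w u + hm w v.
Proof. by rewrite /hm vcD dotDr. Qed.
Lemma hmZr a u v : hm u (a *: v) = cj a * hm u v.
Proof. by rewrite /hm vcZ dotZr. Qed.
Lemma hmNr u v : hm v (- u) = - hm v u.
Proof. by rewrite /hm vcN dotNr. Qed.
Lemma cj_hm u v : cj (hm u v) = hm v u.
Proof. by rewrite /hm cj_dot vcK dotC. Qed.
Lemma hm_orth_comb a u v : hm u v = 0 ->
  hm (u + a *: v) (u + a *: v) = hm u u + a * cj a * hm v v.
Proof.
move=> e; have e' : hm v u = 0 by rewrite -cj_hm e cj0.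
by rewrite !(hmDl, hmZl, hmDr, hmZr) e e'; ring.
Qed.
Definition hmE := (hmDl, hmZl, hmNl, hmDr, hmZr, hmNr).

(** Conjugation negates weights, so [hm u v] has weight k when u has weight [w + k] and v has weight
    w; for the same reason the second argument is hit by [vdb]. *)
Lemma dd_hm k w u v : dd k (hm u v) = hm (vdd (w + k) u) v + hm u (vdb w v).
Proof.
rewrite /dd /hm /dot D_sum mulr_sumr -!big_split; apply: eq_bigr => j _ /=.
rewrite !mxE /dd /db !(derE, cjE, DbE); ring.
Qed.
Lemma db_hm k w u v : db k (hm u v) = hm (vdb (w + k) u) v + hm u (vdd w v).
Proof.
rewrite /db /Db cj_hm /hm /dot D_sum cj_sum mulr_sumr -sumrN -!big_split.
apply: eq_bigr => j _ /=; rewrite !mxE /dd /db !(derE, cjE, DbE); ring.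
Qed.
Lemma D_hm w u v : D (hm u v) = hm (vdd w u) v + hm u (vdb w v).
Proof. by rewrite -dd0 (dd_hm 0 w) addn0. Qed.
Lemma vddD w u v : vdd w (u + v) = vdd w u + vdd w v.
Proof. by apply/rowP => j; rewrite !mxE ddD. Qed.
Lemma vdbD w u v : vdb w (u + v) = vdb w u + vdb w v.
Proof. by apply/rowP => j; rewrite !mxE dbD. Qed.
Lemma vddZ k w a u : vdd (k + w) (a *: u) = dd k a *: u + a *: vdd w u.
Proof. by apply/rowP => j; rewrite !mxE ddM. Qed.
Lemma vdbZ k w a u : vdb (k + w) (a *: u) = db k a *: u + a *: vdb w u.
Proof. by apply/rowP => j; rewrite !mxE dbM. Qed.
Lemma vdd_comm w u : vdb w.+2 (vdd w.+1 u) = vdd w (vdb w.+1 u) + (frK *+ w.+1) *: u.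
Proof. by apply/rowP => j; rewrite !mxE comm_w. Qed.

(* One step of the harmonic sequence: psi, of weight k + 1, is the component of
   the derivative of phi orthogonal to phi. *)
Section Step.
(** [ai] stands for 1 / |phi|^2 and [al] for D |phi|^2 / |phi|^2; they are 1 and 0 when phi is the
    unit tangent vector that starts the sequence. *)
Variables (k : nat) (phi psi : 'rV[C]_n) (al ai : C).
Hypothesis orth : hm psi phi = 0.
Hypothesis ddphi : vdd k phi = psi + al *: phi.
Hypothesis dbpsi : vdb k.+1 psi = - (hm psi psi * ai) *: phi.
Hypothesis D_ai : D ai = - (ai * al).
Let b := hm psi psi.
Let eta := vdd k.+1 psi.

Let orthC : hm phi psi = 0.
Proof. by rewrite -cj_hm orth cj0. Qed.

Let b_real : cj b = b. Proof. exact: cj_hm. Qed.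

Lemma step_D : D b = hm eta psi.
Proof. by rewrite /b (D_hm k.+1) dbpsi !hmE orth mulr0 addr0. Qed.

Lemma step_db_eta : vdb k.+2 eta =
  (frK *+ k.+1 - b * ai) *: psi - (D (b * ai) + b * ai * al) *: phi.
Proof.
rewrite /eta vdd_comm dbpsi (vddZ 0 k) dd0 ddphi -/b.
by apply/rowP => j; rewrite !mxE derN; ring.
Qed.

(** Bochner formula: [D b = hm eta psi], and the second differentiation sees only the psi component
    of [step_db_eta], since phi is orthogonal to psi. *)
Lemma step_lap : lap b = (frK *+ k.+1 - b * ai) * b + hm eta eta.
Proof.
rewrite /lap step_D (db_hm 1 k.+1) addn1 step_db_eta -/eta hmDl hmNl !hmZl orthC -/b; ring.
Qed.

Variable bi : C.
Hypothesis bK : b * bi = 1.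
Let psi' := eta - (D b * bi) *: psi.
Let b' := hm psi' psi'.

Lemma step_orth : hm psi' psi = 0.
Proof.
rewrite /psi' !hmE -step_D -/b -[X in X - _]mulr1 -bK; ring.
Qed.

(** The next vector satisfies the same relation as psi, which makes the step iterable. *)
Lemma step_db : vdb k.+2 psi' = - (b' * bi) *: psi.
Proof.
(* The phi components cancel by [D_ai], which leaves an unknown multiple of psi; differentiating
   [hm psi' psi = 0] then determines the multiple. *)
have [ka kaE] : exists ka, vdb k.+2 psi' = ka *: psi.
  exists (frK *+ k.+1 - b * ai - db 1 (D b * bi)).
  rewrite /psi' -scaleNr vdbD step_db_eta (vdbZ 1 k.+1) dbpsi -/b.
  have -> : D (b * ai) + b * ai * al = D b * ai.
    by rewrite (derM CD) D_ai; ring.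
  apply/rowP => j; rewrite !mxE.
  have -> : db 1 (- (D b * bi)) = - db 1 (D b * bi) by rewrite /db DbN; ring.
  rewrite -[X in _ - X * _]mulr1 -bK; ring.
have e : ka * b = - b'.
  have : db 1 (hm psi' psi) = 0 by rewrite step_orth /db Db0 mulr0 subr0.
  rewrite (db_hm 1 k.+1) addn1 kaE hmZl -/b => /eqP.
  rewrite addr_eq0 => /eqP ->; congr (- _).
  have -> : vdd k.+1 psi = psi' + (D b * bi) *: psi by rewrite /psi' subrK.
  by rewrite hmDr hmZr step_orth mulr0 addr0.
rewrite kaE; congr (_ *: _).
by rewrite -[LHS]mulr1 -bK mulrA e mulNr.
Qed.
End Step.
End Vectors.
End Weights.
End Frame.

(** * Surfaces with parallel mean curvature vector *)

Section Immersion.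
Variables (C : comPzRingType) (cj D : C -> C) (CD : conj_derivation cj D).
Variable n : nat.
Variable F : 'rV[C]_n.
(* F is the position vector; fr2 is h(Z, Z), fr_H the mean curvature vector and
   fr_Q the Hopf differential. *)
Definition fr1 := vD D F.
Definition fr_rho := - dot (vD D fr1) (vc cj fr1).
Definition fr2 := vdd D fr_rho 1 fr1.
Definition fr_H := vdb cj D fr_rho 1 fr1 + F.
Definition fr_Q := dot fr_H fr2.

(** Stands in for division by 2: differentiating a symmetric product such as [dot F F] yields twice
    the product that is wanted. *)
Hypothesis half : forall a : C, a + a = 0 -> a = 0.
Hypothesis F_real : vc cj F = F.
Hypothesis F_unit : dot F F = 1.
Hypothesis f1_null : dot fr1 fr1 = 0.
Hypothesis f1_unit : hm cj fr1 fr1 = 1.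
Hypothesis comm : forall a,
  D (Db cj D a) - Db cj D (D a) = fr_rho * Db cj D a - cj fr_rho * D a.
Hypothesis H_parallel : exists x y, vD D fr_H = x *: fr1 + y *: vc cj fr1.

Let f1 := fr1.
Let fm := vc cj fr1.
Let rho := fr_rho.
Let H := fr_H.
Let f2 := fr2.

Lemma dotFf1 : dot F f1 = 0.
Proof.
apply: half; rewrite {1}dotC /f1 /fr1 -(D_dot CD) F_unit; exact: (der1 CD).
Qed.
Lemma fm1 : dot f1 fm = 1. Proof. exact: f1_unit. Qed.
Lemma dotFfm : dot F fm = 0.
Proof. by rewrite -F_real /fm -(cj_dot CD) dotFf1 (cj0 CD). Qed.
Lemma fmfm : dot fm fm = 0.
Proof. by rewrite /fm -(cj_dot CD) f1_null (cj0 CD). Qed.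

(** [H - F] is the Laplacian of the real vector F, and [lap] commutes with conjugation. *)
Lemma H_real : vc cj H = H.
Proof.
rewrite /H /fr_H (vcD CD) F_real; congr (_ + _); apply/rowP => j; rewrite !mxE.
rewrite -/(lap cj D rho (F 0 j)) (cj_lap CD comm); congr lap.
by have /rowP/(_ j) := F_real; rewrite mxE.
Qed.

Lemma ddf1 : vD D f1 = f2 - rho *: f1.
Proof. by apply/rowP => j; rewrite !mxE /dd mulr1n addrK. Qed.

Lemma f2f1 : dot f2 f1 = 0.
Proof.
have e : dot (vD D f1) f1 = 0.
  by apply: half; rewrite {2}dotC -(D_dot CD) f1_null (der0 CD).
have -> : f2 = vD D f1 + rho *: f1 by rewrite ddf1 subrK.
by rewrite dotDl dotZl e f1_null mulr0 addr0.
Qed.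

Lemma f2fm : dot f2 fm = 0.
Proof.
have -> : f2 = vD D f1 + rho *: f1 by rewrite ddf1 subrK.
by rewrite dotDl dotZl fm1 /rho /fr_rho mulr1 subrr.
Qed.

Lemma Dfm : vD D fm = H - F + rho *: fm.
Proof.
have -> : vD D fm = vc cj (vdb cj D rho 1 f1 + cj rho *: f1).
  by apply/rowP => j; rewrite !mxE /db /Db mulr1n subrK (cjK CD).
have -> : vdb cj D rho 1 f1 = H - F by rewrite /H /fr_H addrK.
by rewrite 2!(vcD CD) (vcN CD) (vcZ CD) (cjK CD) H_real F_real.
Qed.

Lemma fmf1 : dot fm f1 = 1. Proof. by rewrite dotC fm1. Qed.

Lemma Hfm_Ffm : dot H fm = 0.
Proof.
have e : dot (vD D fm) fm = 0.
  by apply: half; rewrite {2}dotC -(D_dot CD) fmfm (der0 CD).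
have := e; rewrite Dfm !(dotDl, dotNl, dotZl) dotFfm fmfm oppr0 mulr0 !addr0.
by [].
Qed.

Lemma Hf1 : dot H f1 = 0.
Proof.
have := congr1 cj Hfm_Ffm; rewrite (cj_dot CD) H_real (cj0 CD) /fm (vcK CD).
by [].
Qed.

Lemma HF : dot H F = 0.
Proof.
have := congr1 D dotFfm; rewrite (D_dot CD) (der0 CD) -/fr1 -/f1 fm1 Dfm.
rewrite 2!dotDr dotNr dotZr F_unit dotFfm mulr0 addr0 (dotC F H) => e.
by rewrite -[RHS]e; ring.
Qed.

Definition fr_hh := dot H H.
Let hh := fr_hh.

(** The two tangential coefficients come from differentiating [dot H f1 = 0] and [dot H fm = 0]. *)
Lemma HDfm : vD D H = - hh *: f1 - fr_Q *: fm.
Proof.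
have [x [y e]] := H_parallel.
have ey : y = - fr_Q.
  have := congr1 D Hf1; rewrite (D_dot CD) (der0 CD) e dotDl !dotZl f1_null ddf1.
  rewrite dotDr dotNr dotZr Hf1 -/fm fmf1 -/f2 -/fr_Q => e1.
  by apply/eqP; rewrite -addr_eq0; apply/eqP; rewrite -[RHS]e1; ring.
have ex : x = - hh.
  have := congr1 D Hfm_Ffm; rewrite (D_dot CD) (der0 CD) e dotDl !dotZl -/fm -/f1.
  rewrite fm1 fmfm Dfm 2!dotDr dotNr dotZr HF Hfm_Ffm -/fr_hh -/hh => e1.
  by apply/eqP; rewrite -addr_eq0; apply/eqP; rewrite -[RHS]e1; ring.
by rewrite e ex ey (scaleNr fr_Q).
Qed.

Lemma D_hh : D hh = 0.
Proof.
rewrite /hh /fr_hh (D_dot CD) (dotC _ H) -/H HDfm dotDr dotNr !dotZr Hf1 Hfm_Ffm.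
ring.
Qed.

Let Kc := frK cj D rho.
Let t := hm cj f2 f2.

(** Codazzi equation in disguise: the Ricci identity on f1 turns the left side into the derivative
    of [H - F], which is tangential because H is parallel. *)
Lemma dbf2_raw : vdb cj D rho 2 f2 = (Kc - (1 + hh)) *: f1 - fr_Q *: fm.
Proof.
rewrite /f2 /fr2 (vdd_comm CD comm) mulr1n.
have -> : vdb cj D fr_rho 1 fr1 = H - F by rewrite /H /fr_H addrK.
have gen u v : vdd D fr_rho 0 (u - v) = vD D u - vD D v :> 'rV_n.
  by apply/rowP => j; rewrite !mxE dd0 !(derE CD).
rewrite gen -/(fr1) -/H -/f1.
rewrite HDfm -/Kc; move: f1 fm Kc => u v k; apply/rowP => j; rewrite !mxE. ring.
Qed.

(** Gauss equation. Differentiating [hm f2 f1 = 0] pairs the f1 coefficient of [dbf2_raw] with t,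
    and this determines the curvature. *)
Lemma Gauss : Kc = 1 + hh - t.
Proof.
have e : db cj D rho 1 (hm cj f2 f1) = 0.
  by rewrite /hm f2fm /db (Db0 CD) mulr0 subr0.
have := e; rewrite (db_hm CD _ 1 1) dbf2_raw hmDl hmZl hmNl hmZl.
rewrite (_ : hm cj f1 f1 = 1); last exact: f1_unit. rewrite (_ : hm cj fm f1 = 0); last exact: fmfm.
rewrite (_ : hm cj f2 (vdd D rho 1 f1) = t); last by [].
by move=> e1; apply/eqP; rewrite -subr_eq0; apply/eqP; rewrite -[RHS]e1; ring.
Qed.

Lemma db_f2 : vdb cj D rho 2 f2 = - t *: f1 - fr_Q *: fm.
Proof. by rewrite dbf2_raw Gauss; congr (_ *: _ - _); ring. Qed.

(** The Hopf differential is holomorphic: Q is a product of the normal vectors f2 and H, and the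
    derivatives of both that occur here are tangential. *)
Lemma db_Q : db cj D rho 2 fr_Q = 0.
Proof.
have -> : fr_Q = hm cj f2 H by rewrite /hm H_real dotC.
rewrite (db_hm CD _ 2 0) (_ : vdb _ _ _ _ _ = - t *: f1 - fr_Q *: fm); last exact: db_f2.
have -> : vdd D fr_rho 0 fr_H = - hh *: f1 - fr_Q *: fm.
  by rewrite -HDfm; apply/rowP => j; rewrite !mxE dd0.
rewrite (_ : hm cj (_ - _) fr_H = 0); last first.
  rewrite /hm H_real dotDl dotNl !dotZl (dotC f1 H) Hf1 (dotC fm H) Hfm_Ffm; ring.
rewrite (hmDr CD) (hmNr CD) !(hmZr CD) (_ : hm cj fr2 f1 = 0); last exact: f2fm.
rewrite (_ : hm cj fr2 fm = 0); last by rewrite /hm (vcK CD) f2f1.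
by ring.
Qed.

(** Bochner formula of a holomorphic quadratic differential; where the curvature is positive it
    forces |Q|^2 to vanish at a maximum. *)
Lemma lap_Q : lap cj D rho (fr_Q * cj fr_Q) =
  Kc *+ 2 * (fr_Q * cj fr_Q) + dd D rho 2 fr_Q * cj (dd D rho 2 fr_Q).
Proof.
have e : db cj D rho 2 fr_Q = 0 by exact: db_Q.
have e2 : D (cj fr_Q) = rho *+ 2 * cj fr_Q.
  have := congr1 cj e; rewrite /db !(cjE CD) => e1.
  by apply/eqP; rewrite -subr_eq0; apply/eqP; rewrite -[RHS]e1; ring.
have e3 : Db cj D (cj fr_Q) = cj (dd D rho 2 fr_Q) - cj rho *+ 2 * cj fr_Q.
  by rewrite /dd !(cjE CD); ring.
have := comm_w CD comm 1 fr_Q; rewrite -/rho e [dd _ _ 1 0]/dd (der0 CD).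
set q := fr_Q in e e2 e3 *; set q2 := dd D rho 2 q => e4.
have e5 : D (q * cj q) = q2 * cj q.
  by rewrite (derM CD) e2 /q2 /dd; ring.
have e6 : Db cj D q2 = Kc *+ 2 * q + cj rho *+ 3 * q2.
  have := e4; rewrite /db -/Kc => e7.
  by apply/eqP; rewrite -subr_eq0; move/eqP: e7; rewrite -subr_eq0 => /eqP e7; apply/eqP; rewrite -[RHS]e7; ring.
rewrite /lap comm_0 e5 (DbM CD) e3 e6; ring.
Qed.

End Immersion.

(** * The harmonic sequence of a minimal surface *)

Section Minimal.
Variables (C : comPzRingType) (cj D : C -> C) (CD : conj_derivation cj D).
Variable rho : C.
Hypothesis comm : forall a,
  D (Db cj D a) - Db cj D (D a) = rho * Db cj D a - cj rho * D a.
Variables (n : nat) (f1 : 'rV[C]_n) (ti ri : C).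

(* The harmonic sequence of a minimal surface; ti and ri stand for the inverses
   of mt = |mf2|^2 and mr = |mpsi3|^2. *)
Definition mf2 := vdd D rho 1 f1.
Definition mt := hm cj mf2 mf2.
Definition mpsi3 := vdd D rho 2 mf2 - (D mt * ti) *: mf2.
Definition mr := hm cj mpsi3 mpsi3.
Definition meta := vdd D rho 3 mpsi3.
Definition mN := hm cj meta meta.
Definition mxi := hm cj meta mpsi3.
Definition mpsi4 := meta - (D mr * ri) *: mpsi3.
Definition mtau := hm cj mpsi4 mpsi4.

Hypothesis f1_unit : hm cj f1 f1 = 1.
Hypothesis f2f1 : hm cj mf2 f1 = 0.
Hypothesis f2n : hm cj mf2 (vdb cj D rho 1 f1) = 0.
Hypothesis db_f2 : vdb cj D rho 2 mf2 = - mt *: f1.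
Hypothesis gauss : frK cj D rho = 1 - mt.
Hypothesis tK : mt * ti = 1.

Let lapC := lap cj D rho.

Lemma cj_inv (a b : C) : cj a = a -> a * b = 1 -> cj b = b.
Proof.
move=> ea ab; have e : a * cj b = 1 by rewrite -{1}ea -(cjM CD) ab (cj1 CD).
by rewrite -[LHS]mul1r -ab mulrAC e mul1r.
Qed.

Lemma D_inv (a b : C) : a * b = 1 -> D b = - (b * (D a * b)).
Proof.
move=> ab; have := congr1 D ab; rewrite (derM CD) (der1 CD) => e.
have -> : D b = (a * D b) * b by rewrite mulrAC ab mul1r.
have -> : a * D b = - (D a * b) by apply/eqP; rewrite -addr_eq0 addrC e.
by ring.
Qed.

Lemma mt_real : cj mt = mt. Proof. exact: (cj_hm CD). Qed.
Lemma mr_real : cj mr = mr. Proof. exact: (cj_hm CD). Qed.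
Lemma mN_real : cj mN = mN. Proof. exact: (cj_hm CD). Qed.
Lemma mtau_real : cj mtau = mtau. Proof. exact: (cj_hm CD). Qed.
Lemma ti_real : cj ti = ti. Proof. exact: cj_inv mt_real tK. Qed.

(** The first step of the sequence has phi = f1 and psi = mf2, with [al = 0] and [ai = 1]; the later
    steps have phi = mf2 and phi = mpsi3. *)
Let s1_dd : vdd D rho 1 f1 = mf2 + 0 *: f1.
Proof. by rewrite scale0r addr0. Qed.
Let s1_db : vdb cj D rho 2 mf2 = - (hm cj mf2 mf2 * 1) *: f1.
Proof. by rewrite mulr1 db_f2. Qed.
Let s1_D : D 1 = - (1 * 0). Proof. by rewrite (der1 CD) mulr0 oppr0. Qed.

Lemma psi3f2 : hm cj mpsi3 mf2 = 0.
Proof. exact: (step_orth CD f2f1 s1_db tK). Qed.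

Lemma db_psi3 : vdb cj D rho 3 mpsi3 = - (mr * ti) *: mf2.
Proof. exact: (step_db CD comm f2f1 s1_dd s1_db s1_D tK). Qed.

Let dd_f2 : vdd D rho 2 mf2 = mpsi3 + (D mt * ti) *: mf2.
Proof. by rewrite /mpsi3 subrK. Qed.
Let psi3E : mpsi3 = vdd D rho 2 mf2 - (D mt * ti) *: mf2.
Proof. by []. Qed.
Let f2psi3 : hm cj mf2 mpsi3 = 0.
Proof. by rewrite -(cj_hm CD) psi3f2 (cj0 CD). Qed.

Lemma lap_mt : lapC mt = (2%:R - mt *+ 3) * mt + mr + D mt * cj (D mt) * ti.
Proof.
have := step_lap CD comm f2f1 s1_dd s1_db.
rewrite -/(mt) -/lapC => ->; rewrite gauss dd_f2.
rewrite (hm_orth_comb CD _ psi3f2) -/mr -/mt (cjM CD) ti_real.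
transitivity ((2%:R - mt *+ 3) * mt + mr + D mt * cj (D mt) * ti * (mt * ti)).
  ring.
by rewrite tK mulr1.
Qed.

Lemma D_mr : D mr = mxi.
Proof. exact: (step_D CD psi3f2 db_psi3). Qed.

Lemma lap_mr : lapC mr = ((1 - mt) *+ 3 - mr * ti) * mr + mN.
Proof.
by have := step_lap CD comm psi3f2 dd_f2 db_psi3; rewrite gauss.
Qed.

Lemma db_eta : vdb cj D rho 4 meta =
  ((1 - mt) *+ 3 - mr * ti) *: mpsi3 - (mxi * ti) *: mf2.
Proof.
have := step_db_eta CD comm dd_f2 db_psi3; rewrite -/meta -/mr gauss => ->.
congr (_ - _ *: _); rewrite (derM CD) D_mr (D_inv tK); ring.
Qed.

(** Differentiate [hm mpsi3 mf2 = 0]. The remaining term pairs mpsi3 with f1, and it vanishes by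
    differentiating [hm mf2 f1 = 0] and using [f2n]. *)
Lemma etaf2 : hm cj meta mf2 = 0.
Proof.
have e : dd D rho 1 (hm cj mpsi3 mf2) = 0 by rewrite psi3f2 /dd (der0 CD) mulr0 addr0.
have := e; rewrite (dd_hm CD _ 1 2) db_f2 (hmZr CD) (_ : hm cj mpsi3 f1 = 0) ?mulr0 ?addr0 //.
rewrite psi3E hmDl hmNl hmZl f2f1 mulr0 oppr0 addr0.
have e2 : dd D rho 1 (hm cj mf2 f1) = 0 by rewrite f2f1 /dd (der0 CD) mulr0 addr0.
by have := e2; rewrite (dd_hm CD _ 1 1) f2n addr0.
Qed.

Let f2eta : hm cj mf2 meta = 0.
Proof. by rewrite -(cj_hm CD) etaf2 (cj0 CD). Qed.

Let sg := mr * ti.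

Lemma ddb_eta : hm cj (vdd D rho 3 (vdb cj D rho 4 meta)) meta =
  ((1 - mt) *+ 3 - sg) * mN - (mxi * cj mxi * ti) *+ 2
  + (sg * ti - 3%:R) * (D mt * cj mxi).
Proof.
rewrite db_eta -scaleNr (vddD CD) (vddZ CD _ 0 3) (vddZ CD _ 1 2) dd_f2 dd0.
have gen (p e f : 'rV[C]_n) a b c d x : hm cj f e = 0 ->
    hm cj ((a *: p + b *: e) + (c *: f + d *: (p + x *: f))) e =
    a * hm cj p e + b * hm cj e e + d * hm cj p e.
  by move=> e0; rewrite !(hmDl, hmZl) e0; ring.
rewrite gen // -/mN (_ : hm cj mpsi3 meta = cj mxi); last by rewrite (cj_hm CD).
have -> : D ((1 - mt) *+ 3 - mr * ti) =
    - (D mt) *+ 3 - mxi * ti + sg * (D mt * ti).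
  rewrite !(derE CD) D_mr (D_inv tK) /sg; ring.
rewrite /sg; ring.
Qed.

(** The vector meta is not orthogonal to mpsi3, so [step_lap] does not apply to it. The product rule
    gives |dd meta|^2, |db meta|^2 and two mixed terms; after the Ricci identity has reordered one
    of them, these are [ddb_eta] and its conjugate. *)
Lemma lap_mN : lapC mN =
  hm cj (vdd D rho 4 meta) (vdd D rho 4 meta)
  + ((1 - mt) *+ 3 - sg) ^+ 2 * mr + mxi * cj mxi * ti
  + (1 - mt) *+ 4 * mN
  + (((1 - mt) *+ 3 - sg) * mN - (mxi * cj mxi * ti) *+ 2) *+ 2
  + (sg * ti - 3%:R) * (D mt * cj mxi + cj (D mt) * mxi).
Proof.
rewrite /lapC /lap {1}/mN (D_hm CD rho 4) (dbD CD) (db_hm CD _ 1 4) (db_hm CD _ 1 3).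
have -> : vdb cj D rho 5 (vdd D rho 4 meta) =
    vdd D rho 3 (vdb cj D rho 4 meta) + (1 - mt) *+ 4 *: meta.
  by rewrite (vdd_comm CD comm) gauss.
have e1 : hm cj meta (vdd D rho 3 (vdb cj D rho 4 meta)) =
   ((1 - mt) *+ 3 - sg) * mN - (mxi * cj mxi * ti) *+ 2
  + (sg * ti - 3%:R) * (cj (D mt) * mxi).
  rewrite -(cj_hm CD) ddb_eta; have := cj_hm CD; have := ti_real.
  rewrite /sg !((cjD CD), (cjN CD), (cjM CD), (cjMn CD)) mt_real mr_real mN_real.
  by move=> -> _; rewrite (cjK CD) (cj1 CD); ring.
have e2 : hm cj (vdb cj D rho 4 meta) (vdb cj D rho 4 meta) =
    ((1 - mt) *+ 3 - sg) ^+ 2 * mr + mxi * cj mxi * ti.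
  rewrite db_eta -scaleNr.
  have gen (p f : 'rV[C]_n) a b : hm cj p f = 0 ->
      hm cj (a *: p + b *: f) (a *: p + b *: f) = a * cj a * hm cj p p + b * cj b * hm cj f f.
    move=> e0; have e0' : hm cj f p = 0 by rewrite -(cj_hm CD) e0 (cj0 CD).
    by rewrite !(hmDl, hmZl, hmDr CD, hmZr CD) e0 e0'; ring.
  rewrite gen ?psi3f2 // -/mr -/mt.
  rewrite !((cjD CD), (cjN CD), (cjM CD), (cjMn CD)) mt_real mr_real ti_real (cj1 CD).
  rewrite /sg; transitivity (((1 - mt) *+ 3 - mr * ti) ^+ 2 * mr + mxi * cj mxi * ti * (mt * ti)); first by ring.
  by rewrite tK mulr1.
rewrite hmDl hmZl -/mN ddb_eta e1 e2; ring.
Qed.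

Hypothesis rK : mr * ri = 1.

Lemma psi4_orth : hm cj mpsi4 mpsi3 = 0.
Proof. exact: (step_orth CD psi3f2 db_psi3 rK). Qed.

Lemma db_psi4 : vdb cj D rho 4 mpsi4 = - (mtau * ri) *: mpsi3.
Proof.
apply: (step_db CD comm psi3f2 dd_f2 db_psi3 _ rK).
by rewrite (D_inv tK); ring.
Qed.

Lemma D_mtau : D mtau = hm cj (vdd D rho 4 mpsi4) mpsi4.
Proof. exact: (step_D CD psi4_orth db_psi4). Qed.

Lemma lap_mtau : lapC mtau = ((1 - mt) *+ 4 - mtau * ri) * mtau
  + hm cj (vdd D rho 4 mpsi4) (vdd D rho 4 mpsi4).
Proof.
have dd_psi3 : vdd D rho 3 mpsi3 = mpsi4 + (D mr * ri) *: mpsi3.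
  by rewrite /mpsi4 subrK.
by have := step_lap CD comm psi4_orth dd_psi3 db_psi4; rewrite gauss.
Qed.

(** Pythagoras: mpsi4 is meta without its mpsi3 component, whose coefficient is mxi / mr. *)
Lemma mtauE : mtau = mN - mxi * cj mxi * ri.
Proof.
have e : meta = mpsi4 + (mxi * ri) *: mpsi3 by rewrite /mpsi4 D_mr subrK.
rewrite /mN {1 2}e (hm_orth_comb CD _ psi4_orth) -/mtau -/mr.
rewrite (cjM CD) (cj_inv mr_real rK).
transitivity (mtau + mxi * cj mxi * ri * (mr * ri - 1)); last by ring.
by rewrite rK subrr mulr0 addr0.
Qed.

End Minimal.

(** * Changes of frame *)

Section Morphism.
Variables (C C' : comPzRingType) (cj D : C -> C) (cj' D' : C' -> C').
Variables (CD : conj_derivation cj D) (CD' : conj_derivation cj' D').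

(* A change of chart sends the frame Z to lam Z, or to lam times the conjugate
   of Z; the second case becomes the first after composing th with cj. *)
Record frame_morph (th : C -> C') (lam : C') : Prop := FrameMorph {
  thD : forall a b, th (a + b) = th a + th b ;
  thM : forall a b, th (a * b) = th a * th b ;
  th_cj : forall a, th (cj a) = cj' (th a) ;
  th_der : forall a, D' (th a) = lam * th (D a) ;
  lamK : lam * cj' lam = 1 }.

Variables (th : C -> C') (lam : C') (FM : frame_morph th lam).

Lemma th0 : th 0 = 0.
Proof. by apply: (addIr (th 0)); rewrite -(thD FM) !add0r. Qed.
Lemma thN a : th (- a) = - th a.
Proof. by apply: (addIr (th a)); rewrite -(thD FM) !addNr th0. Qed.
Lemma thMn a k : th (a *+ k) = th a *+ k.
Proof. by elim: k => [|k IH]; rewrite ?th0 // !mulrS (thD FM) IH. Qed.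
Lemma th_sum (I : finType) (G : I -> C) : th (\sum_i G i) = \sum_i th (G i).
Proof. by apply: big_morph => [a b|]; rewrite ?(thD FM) ?th0. Qed.
Lemma th_Db a : Db cj' D' (th a) = cj' lam * th (Db cj D a).
Proof. by rewrite /Db -(th_cj FM) (th_der FM) (cjM CD') -(th_cj FM). Qed.

Let Dlb : D' (cj' lam) = - (cj' lam * (D' lam * cj' lam)).
Proof. exact: (D_inv CD' (lamK FM)). Qed.

Let lamKl : cj' lam * lam = 1. Proof. by rewrite mulrC (lamK FM). Qed.

Lemma DX a k : D' (a ^+ k.+1) = (a ^+ k * D' a) *+ k.+1.
Proof.
elim: k => [|k IH]; first by rewrite expr1 expr0 mul1r.
by rewrite exprS (derM CD') IH exprS; ring.
Qed.

Section Weights.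
Variables (rho : C) (rho' : C').
Hypothesis rhoE : rho' = lam * th rho - cj' lam * D' lam.

(** Differentiating [lam ^ k] produces a term in [D' lam] that cancels against the change of rho;
    this is what makes [dd] covariant. *)
Lemma th_dd k a : dd D' rho' k (lam ^+ k * th a) = lam ^+ k.+1 * th (dd D rho k a).
Proof.
rewrite /dd (derM CD') (th_der FM) rhoE (thD FM) (thM FM) thMn.
case: k => [|k]; first by rewrite expr0 expr1 (der1 CD'); ring.
rewrite DX exprS; set l := cj' lam; have e : l * lam = 1 by exact: lamKl.
rewrite [in RHS]exprS [in RHS]exprS.
transitivity (lam * (lam * lam ^+ k) * (th (D a) + th rho *+ k.+1 * th a)
  + (lam ^+ k * D' lam) *+ k.+1 * th a * (1 - l * lam)); first by ring.
by rewrite e subrr mulr0 addr0.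
Qed.

Lemma th_db k a :
  db cj' D' rho' k.+1 (lam ^+ k.+1 * th a) = lam ^+ k * th (db cj D rho k.+1 a).
Proof.
have e : lam * cj' lam = 1 by exact: (lamK FM).
have Dbl : Db cj' D' lam = - (lam * (cj' (D' lam) * lam)).
  by rewrite /Db Dlb !((cjN CD'), (cjM CD'), (cjK CD')).
have DbX : Db cj' D' (lam ^+ k.+1) = (lam ^+ k * Db cj' D' lam) *+ k.+1.
  elim: {a} k => [|k IH]; first by rewrite expr1 expr0 mul1r.
  by rewrite exprS (DbM CD') IH exprS; ring.
rewrite /db (DbM CD') DbX Dbl th_Db rhoE (thD FM) thN (thM FM) thMn (th_cj FM).
rewrite !((cjD CD'), (cjN CD'), (cjM CD'), (cjK CD')) exprS.
set l := cj' lam in e *; set m := cj' (D' lam); set r := cj' (th rho).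
transitivity (lam ^+ k * (th (Db cj D a) - r *+ k.+1 * th a)
  + (lam * l - 1) * lam ^+ k * (th (Db cj D a) - r *+ k.+1 * th a)); first by ring.
by rewrite e subrr !mul0r addr0.
Qed.

Variable n : nat.
Implicit Types u v : 'rV[C]_n.
Definition tv u : 'rV[C']_n := map_mx th u.

Lemma tv_dd k u : vdd D' rho' k (lam ^+ k *: tv u) = lam ^+ k.+1 *: tv (vdd D rho k u).
Proof. by apply/rowP => j; rewrite !mxE th_dd. Qed.
Lemma tv_db k u :
  vdb cj' D' rho' k.+1 (lam ^+ k.+1 *: tv u) = lam ^+ k *: tv (vdb cj D rho k.+1 u).
Proof. by apply/rowP => j; rewrite !mxE th_db. Qed.
Lemma tvD u v : tv (u + v) = tv u + tv v.
Proof. by apply/rowP => j; rewrite !mxE (thD FM). Qed.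
Lemma tvN u : tv (- u) = - tv u.
Proof. by apply/rowP => j; rewrite !mxE thN. Qed.
Lemma tvZ a u : tv (a *: u) = th a *: tv u.
Proof. by apply/rowP => j; rewrite !mxE (thM FM). Qed.
Lemma tv_dot u v : dot (tv u) (tv v) = th (dot u v).
Proof. by rewrite /dot th_sum; apply: eq_bigr => j _; rewrite !mxE (thM FM). Qed.
Lemma tv_vc u : vc cj' (tv u) = tv (vc cj u).
Proof. by apply/rowP => j; rewrite !mxE (th_cj FM). Qed.

Lemma lamXK k : lam ^+ k * cj' (lam ^+ k) = 1.
Proof.
elim: k => [|k IH]; first by rewrite expr0 mul1r (cj1 CD').
rewrite exprS (cjM CD'); transitivity ((lam * cj' lam) * (lam ^+ k * cj' (lam ^+ k))); first by ring.
by rewrite IH (lamK FM) mulr1.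
Qed.

Lemma tv_hm k u v : hm cj' (lam ^+ k *: tv u) (lam ^+ k *: tv v) = th (hm cj u v).
Proof.
rewrite (hmZl) (hmZr CD') mulrA lamXK mul1r /hm tv_vc; exact: tv_dot.
Qed.

End Weights.

Variable n : nat.

Section Raw.
Variables (F : 'rV[C]_n) (F' : 'rV[C']_n).
Hypothesis FE : F' = tv F.
Hypothesis f1_unit : hm cj (fr1 D F) (fr1 D F) = 1.
Hypothesis th1 : th 1 = 1.

Lemma tv_fr1 : fr1 D' F' = lam *: tv (fr1 D F).
Proof. by apply/rowP => j; rewrite FE !mxE (th_der FM). Qed.

Lemma th_rho : fr_rho cj' D' F' = lam * th (fr_rho cj D F) - cj' lam * D' lam.
Proof.
have fu := f1_unit; rewrite /fr_rho tv_fr1; set u := fr1 D F in fu *.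
have -> : vD D' (lam *: tv u) = D' lam *: tv u + lam ^+ 2 *: tv (vD D u).
  by apply/rowP => j; rewrite !mxE (derM CD') (th_der FM) expr2 !mulrA.
rewrite (vcZ CD') dotZr dotDl !dotZl tv_vc !tv_dot [dot u _]fu th1 thN.
transitivity (- (lam * cj' lam) * (lam * th (dot (vD D u) (vc cj u))) - cj' lam * D' lam).
  by ring.
by rewrite (lamK FM); ring.
Qed.

Let rE := th_rho.

Lemma tv_fr2 : fr2 cj' D' F' = lam ^+ 2 *: tv (fr2 cj D F).
Proof. by rewrite /fr2 tv_fr1 -[lam]expr1 (tv_dd rE). Qed.

Lemma tv_H : fr_H cj' D' F' = tv (fr_H cj D F).
Proof.
rewrite /fr_H tv_fr1 -[X in X *: _]expr1 (tv_db rE) expr0 scale1r tvD.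
by rewrite FE.
Qed.

Lemma th_hh : fr_hh cj' D' F' = th (fr_hh cj D F).
Proof. by rewrite /fr_hh tv_H tv_dot. Qed.

Lemma th_t0 : hm cj' (fr2 cj' D' F') (fr2 cj' D' F') =
  th (hm cj (fr2 cj D F) (fr2 cj D F)).
Proof. by rewrite tv_fr2 tv_hm. Qed.

(** Q has weight 2 and is multiplied by [lam ^ 2], a factor of modulus 1, so only |Q|^2 makes sense
    on all of M. *)
Lemma th_QQ : fr_Q cj' D' F' * cj' (fr_Q cj' D' F') =
  th (fr_Q cj D F * cj (fr_Q cj D F)).
Proof.
have -> : fr_Q cj' D' F' = lam ^+ 2 * th (fr_Q cj D F).
  by rewrite /fr_Q tv_fr2 tv_H dotZr tv_dot.
rewrite (cjM CD') (thM FM) (th_cj FM).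
transitivity ((lam ^+ 2 * cj' (lam ^+ 2)) * (th (fr_Q cj D F) * cj' (th (fr_Q cj D F)))).
  by ring.
by rewrite lamXK mul1r.
Qed.
End Raw.

Section Min.
Variables (rho : C) (rho' : C') (f1 : 'rV[C]_n) (f1' : 'rV[C']_n) (ti ri : C) (ti' ri' : C').
Hypothesis rhoE : rho' = lam * th rho - cj' lam * D' lam.
Hypothesis f1E : f1' = lam *: tv f1.
Hypothesis tiE : ti' = th ti.
Hypothesis riE : ri' = th ri.

Lemma tv_mf2 : mf2 D' rho' f1' = lam ^+ 2 *: tv (mf2 D rho f1).
Proof. by rewrite /mf2 f1E -[lam]expr1 (tv_dd rhoE). Qed.
Lemma th_mt : mt cj' D' rho' f1' = th (mt cj D rho f1).
Proof. by rewrite /mt tv_mf2 tv_hm. Qed.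
Lemma tv_mpsi3 : mpsi3 cj' D' rho' f1' ti' = lam ^+ 3 *: tv (mpsi3 cj D rho f1 ti).
Proof.
rewrite /mpsi3 th_mt (th_der FM) tv_mf2 (tv_dd rhoE) tvD tvN tvZ (thM FM) tiE.
by apply/rowP => j; rewrite !mxE; ring.
Qed.
Lemma th_mr : mr cj' D' rho' f1' ti' = th (mr cj D rho f1 ti).
Proof. by rewrite /mr tv_mpsi3 tv_hm. Qed.
Lemma tv_meta : meta cj' D' rho' f1' ti' = lam ^+ 4 *: tv (meta cj D rho f1 ti).
Proof. by rewrite /meta tv_mpsi3 (tv_dd rhoE). Qed.
Lemma th_mN : mN cj' D' rho' f1' ti' = th (mN cj D rho f1 ti).
Proof. by rewrite /mN tv_meta tv_hm. Qed.
Lemma tv_mpsi4 : mpsi4 cj' D' rho' f1' ti' ri' = lam ^+ 4 *: tv (mpsi4 cj D rho f1 ti ri).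
Proof.
rewrite /mpsi4 th_mr (th_der FM) tv_meta tv_mpsi3 tvD tvN tvZ (thM FM) riE.
by apply/rowP => j; rewrite !mxE; ring.
Qed.
Lemma th_mtau : mtau cj' D' rho' f1' ti' ri' = th (mtau cj D rho f1 ti ri).
Proof. by rewrite /mtau tv_mpsi4 tv_hm. Qed.
End Min.
End Morphism.

(** * Complexification and the Gram-Schmidt frame *)

(* The library complex numbers R[i] need a field of real numbers; here the
   real parts range over a ring of smooth functions. *)
Record cx (A : Type) := Cx { re : A ; im : A }.

Section CxRing.
Variable A : comPzRingType.
Implicit Types x y z : cx A.

Lemma cx_eq x y : re x = re y -> im x = im y -> x = y.
Proof. by case: x y => [a b] [c d] /= -> ->. Qed.

Definition cx_add x y := Cx (re x + re y) (im x + im y).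
Definition cx_opp x := Cx (- re x) (- im x).
Definition cx_mul x y :=
  Cx (re x * re y - im x * im y) (re x * im y + im x * re y).

HB.instance Definition _ := gen_eqMixin (cx A).
HB.instance Definition _ := gen_choiceMixin (cx A).

Fact cx_addA : associative cx_add.
Proof. by move=> *; apply: cx_eq; rewrite /= addrA. Qed.
Fact cx_addC : commutative cx_add.
Proof. by move=> *; apply: cx_eq; rewrite /= addrC. Qed.
Fact cx_add0 : left_id (Cx 0 0) cx_add.
Proof. by move=> *; apply: cx_eq; rewrite /= add0r. Qed.
Fact cx_addN : left_inverse (Cx 0 0) cx_opp cx_add.
Proof. by move=> *; apply: cx_eq; rewrite /= addNr. Qed.
HB.instance Definition _ :=
  GRing.isZmodule.Build (cx A) cx_addA cx_addC cx_add0 cx_addN.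

Fact cx_mulA : associative cx_mul.
Proof. by move=> *; apply: cx_eq => /=; ring. Qed.
Fact cx_mulC : commutative cx_mul.
Proof. by move=> *; apply: cx_eq => /=; ring. Qed.
Fact cx_mul1 : left_id (Cx 1 0) cx_mul.
Proof. by move=> *; apply: cx_eq => /=; ring. Qed.
Fact cx_mulD : left_distributive cx_mul cx_add.
Proof. by move=> *; apply: cx_eq => /=; ring. Qed.
HB.instance Definition _ :=
  GRing.Zmodule_isComPzRing.Build (cx A) cx_mulA cx_mulC cx_mul1 cx_mulD.

Lemma reD x y : re (x + y) = re x + re y. Proof. by []. Qed.
Lemma imD x y : im (x + y) = im x + im y. Proof. by []. Qed.
Lemma reN x : re (- x) = - re x. Proof. by []. Qed.
Lemma imN x : im (- x) = - im x. Proof. by []. Qed.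
Lemma reM x y : re (x * y) = re x * re y - im x * im y. Proof. by []. Qed.
Lemma imM x y : im (x * y) = re x * im y + im x * re y. Proof. by []. Qed.
Lemma re0 : re (0 : cx A) = 0. Proof. by []. Qed.
Lemma im0 : im (0 : cx A) = 0. Proof. by []. Qed.
Lemma re1 : re (1 : cx A) = 1. Proof. by []. Qed.
Lemma im1 : im (1 : cx A) = 0. Proof. by []. Qed.
Lemma reMn x k : re (x *+ k) = re x *+ k.
Proof. by elim: k => // k IH; rewrite !mulrS reD IH. Qed.
Lemma imMn x k : im (x *+ k) = im x *+ k.
Proof. by elim: k => // k IH; rewrite !mulrS imD IH. Qed.
Lemma re_sum (I : finType) (G : I -> cx A) : re (\sum_i G i) = \sum_i re (G i).
Proof. by elim/big_rec2 : _ => // i a b _ <-. Qed.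
Lemma im_sum (I : finType) (G : I -> cx A) : im (\sum_i G i) = \sum_i im (G i).
Proof. by elim/big_rec2 : _ => // i a b _ <-. Qed.
Definition reimE := (reD, imD, reN, imN, reM, imM, re0, im0, re1, im1, reMn, imMn).

Definition cxr (a : A) := Cx a 0.
Definition cjx x := Cx (re x) (- im x).

Lemma cxrD a b : cxr (a + b) = cxr a + cxr b.
Proof. by apply: cx_eq; rewrite //= addr0. Qed.
Lemma cxrM a b : cxr (a * b) = cxr a * cxr b.
Proof. by apply: cx_eq; rewrite /=; ring. Qed.

Lemma cx_real x : (forall a : A, a + a = 0 -> a = 0) -> cjx x = x -> x = cxr (re x).
Proof.
move=> half e; apply: cx_eq => //=; apply: half.
by have /(congr1 (@im A)) /= := e; move=> {1}<-; rewrite addNr.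
Qed.
End CxRing.

Section GramSchmidt.
Variables (A : comPzRingType) (d : 'I_2 -> A -> A).
Hypothesis half : forall a : A, a + a = 0 -> a = 0.
Hypothesis dD : forall k a b, d k (a + b) = d k a + d k b.
Hypothesis dM : forall k a b, d k (a * b) = d k a * b + a * d k b.
Hypothesis dC : forall a, d 0 (d 1 a) = d 1 (d 0 a).

Lemma cx_half (x : cx A) : x + x = 0 -> x = 0.
Proof.
move=> e; apply: cx_eq; apply: half.
  exact: (congr1 (@re A) e).
exact: (congr1 (@im A) e).
Qed.

Definition dx k (x : cx A) := Cx (d k (re x)) (d k (im x)).

Variable z : 'I_2 -> cx A.
Definition Zf (x : cx A) : cx A := z 0 * dx 0 x + z 1 * dx 1 x.

Lemma d_0 k : d k 0 = 0.
Proof. by apply: (addIr (d k 0)); rewrite -dD !add0r. Qed.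
Lemma dN k a : d k (- a) = - d k a.
Proof. by apply: (addIr (d k a)); rewrite -dD !addNr d_0. Qed.
Lemma dxD k x y : dx k (x + y) = dx k x + dx k y.
Proof. by apply: cx_eq; rewrite /= !dD. Qed.
Lemma dxM k x y : dx k (x * y) = dx k x * y + x * dx k y.
Proof. by apply: cx_eq; rewrite /= !(dD, dN, dM); ring. Qed.
Lemma dx_cj k x : dx k (cjx x) = cjx (dx k x).
Proof. by apply: cx_eq; rewrite //= dN. Qed.
Lemma dxC x : dx 0 (dx 1 x) = dx 1 (dx 0 x).
Proof. by apply: cx_eq; rewrite /= dC. Qed.
Lemma cjxD (x y : cx A) : cjx (x + y) = cjx x + cjx y.
Proof. by apply: cx_eq; rewrite //= opprD. Qed.
Lemma cjxM (x y : cx A) : cjx (x * y) = cjx x * cjx y.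
Proof. by apply: cx_eq; rewrite /=; ring. Qed.
Lemma cjxK (x : cx A) : cjx (cjx x) = x.
Proof. by apply: cx_eq; rewrite //= opprK. Qed.

Lemma Zf_derivation : conj_derivation (@cjx A) Zf.
Proof.
split; [exact: cjxD|exact: cjxM|exact: cjxK| |].
  by move=> x y; rewrite /Zf !dxD; ring.
by move=> x y; rewrite /Zf !dxM; ring.
Qed.

(** The second derivatives cancel by [dC], so the commutator is again a first-order operator. *)
Lemma Zf_comm x : Zf (Db (@cjx A) Zf x) - Db (@cjx A) Zf (Zf x) =
  (Zf (cjx (z 0)) - Db (@cjx A) Zf (z 0)) * dx 0 x
  + (Zf (cjx (z 1)) - Db (@cjx A) Zf (z 1)) * dx 1 x.
Proof.
have DbE y : Db (@cjx A) Zf y = cjx (z 0) * dx 0 y + cjx (z 1) * dx 1 y.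
  by rewrite /Db /Zf cjxD !cjxM !dx_cj !cjxK.
rewrite !DbE /Zf !(dxD, dxM) -!(dxC x); ring.
Qed.
End GramSchmidt.

Section FrameComm.
Variables (C : comPzRingType) (cj D : C -> C) (CD : conj_derivation cj D).
Hypothesis half : forall a : C, a + a = 0 -> a = 0.
Variables (n : nat) (F : 'rV[C]_n).
Hypothesis F_real : vc cj F = F.
Let f1 := vD D F.
Hypothesis f1_null : dot f1 f1 = 0.
Hypothesis f1_unit : hm cj f1 f1 = 1.
Variables (al be : C).
Hypothesis commE : forall a, D (Db cj D a) - Db cj D (D a) = al * D a + be * Db cj D a.

(** Applying the commutator to the position vector F gives an identity of tangent vectors. Its
    products with f1 and with the conjugate of f1 determine [al] and [be], through the derivatives
    of the relations that make f1 a unit null vector. *)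
Lemma frame_comm a : let rho := - dot (vD D f1) (vc cj f1) in
  D (Db cj D a) - Db cj D (D a) = rho * Db cj D a - cj rho * D a.
Proof.
set rho := - _; set fm := vc cj f1.
have vDb (u : 'rV[C]_n) : vc cj (vD D (vc cj u)) = map_mx (Db cj D) u.
  by apply/rowP => j; rewrite !mxE.
have fmE : fm = map_mx (Db cj D) F by rewrite /fm /f1 -[in LHS]F_real vDb.
have fmfm : dot fm fm = 0 by rewrite /fm -(cj_dot CD) f1_null (cj0 CD).
have f1fm : dot f1 fm = 1 by exact: f1_unit.
have fmf1 : dot fm f1 = 1 by rewrite dotC.
have V : vD D fm - map_mx (Db cj D) f1 = al *: f1 + be *: fm.
  apply/rowP => j; rewrite fmE /f1 !mxE; exact: commE.
have Db_dot (u v : 'rV[C]_n) : Db cj D (dot u v) =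
    dot (map_mx (Db cj D) u) v + dot u (map_mx (Db cj D) v) :> C.
  rewrite [LHS]/Db (cj_dot CD) (D_dot CD) (cjD CD) !(cj_dot CD) !vDb !(vcK CD).
  by [].
have e1 : dot (vD D fm) fm = 0.
  by apply: half; rewrite {2}dotC -(D_dot CD) fmfm (der0 CD).
have e2 : dot (map_mx (Db cj D) f1) f1 = 0.
  by apply: half; rewrite {2}dotC -Db_dot f1_null (Db0 CD).
have cjrho : dot f1 (map_mx (Db cj D) fm) = - cj rho.
  rewrite /rho (cjN CD) opprK (cj_dot CD) (vcK CD) dotC; congr dot.
  by apply/rowP => j; rewrite !mxE /Db (cjK CD).
have e3 : dot (map_mx (Db cj D) f1) fm = cj rho.
  have := congr1 (Db cj D) f1fm; rewrite Db_dot (Db1 CD) cjrho => /eqP.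
  by rewrite subr_eq0 => /eqP.
have e4 : dot (vD D fm) f1 = rho.
  have := congr1 D fmf1; rewrite (D_dot CD) (der1 CD) => /eqP.
  by rewrite addr_eq0 dotC => /eqP; rewrite dotC => ->; rewrite /rho dotC.
have Eal : al = - cj rho.
  have := congr1 (fun v => dot v fm) V.
  by rewrite !dotDl !dotZl dotNl e1 e3 f1fm fmfm mulr0 mulr1 addr0 add0r.
have Ebe : be = rho.
  have := congr1 (fun v => dot v f1) V.
  by rewrite !dotDl !dotZl dotNl e2 e4 f1_null fmf1 mulr0 mulr1 add0r oppr0 addr0.
by rewrite commE Eal Ebe; ring.
Qed.
End FrameComm.

Section OrthonormalFrame.
Variables (A : comPzRingType) (d : 'I_2 -> A -> A).
Hypothesis half : forall a : A, a + a = 0 -> a = 0.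
Hypothesis dD : forall k a b, d k (a + b) = d k a + d k b.
Hypothesis dM : forall k a b, d k (a * b) = d k a * b + a * d k b.
Hypothesis dC : forall a, d 0 (d 1 a) = d 1 (d 0 a).
Variables (n : nat) (F : 'rV[A]_n) (s r : A).
Definition gE := dot (map_mx (d 0) F) (map_mx (d 0) F).
Definition gF := dot (map_mx (d 0) F) (map_mx (d 1) F).
Definition gG := dot (map_mx (d 1) F) (map_mx (d 1) F).
(** s is 1 / sqrt (2 E) and r is 1 / sqrt (E G - F^2), both as elements of the ring. *)
Hypothesis sE : s * s * (gE *+ 2) = 1.
Hypothesis rE : r * r * (gE * gG - gF * gF) = 1.

(* Gram-Schmidt: Z = (e1 - i e2) / sqrt 2 with e1 = d0 / sqrt E and
   e2 = (E d1 - F d0) / sqrt (E (E G - F^2)). *)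
Definition gsz (k : 'I_2) : cx A :=
  if k == 0 then Cx s (s * gF * r) else Cx 0 (- (s * gE * r)).
Definition gsZ := Zf d gsz.
Definition cF : 'rV[cx A]_n := map_mx (@cxr A) F.
Let f1 := vD gsZ cF.

Lemma gsz0 : gsz 0 = Cx s (s * gF * r). Proof. by []. Qed.
Lemma gsz1 : gsz 1 = Cx 0 (- (s * gE * r)). Proof. by []. Qed.

Lemma gs_CD : conj_derivation (@cjx A) gsZ.
Proof. exact: Zf_derivation. Qed.

Definition cd k : 'rV[cx A]_n := map_mx (@cxr A) (map_mx (d k) F).

Lemma f1E : f1 = gsz 0 *: cd 0 + gsz 1 *: cd 1.
Proof.
have d0 k : d k 0 = 0 by apply: (addIr (d k 0)); rewrite -dD !add0r.
by apply/rowP => j; rewrite !mxE /gsZ /Zf /dx /= !d0.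
Qed.

Lemma dot_cxr (u v : 'rV[A]_n) : dot (map_mx (@cxr A) u) (map_mx (@cxr A) v) = cxr (dot u v).
Proof.
apply: cx_eq; rewrite /dot ?(re_sum, im_sum) /=.
  by apply: eq_bigr => j _; rewrite !mxE /= mul0r subr0.
by apply: big1 => j _; rewrite !mxE /= mulr0 mul0r addr0.
Qed.

Lemma cF_real : vc (@cjx A) cF = cF.
Proof. by apply/rowP => j; rewrite !mxE; apply: cx_eq; rewrite //= oppr0. Qed.

Lemma cd_real k : vc (@cjx A) (cd k) = cd k.
Proof. by apply/rowP => j; rewrite !mxE; apply: cx_eq; rewrite //= oppr0. Qed.

Let cd00 : dot (cd 0) (cd 0) = cxr gE. Proof. exact: dot_cxr. Qed.
Let cd01 : dot (cd 0) (cd 1) = cxr gF. Proof. exact: dot_cxr. Qed.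
Let cd10 : dot (cd 1) (cd 0) = cxr gF. Proof. by rewrite dotC; exact: dot_cxr. Qed.
Let cd11 : dot (cd 1) (cd 1) = cxr gG. Proof. exact: dot_cxr. Qed.

Lemma gs_null : dot f1 f1 = 0.
Proof.
rewrite f1E !(dotDl, dotDr, dotZl, dotZr) cd00 cd01 cd10 cd11 gsz0 gsz1.
apply: cx_eq => /=; last by ring.
transitivity (s * s * gE * (1 - r * r * (gE * gG - gF * gF))); first by ring.
by rewrite rE subrr mulr0.
Qed.

(* The inverse metric is 2 Re (z_k conj z_l). *)
Lemma gs_g00 : (re (gsz 0 * cjx (gsz 0))) *+ 2 = r * r * gG.
Proof.
rewrite gsz0 /=.
transitivity (s * s * (1 + gF * gF * (r * r)) *+ 2); first by ring.
transitivity (s * s * (r * r * (gE * gG - gF * gF) + gF * gF * (r * r)) *+ 2).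
  by rewrite rE.
transitivity (s * s * (gE *+ 2) * (r * r * gG)); first by ring.
by rewrite sE mul1r.
Qed.
Lemma gs_g01 : (re (gsz 0 * cjx (gsz 1))) *+ 2 = - (r * r * gF).
Proof.
rewrite gsz0 gsz1 /=; transitivity (- (s * s * (gE *+ 2) * (r * r * gF))); first by ring.
by rewrite sE mul1r.
Qed.
Lemma gs_g11 : (re (gsz 1 * cjx (gsz 1))) *+ 2 = r * r * gE.
Proof.
rewrite gsz1 /=; transitivity (s * s * (gE *+ 2) * (r * r * gE)); first by ring.
by rewrite sE mul1r.
Qed.

Lemma gs_unit : hm (@cjx A) f1 f1 = 1.
Proof.
have CD := gs_CD.
rewrite f1E (hmDl) !(hmDr CD) !hmZl !(hmZr CD) /hm !cd_real cd00 cd01 cd10 cd11.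
apply: cx_eq; last by rewrite gsz0 gsz1 /=; ring.
rewrite gsz0 gsz1 /=.
transitivity (s * s * (gE *+ 2) * (r * r * (gE * gG - gF * gF))
  + s * s * gE * (1 - r * r * (gE * gG - gF * gF))); first by ring.
by rewrite sE rE; ring.
Qed.

(* dx k = p_k Z + conj p_k conj Z. *)
Definition gsp (k : 'I_2) : cx A := dot (cd k) (vc (@cjx A) f1).

Lemma gspE k : gsp k = cjx (gsz 0) * dot (cd k) (cd 0) + cjx (gsz 1) * dot (cd k) (cd 1).
Proof.
have CD := gs_CD.
by rewrite /gsp f1E (vcD CD) !(vcZ CD) !cd_real dotDr !dotZr.
Qed.

Lemma gs_dual k x : dx d k x = gsp k * gsZ x + cjx (gsp k) * Db (@cjx A) gsZ x.
Proof.
have DbE y : Db (@cjx A) gsZ y = cjx (gsz 0) * dx d 0 y + cjx (gsz 1) * dx d 1 y.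
  by rewrite /Db /gsZ /Zf cjxD !cjxM !(dx_cj dD) !cjxK.
have key (a b c e : cx A) : gsp k * gsz 0 + cjx (gsp k) * cjx (gsz 0) = a ->
   gsp k * gsz 1 + cjx (gsp k) * cjx (gsz 1) = b ->
   gsp k * gsZ x + cjx (gsp k) * Db (@cjx A) gsZ x = a * dx d 0 x + b * dx d 1 x.
  by move=> <- <-; rewrite DbE /gsZ /Zf; ring.
have two l : gsp k * gsz l + cjx (gsp k) * cjx (gsz l) = cxr (re (gsp k * gsz l) *+ 2).
  by apply: cx_eq; rewrite /=; ring.
have eE : s * s * gE *+ 2 = 1 by rewrite -sE; ring.
have eF : s * s * (1 + gF * gF * (r * r)) * gE *+ 2 =
    r * r * (gE * gG - gF * gF) + gF * gF * (r * r).
  by rewrite rE -[RHS]mul1r -sE; ring.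
have h00 : re (gsp 0 * gsz 0) *+ 2 = 1.
  rewrite gspE cd00 cd01 gsz0 gsz1 /= -[RHS]mul1r -{1}sE; ring.
have h01 : re (gsp 0 * gsz 1) *+ 2 = 0.
  by rewrite gspE cd00 cd01 gsz0 gsz1 /=; ring.
have h10 : re (gsp 1 * gsz 0) *+ 2 = 0.
  rewrite gspE cd10 cd11 gsz0 gsz1 /=.
  transitivity (s * s * gF * (1 - r * r * (gE * gG - gF * gF)) *+ 2); first by ring.
  by rewrite rE; ring.
have h11 : re (gsp 1 * gsz 1) *+ 2 = 1.
  rewrite gspE cd10 cd11 gsz0 gsz1 /=.
  transitivity (s * s * (gE *+ 2) * (r * r * (gE * gG - gF * gF))); first by ring.
  by rewrite sE rE mulr1.
rewrite (key _ _ 0 0 (two 0) (two 1)).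
have [->|->] : k = 0 \/ k = 1 by case: k {key two h00 h01 h10 h11} => [[|[|//]] ?]; [left|right]; apply/val_inj.
  by rewrite h00 h01 (_ : cxr 0 = 0) // mul0r addr0 (_ : cxr 1 = 1) // mul1r.
by rewrite h10 h11 (_ : cxr 0 = 0) // mul0r add0r (_ : cxr 1 = 1) // mul1r.
Qed.

Lemma gs_comm a : let rho := - dot (vD gsZ f1) (vc (@cjx A) f1) in
  gsZ (Db (@cjx A) gsZ a) - Db (@cjx A) gsZ (gsZ a) =
  rho * Db (@cjx A) gsZ a - cjx rho * gsZ a.
Proof.
pose c k := gsZ (cjx (gsz k)) - Db (@cjx A) gsZ (gsz k).
apply: (frame_comm gs_CD (cx_half half) cF_real gs_null gs_unit
  (al := c 0 * gsp 0 + c 1 * gsp 1) (be := c 0 * cjx (gsp 0) + c 1 * cjx (gsp 1))).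
by move=> x; rewrite [LHS](Zf_comm dD dM dC) !gs_dual -/gsZ -/(c 0) -/(c 1); ring.
Qed.
End OrthonormalFrame.

Lemma ord2 (k : 'I_2) : k = 0 \/ k = 1.
Proof. by case: k => [[|[|//]] ?]; [left|right]; apply/val_inj. Qed.

Lemma sum2 (V : nmodType) (G : 'I_2 -> V) : \sum_a G a = G 0 + G 1.
Proof.
rewrite !big_ord_recl big_ord0 addr0; congr (G _ + G _); exact/val_inj.
Qed.

(** * Normal projection and second fundamental form in coordinates *)

Section Projection.
Variables (C : comPzRingType) (n : nat) (p q c : 'rV[C]_n).
Implicit Types u v : 'rV[C]_n.
(** Meant for a null pair p, q with [dot p q = 1], so that the coefficient of p is the product with
    q, and for a unit vector c orthogonal to both. *)
Definition nproj v := v - dot v q *: p - dot v p *: q - dot v c *: c.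
Lemma nprojD u v : nproj (u + v) = nproj u + nproj v.
Proof. by apply/rowP => j; rewrite /nproj !dotDl !mxE; ring. Qed.
Lemma nprojZ a u : nproj (a *: u) = a *: nproj u.
Proof. by apply/rowP => j; rewrite /nproj !dotZl !mxE; ring. Qed.
Lemma nproj_id v : dot v q = 0 -> dot v p = 0 -> dot v c = 0 -> nproj v = v.
Proof. by move=> e1 e2 e3; rewrite /nproj e1 e2 e3 !scale0r !subr0. Qed.
Lemma nproj_p : dot p q = 1 -> dot p p = 0 -> dot p c = 0 -> nproj p = 0.
Proof.
by move=> e1 e2 e3; rewrite /nproj e1 e2 e3 !scale0r scale1r !subr0 subrr.
Qed.
Lemma nproj_q : dot q p = 1 -> dot q q = 0 -> dot q c = 0 -> nproj q = 0.
Proof.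
by move=> e1 e2 e3; rewrite /nproj e1 e2 e3 !scale0r scale1r !subr0 subrr.
Qed.
Lemma nproj_c : dot c c = 1 -> dot c p = 0 -> dot c q = 0 -> nproj c = 0.
Proof.
by move=> e1 e2 e3; rewrite /nproj e1 e2 e3 !scale0r scale1r !subr0 subrr.
Qed.
End Projection.

Section EmbProjection.
Variables (A : comPzRingType) (n : nat) (g : 'I_2 -> 'I_2 -> A) (e : 'I_2 -> 'rV[A]_n).
Variables (F : 'rV[A]_n) (z : 'I_2 -> cx A).
Hypothesis gE : forall a b, cxr (g a b) = z a * cjx (z b) + cjx (z a) * z b.
Let emb (v : 'rV[A]_n) : 'rV[cx A]_n := map_mx (@cxr A) v.
Definition rproj (v : 'rV[A]_n) : 'rV[A]_n :=
  v - \sum_a \sum_b (g a b * dot v (e b)) *: e a - dot v F *: F.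
(** By [gE] the inverse metric is z times its conjugate, symmetrized, so the coordinate projection
    and the null-frame projection have the same expansion. *)
Lemma emb_rproj v : emb (rproj v) =
  nproj (z 0 *: emb (e 0) + z 1 *: emb (e 1))
    (cjx (z 0) *: emb (e 0) + cjx (z 1) *: emb (e 1)) (emb F) (emb v).
Proof.
have cxrN a : cxr (- a) = - cxr a :> cx A by apply: cx_eq; rewrite //= oppr0.
apply/rowP => j; rewrite /nproj !(dotDr, dotZr) /emb !dot_cxr.
rewrite /rproj !sum2 !mxE !(cxrD, cxrN) !cxrM !gE; ring.
Qed.
End EmbProjection.

Section Coordinates.
Variables (A : comPzRingType) (d : 'I_2 -> A -> A).
Hypothesis half : forall a : A, a + a = 0 -> a = 0.
Hypothesis dD : forall k a b, d k (a + b) = d k a + d k b.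
Hypothesis dM : forall k a b, d k (a * b) = d k a * b + a * d k b.
Hypothesis dC : forall a, d 0 (d 1 a) = d 1 (d 0 a).
Variables (n : nat) (F : 'rV[A]_n) (s r : A).
Hypothesis sE : s * s * (gE d F *+ 2) = 1.
Hypothesis rE : r * r * (gE d F * gG d F - gF d F * gF d F) = 1.
Hypothesis F_unit : dot F F = 1.

Let E := gE d F. Let Fm := gF d F. Let G := gG d F.
Let z := gsz d F s r.
Let Z := gsZ d F s r.
Let cj := @cjx A.
Let cFv := cF F.
Let f1 := fr1 Z cFv.
Let fm := vc cj f1.
Let f2 := fr2 cj Z cFv.
Let H := fr_H cj Z cFv.
Let rho := fr_rho cj Z cFv.
Let CD : conj_derivation cj Z. Proof. exact: gs_CD. Qed.
Let emb (v : 'rV[A]_n) : 'rV[cx A]_n := map_mx (@cxr A) v.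

(** The inverse metric: the adjugate matrix times [r * r], the inverse of the determinant. *)
Definition gi (a b : 'I_2) : A :=
  if a == 0 then if b == 0 then r * r * G else - (r * r * Fm)
  else if b == 0 then - (r * r * Fm) else r * r * E.

Definition dv k (v : 'rV[A]_n) : 'rV[A]_n := map_mx (d k) v.

Definition npA := rproj gi (fun k => dv k F) F.

Definition hA a b := npA (dv a (dv b F)).

Lemma giE a b : cxr (gi a b) = z a * cj (z b) + cj (z a) * z b.
Proof.
have two x : x + cj x = cxr (re x *+ 2) by apply: cx_eq; rewrite /=; ring.
have -> : z a * cj (z b) + cj (z a) * z b = cxr (re (z a * cj (z b)) *+ 2).
  by rewrite -two /cj cjxM cjxK.
have h10 : re (z 1 * cj (z 0)) *+ 2 = - (r * r * Fm).
  by rewrite -(gs_g01 r sE) /=; ring.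
congr cxr; have [->|->] := ord2 a; have [->|->] := ord2 b; rewrite /gi /=.
- by rewrite -(gs_g00 sE rE).
- by rewrite -(gs_g01 r sE).
- by rewrite -h10.
- by rewrite -(gs_g11 r sE).
Qed.

Definition npc := nproj f1 fm cFv.

Lemma emb_dot u v : dot (emb u) (emb v) = cxr (dot u v).
Proof. exact: dot_cxr. Qed.

Lemma f1_emb : f1 = z 0 *: emb (dv 0 F) + z 1 *: emb (dv 1 F).
Proof. exact: (f1E dD F s r). Qed.

Lemma fm_emb : fm = cj (z 0) *: emb (dv 0 F) + cj (z 1) *: emb (dv 1 F).
Proof.
rewrite /fm f1_emb (vcD CD) !(vcZ CD).
by congr (_ *: _ + _ *: _); apply/rowP => j; rewrite !mxE; apply: cx_eq; rewrite //= oppr0.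
Qed.

Lemma emb_npA v : emb (npA v) = npc (emb v).
Proof. by rewrite /npc f1_emb fm_emb; exact: (emb_rproj (fun k => dv k F) F giE v). Qed.

Let halfC := cx_half half.
Let f1_null : dot f1 f1 = 0. Proof. exact: gs_null. Qed.
Let f1_unit : hm cj f1 f1 = 1. Proof. exact: gs_unit. Qed.
Let F_real : vc cj cFv = cFv. Proof. exact: cF_real. Qed.
Let cF_unit : dot cFv cFv = 1. Proof. by rewrite /cFv [LHS]emb_dot F_unit. Qed.
Let comm a : Z (Db cj Z a) - Db cj Z (Z a) = rho * Db cj Z a - cj rho * Z a.
Proof. exact: (gs_comm half dD dM dC sE rE a). Qed.

Let Ff1 : dot cFv f1 = 0. Proof. exact: (dotFf1 CD halfC cF_unit). Qed.
Let Ffm : dot cFv fm = 0. Proof. exact: (dotFfm CD halfC F_real cF_unit). Qed.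
Let f1F : dot f1 cFv = 0. Proof. by rewrite dotC. Qed.
Let fmF : dot fm cFv = 0. Proof. by rewrite dotC. Qed.
Let f1fm : dot f1 fm = 1. Proof. exact: f1_unit. Qed.
Let fmf1 : dot fm f1 = 1. Proof. by rewrite dotC. Qed.
Let fm0 : dot fm fm = 0. Proof. exact: (fmfm CD f1_null). Qed.

Lemma npc_f1 : npc f1 = 0. Proof. exact: nproj_p. Qed.
Lemma npc_fm : npc fm = 0. Proof. exact: nproj_q. Qed.
Lemma npc_F : npc cFv = 0. Proof. exact: nproj_c. Qed.

Lemma npc_dv k : npc (emb (dv k F)) = 0.
Proof.
have -> : emb (dv k F) = gsp d F s r k *: f1 + cj (gsp d F s r k) *: fm.
  apply/rowP => j; rewrite !mxE.
  have -> : cxr (d k (F 0 j)) = dx d k (cxr (F 0 j)).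
    by apply: cx_eq; rewrite //= (d_0 dD).
  rewrite (gs_dual dD dM sE rE k); congr (_ * _ + _ * _).
  by rewrite /Db; congr (cjx (Z _)); apply: cx_eq; rewrite //= oppr0.
by rewrite /npc nprojD !nprojZ -/npc npc_f1 npc_fm !scaler0 addr0.
Qed.

Let ZE x : Z x = z 0 * dx d 0 x + z 1 * dx d 1 x. Proof. by []. Qed.
Let ZbE x : Db cj Z x = cj (z 0) * dx d 0 x + cj (z 1) * dx d 1 x.
Proof. by rewrite /Db /cj ZE cjxD !cjxM !(dx_cj dD) !cjxK. Qed.

Let dx_emb k l j : dx d k (emb (dv l F) 0 j) = emb (dv k (dv l F)) 0 j.
Proof.
rewrite !mxE /dx /=; have -> : d k 0 = 0 by apply: (addIr (d k 0)); rewrite -dD !add0r.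
by [].
Qed.

(** f2 is normal, hence equal to its projection. In the derivative of the expansion of f1 in
    coordinate vectors, the terms that differentiate z are tangential and disappear, and the normal
    parts of the second derivatives of F remain. *)
Lemma f2_h : f2 = \sum_a \sum_b (z a * z b) *: emb (hA a b).
Proof.
have -> : f2 = npc f2.
  rewrite /npc nproj_id //; first exact: f2fm.
    exact: (f2f1 CD halfC f1_null).
  have := congr1 Z f1F; rewrite (D_dot CD) (der0 CD) -/f1 f1_null addr0.
  rewrite (ddf1 cj Z cFv) dotDl dotNl dotZl f1F mulr0 subr0.
  by [].
have -> : f2 = (Z (z 0) + rho * z 0) *: emb (dv 0 F) + (Z (z 1) + rho * z 1) *: emb (dv 1 F)
   + ((z 0 * z 0) *: emb (dv 0 (dv 0 F)) + (z 0 * z 1) *: emb (dv 0 (dv 1 F))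
   + ((z 1 * z 0) *: emb (dv 1 (dv 0 F)) + (z 1 * z 1) *: emb (dv 1 (dv 1 F)))).
  apply/rowP => j; have e := dx_emb.
  have -> : f2 0 j = Z (f1 0 j) + rho * f1 0 j by rewrite [LHS]mxE /dd mulr1n.
  have -> : f1 0 j = z 0 * emb (dv 0 F) 0 j + z 1 * emb (dv 1 F) 0 j.
    by rewrite f1_emb; move: (emb _) (emb _) => u v; rewrite !mxE.
  have DM a b : Z (a * b) = Z a * b + a * Z b by exact: (derM CD).
  rewrite (derD CD) !DM [Z (emb (dv 0 F) 0 j)]ZE [Z (emb (dv 1 F) 0 j)]ZE !e.
  move: (emb _) (emb _) (emb _) (emb _) (emb _) (emb _) => a b c d' e' f'.
  by rewrite !mxE; ring.
by rewrite /npc !(nprojD, nprojZ) -/npc !npc_dv !scaler0 !add0r !sum2 !emb_npA.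
Qed.

Lemma H_h : H = \sum_a \sum_b (cj (z a) * z b) *: emb (hA a b).
Proof.
have -> : H = npc H.
  rewrite /npc nproj_id //; first exact: (Hfm_Ffm CD halfC F_real cF_unit f1_null comm).
    exact: (Hf1 CD halfC F_real cF_unit f1_null comm).
  exact: (HF CD halfC F_real cF_unit f1_unit comm).
have -> : H = (Db cj Z (z 0) - cj rho * z 0) *: emb (dv 0 F)
   + (Db cj Z (z 1) - cj rho * z 1) *: emb (dv 1 F)
   + ((cj (z 0) * z 0) *: emb (dv 0 (dv 0 F)) + (cj (z 0) * z 1) *: emb (dv 0 (dv 1 F))
   + ((cj (z 1) * z 0) *: emb (dv 1 (dv 0 F)) + (cj (z 1) * z 1) *: emb (dv 1 (dv 1 F))))
   + cFv.
  apply/rowP => j; have e := dx_emb.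
  have -> : H 0 j = Db cj Z (f1 0 j) - cj rho * f1 0 j + cFv 0 j.
    by rewrite [LHS]mxE; congr (_ + _); rewrite [LHS]mxE /db mulr1n.
  have -> : f1 0 j = z 0 * emb (dv 0 F) 0 j + z 1 * emb (dv 1 F) 0 j.
    by rewrite f1_emb; move: (emb _) (emb _) => u v; rewrite !mxE.
  have DM a b : Db cj Z (a * b) = Db cj Z a * b + a * Db cj Z b by exact: (DbM CD).
  rewrite (DbD CD) !DM [Db _ _ (emb (dv 0 F) 0 j)]ZbE [Db _ _ (emb (dv 1 F) 0 j)]ZbE !e.
  move: (emb _) (emb _) (emb _) (emb _) (emb _) (emb _) cFv => a b c d' e' f' g'.
  by rewrite !mxE; ring.
by rewrite /npc !(nprojD, nprojZ) -/npc !npc_dv npc_F !scaler0 !add0r addr0 !sum2 !emb_npA.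
Qed.

Let dvC : dv 1 (dv 0 F) = dv 0 (dv 1 F).
Proof. by apply/rowP => j; rewrite !mxE dC. Qed.

Lemma hA_sym : hA 1 0 = hA 0 1. Proof. by rewrite /hA dvC. Qed.

Lemma H_coord : emb (\sum_a \sum_b gi a b *: hA a b) = H + H.
Proof.
have embD u v : emb (u + v) = emb u + emb v.
  by apply/rowP => j; rewrite !mxE cxrD.
have embZ a u : emb (a *: u) = cxr a *: emb u.
  by apply/rowP => j; rewrite !mxE cxrM.
rewrite sum2 embD !sum2 !embD !embZ.
rewrite H_h !sum2 !giE hA_sym; move: (emb _) (emb _) (emb _) => a b c.
by apply/rowP => j; rewrite !mxE; ring.
Qed.

Lemma hm_emb_comb (x y : 'I_2 -> 'I_2 -> cx A) :
  hm cj (\sum_a \sum_b x a b *: emb (hA a b)) (\sum_a \sum_b y a b *: emb (hA a b)) =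
  \sum_a \sum_b \sum_k \sum_l x a b * cj (y k l) * cxr (dot (hA a b) (hA k l)).
Proof.
have vcemb v : vc cj (emb v) = emb v.
  by apply/rowP => j; rewrite !mxE; apply: cx_eq; rewrite //= oppr0.
rewrite !sum2 -!emb_dot /hm !(vcD CD) !(vcZ CD) !vcemb.
move: (emb _) (emb _) (emb _) (emb _) => u v w t.
by rewrite !(dotDl, dotDr, dotZl, dotZr); ring.
Qed.

(** In a unit null frame |h|^2 = 2 |h(Z, Z)|^2 + 2 |h(Z, conj Z)|^2, and h(Z, conj Z) is H; with the
    inverse metric in the form of [giE] this is an expansion. *)
Lemma S_coord : cxr (\sum_a \sum_b \sum_k \sum_l gi a k * gi b l * dot (hA a b) (hA k l))
  = (hm cj f2 f2 + fr_hh cj Z cFv) *+ 2.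
Proof.
have -> : fr_hh cj Z cFv = hm cj H H.
  rewrite /fr_hh /hm (_ : vc cj H = H) //.
  exact: (H_real CD F_real comm).
rewrite f2_h H_h !hm_emb_comb.
have -> : cxr (\sum_a \sum_b \sum_k \sum_l gi a k * gi b l * dot (hA a b) (hA k l)) =
   \sum_a \sum_b \sum_k \sum_l cxr (gi a k) * cxr (gi b l) * cxr (dot (hA a b) (hA k l)).
  by rewrite !sum2 !cxrD !cxrM.
rewrite !sum2 !giE !hA_sym /cj !cjxM !cjxK.
rewrite (dotC (hA 0 1) (hA 0 0)) (dotC (hA 1 1) (hA 0 0)) (dotC (hA 1 1) (hA 0 1)).
move: (cjx (z 0)) (cjx (z 1)) (z 0) (z 1) (cxr _) (cxr _) (cxr _) (cxr _) (cxr _) (cxr _).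
by move=> x y u v a b c e f g; ring.
Qed.

(* The normal part of the derivative of H vanishes: the form in which the
   parallel mean curvature hypothesis is available. *)
Lemma parallel_tangential : (forall a, npA (dv a (map_mx (@re A) H)) = 0) ->
  exists x y, vD Z H = x *: f1 + y *: fm.
Proof.
move=> h; set Hr := map_mx (@re A) H in h.
have HrE : H = emb Hr.
  apply/rowP => j; rewrite /emb /Hr [RHS]mxE [X in cxr X]mxE.
  apply: (cx_real half).
  have /rowP/(_ j) : vc cj H = H by exact: (H_real CD F_real comm).
  by rewrite mxE.
have ZH : vD Z H = z 0 *: emb (dv 0 Hr) + z 1 *: emb (dv 1 Hr).
  rewrite HrE; apply/rowP => j; rewrite !mxE ZE /dx /= (d_0 dD) (d_0 dD).
  by [].
(* [npA] removes the directions f1, fm and F, so its vanishing leaves a combination of all three;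
   this excludes the component along F. *)
have dF : dot (vD Z H) cFv = 0.
  have hf := HF CD halfC F_real cF_unit f1_unit comm.
  have hf1 := Hf1 CD halfC F_real cF_unit f1_null comm.
  have := congr1 Z hf; rewrite (D_dot CD) (der0 CD) -/f1.
  by rewrite [X in _ + X]hf1 addr0.
have key a : emb (dv a Hr) = dot (emb (dv a Hr)) fm *: f1 + dot (emb (dv a Hr)) f1 *: fm
    + dot (emb (dv a Hr)) cFv *: cFv.
  have gen (v u w t : 'rV[cx A]_n) : v - u - w - t = 0 -> v = u + w + t.
    by move/eqP; rewrite -!addrA -!opprD subr_eq0 addrA => /eqP.
  apply: gen; rewrite -/(nproj _ _ _ _) -/npc -emb_npA h.
  by apply/rowP => j; rewrite !mxE.
have gen (u0 u1 p q c : 'rV[cx A]_n) (w0 w1 : cx A) :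
    u0 = dot u0 q *: p + dot u0 p *: q + dot u0 c *: c ->
    u1 = dot u1 q *: p + dot u1 p *: q + dot u1 c *: c ->
    dot (w0 *: u0 + w1 *: u1) c = 0 ->
    exists x y, w0 *: u0 + w1 *: u1 = x *: p + y *: q.
  move=> e0 e1; rewrite dotDl !dotZl => e2.
  exists (w0 * dot u0 q + w1 * dot u1 q), (w0 * dot u0 p + w1 * dot u1 p).
  rewrite [in LHS]e0 [in LHS]e1 -[RHS]addr0 -(scale0r c) -[X in X *: c]e2.
  move: (dot u0 q) (dot u0 p) (dot u0 c) (dot u1 q) (dot u1 p) (dot u1 c) => *.
  by apply/rowP => j; rewrite !mxE; ring.
rewrite ZH in dF *; exact: (gen _ _ _ _ _ _ _ (key 0) (key 1) dF).
Qed.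
End Coordinates.

(** * Rescaling to a minimal surface *)

Section Inverse.
Variable C : comPzRingType.
(** Picked by choice, but unique by [cinv_eq]; uniqueness is what lets a change of frame carry
    inverses to inverses. *)
Definition cinv (x : C) : C := xget 0 [set y | x * y = 1]%classic.
Lemma cinv_eq x y : x * y = 1 -> cinv x = y.
Proof.
move=> e; rewrite /cinv; case: xgetP => [z _ /= ez|/(_ y)/(_ e)//].
by rewrite -[LHS]mulr1 -e mulrCA mulrA ez mul1r.
Qed.
Lemma mul_cinv x y : x * y = 1 -> x * cinv x = 1.
Proof. by move=> e; rewrite (cinv_eq e). Qed.
End Inverse.

(* Multiplying the frame by a constant kap rescales the sphere to radius 1/kap. *)
Section Rescale.
Variables (C : comPzRingType) (cj D : C -> C) (kap : C).
Definition kD x := kap * D x.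
Variables (n : nat) (F : 'rV[C]_n).
(** Only the derivation and its structure function are scaled. The vector f1 stays [fr1 D F], of
    unit length, so that [kt] is |h(Z, Z)|^2 / (1 + |H|^2). *)
Definition krho := kap * fr_rho cj D F.
Definition kt := mt cj kD krho (fr1 D F).
Definition kti := cinv kt.
Definition kr := mr cj kD krho (fr1 D F) kti.
Definition kri := cinv kr.
Definition kN := mN cj kD krho (fr1 D F) kti.
Definition ktau := mtau cj kD krho (fr1 D F) kti kri.

Hypothesis CD : conj_derivation cj D.
Hypothesis kap_real : cj kap = kap.
Hypothesis D_kap : D kap = 0.

Lemma kD_CD : conj_derivation cj kD.
Proof.
split; [exact: (cjD CD)|exact: (cjM CD)|exact: (cjK CD)| |] => a b; rewrite /kD.
  by rewrite (derD CD); ring.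
by rewrite (derM CD); ring.
Qed.

Lemma kDb x : Db cj kD x = kap * Db cj D x.
Proof. by rewrite /Db /kD (cjM CD) kap_real. Qed.

Lemma klap x : lap cj kD krho x = kap ^+ 2 * lap cj D (fr_rho cj D F) x.
Proof.
rewrite /lap !comm_0 kDb /kD (DbM CD) /krho (cjM CD) kap_real.
have -> : Db cj D kap = 0 by rewrite /Db kap_real D_kap (cj0 CD).
by ring.
Qed.

Lemma kdd w (u : 'rV[C]_n) : vdd kD krho w u = kap *: vdd D (fr_rho cj D F) w u.
Proof. by apply/rowP => j; rewrite !mxE /dd /kD /krho; ring. Qed.

Lemma kdb w (u : 'rV[C]_n) : vdb cj kD krho w u = kap *: vdb cj D (fr_rho cj D F) w u.
Proof.
by apply/rowP => j; rewrite !mxE /db kDb /krho (cjM CD) kap_real; ring.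
Qed.

Hypothesis comm : forall a, D (Db cj D a) - Db cj D (D a) =
  fr_rho cj D F * Db cj D a - cj (fr_rho cj D F) * D a.

Lemma kcomm a : kD (Db cj kD a) - Db cj kD (kD a) =
  krho * Db cj kD a - cj krho * kD a.
Proof.
rewrite !kDb /kD (derM CD) (DbM CD) D_kap /krho (cjM CD) kap_real.
have -> : Db cj D kap = 0 by rewrite /Db kap_real D_kap (cj0 CD).
transitivity (kap ^+ 2 * (D (Db cj D a) - Db cj D (D a))); first by ring.
by rewrite comm; ring.
Qed.

Hypothesis half : forall a : C, a + a = 0 -> a = 0.
Hypothesis F_real : vc cj F = F.
Hypothesis F_unit : dot F F = 1.
Hypothesis f1_null : dot (fr1 D F) (fr1 D F) = 0.
Hypothesis f1_unit : hm cj (fr1 D F) (fr1 D F) = 1.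
Hypothesis H_parallel : exists x y,
  vD D (fr_H cj D F) = x *: fr1 D F + y *: vc cj (fr1 D F).
Hypothesis Q0 : fr_Q cj D F = 0.
Hypothesis kapK : kap ^+ 2 * (1 + fr_hh cj D F) = 1.

Let f2 := fr2 cj D F.

Lemma kf2 : mf2 kD krho (fr1 D F) = kap *: f2.
Proof. exact: kdd. Qed.

Lemma ktE : kt = kap ^+ 2 * hm cj f2 f2.
Proof. by rewrite /kt /mt kf2 hmZl (hmZr CD) kap_real; ring. Qed.

Lemma dotf2F : dot f2 F = 0.
Proof.
have e1 := dotFf1 CD half F_unit; have := congr1 D e1.
rewrite (D_dot CD) (der0 CD) -/(fr1 D F) f1_null add0r dotC => e2.
rewrite /f2 /fr2 (_ : vdd _ _ _ _ = vD D (fr1 D F) + fr_rho cj D F *: fr1 D F).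
  by rewrite dotDl dotZl e2 (dotC _ F) e1 mulr0 addr0.
by apply/rowP => j; rewrite !mxE /dd mulr1n.
Qed.

Lemma kf2f1 : hm cj (mf2 kD krho (fr1 D F)) (fr1 D F) = 0.
Proof. by rewrite kf2 hmZl [hm _ _ _](f2fm f1_unit) mulr0. Qed.

(** [vdb] of f1 is a multiple of [H - F], and f2 is orthogonal to H precisely because Q = 0; the
    same fact removes the conjugate component in [kdb_f2]. *)
Lemma kf2n : hm cj (mf2 kD krho (fr1 D F)) (vdb cj kD krho 1 (fr1 D F)) = 0.
Proof.
have -> : vdb cj kD krho 1 (fr1 D F) = kap *: (fr_H cj D F - F).
  by rewrite kdb /fr_H addrK.
rewrite kf2 hmZl (hmZr CD) /hm (vcD CD) (vcN CD) F_real (H_real CD F_real comm).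
by rewrite dotDr dotNr (dotC f2 (fr_H cj D F)) -/(fr_Q cj D F) Q0 dotf2F subrr !mulr0.
Qed.

Lemma kdb_f2 : vdb cj kD krho 2 (mf2 kD krho (fr1 D F)) = - kt *: fr1 D F.
Proof.
rewrite kf2 kdb ktE; have e := db_f2 CD half F_real F_unit f1_null f1_unit comm H_parallel.
have -> : vdb cj D (fr_rho cj D F) 2 (kap *: f2) = kap *: vdb cj D (fr_rho cj D F) 2 f2.
  apply/rowP => j; rewrite !mxE /db (DbM CD) /Db kap_real D_kap (cj0 CD); ring.
rewrite e Q0 scale0r subr0 -/f2.
by apply/rowP => j; rewrite !mxE; ring.
Qed.

Lemma kgauss : frK cj kD krho = 1 - kt.
Proof.
have e := Gauss CD half F_real F_unit f1_null f1_unit comm H_parallel.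
have -> : frK cj kD krho = kap ^+ 2 * frK cj D (fr_rho cj D F).
  rewrite /frK kDb /kD /krho (DbM CD) !(cjM CD) kap_real !(derM CD) D_kap.
  by rewrite /Db kap_real D_kap (cj0 CD); ring.
by rewrite e ktE -/f2 mulrBr kapK.
Qed.
End Rescale.

Section RescaleMorphism.
Variables (C C' : comPzRingType) (cj D : C -> C) (cj' D' : C' -> C').
Variables (CD : conj_derivation cj D) (CD' : conj_derivation cj' D').
Variables (th : C -> C') (lam : C') (FM : frame_morph cj D cj' D' th lam).
Variables (n : nat) (F : 'rV[C]_n) (F' : 'rV[C']_n) (kap : C) (kap' : C').
Hypothesis FE : F' = tv th F.
Hypothesis f1_unit : hm cj (fr1 D F) (fr1 D F) = 1.
Hypothesis th1 : th 1 = 1.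
Hypothesis kapE : kap' = th kap.
Hypothesis kap_real' : cj' kap' = kap'.
Hypothesis D_kap' : D' kap' = 0.

Lemma kFM : frame_morph cj (kD D kap) cj' (kD D' kap') th lam.
Proof.
split; [exact: (thD FM)|exact: (thM FM)|exact: (th_cj FM)| |exact: (lamK FM)].
by move=> a; rewrite /kD (th_der FM) (thM FM) kapE; ring.
Qed.

Let CDk := kD_CD kap' CD'.

Lemma krhoE : krho cj' D' kap' F' = lam * th (krho cj D kap F) - cj' lam * kD D' kap' lam.
Proof. by rewrite /krho (th_rho CD' FM FE f1_unit th1) (thM FM) kapE /kD; ring. Qed.

Let f1E : fr1 D' F' = lam *: tv th (fr1 D F) := tv_fr1 FM FE.

Lemma th_kt : kt cj' D' kap' F' = th (kt cj D kap F).
Proof. exact: (th_mt CDk kFM krhoE f1E). Qed.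

Hypothesis tK : exists ti, kt cj D kap F * ti = 1.

Lemma th_kti : kti cj' D' kap' F' = th (kti cj D kap F).
Proof.
apply: cinv_eq; case: tK => ti /mul_cinv e.
by rewrite th_kt -(thM FM) e th1.
Qed.

Lemma th_kr : kr cj' D' kap' F' = th (kr cj D kap F).
Proof. exact: (th_mr CDk kFM krhoE f1E th_kti). Qed.

Lemma th_kN : kN cj' D' kap' F' = th (kN cj D kap F).
Proof. exact: (th_mN CDk kFM krhoE f1E th_kti). Qed.

Hypothesis rK : exists ri, kr cj D kap F * ri = 1.

Lemma th_kri : kri cj' D' kap' F' = th (kri cj D kap F).
Proof.
apply: cinv_eq; case: rK => ri /mul_cinv e.
by rewrite th_kr -(thM FM) e th1.
Qed.

Lemma th_ktau : ktau cj' D' kap' F' = th (ktau cj D kap F).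
Proof. exact: (th_mtau CDk kFM krhoE f1E th_kti th_kri). Qed.
End RescaleMorphism.

(** * Pointwise inequalities *)

Section Numeric.
Variable R : realFieldType.
Implicit Types t r it N : R.

(** Here (a1, a2) and (x1, x2) are the components of D t and D r, and [it] is 1 / t. As lap log (t^3
    r) = 9 - 12 t + 2 r / t + tau / r, the exponent 3 leaves a positive multiple of r / t, so a
    maximum bounds r. At a critical point x = - 3 r a / t, and Cauchy-Schwarz then plays the part of
    tau >= 0. *)
Lemma num_t3r t r it N a1 a2 x1 x2 :
  0 < t -> 0 < r -> t * it = 1 ->
  t * x1 = - 3 * r * a1 -> t * x2 = - 3 * r * a2 -> x1 ^+ 2 + x2 ^+ 2 <= N * r ->
  t ^+ 3 * ((3 * (1 - t) - r * it) * r + N)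
  + r * (3 * t ^+ 2 * ((2 - 3 * t) * t + r + (a1 ^+ 2 + a2 ^+ 2) * it)
         + 6 * t * (a1 ^+ 2 + a2 ^+ 2))
  + 6 * t ^+ 2 * (a1 * x1 + a2 * x2) <= 0 ->
  9 * t - 12 * t ^+ 2 + 2 * r <= 0.
Proof.
move=> t0 r0 tK e1 e2 cs h.
set A := a1 ^+ 2 + a2 ^+ 2 in h.
have eX : t ^+ 2 * (x1 ^+ 2 + x2 ^+ 2) = 9 * r ^+ 2 * A.
  transitivity ((t * x1) ^+ 2 + (t * x2) ^+ 2); first by ring.
  by rewrite e1 e2 /A; ring.
have eA : t * (a1 * x1 + a2 * x2) = - 3 * r * A.
  transitivity (a1 * (t * x1) + a2 * (t * x2)); first by ring.
  by rewrite e1 e2 /A; ring.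
have h1 : 9 * r * A <= t ^+ 2 * N.
  rewrite -(ler_pM2r r0); have := ler_wpM2l (ltW (exprn_gt0 2 t0)) cs.
  by rewrite eX; move=> h1; lra.
have h2 : t ^+ 2 * r * (9 * t - 12 * t ^+ 2 + 2 * r) <= 0.
  apply: le_trans h.
  have -> : t ^+ 3 * ((3 * (1 - t) - r * it) * r + N) + r *
     (3 * t ^+ 2 * ((2 - 3 * t) * t + r + A * it) + 6 * t * A) +
     6 * t ^+ 2 * (a1 * x1 + a2 * x2) =
     t ^+ 2 * r * (9 * t - 12 * t ^+ 2 + 2 * r) + t * (t ^+ 2 * N - 9 * r * A)
     + 6 * t * (t * (a1 * x1 + a2 * x2) + 3 * r * A)
     + (t * it - 1) * (3 * t * r * A - t ^+ 2 * r ^+ 2) by ring.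
  rewrite eA tK subrr mul0r addr0 (_ : - 3 * r * A + 3 * r * A = 0) ?mulr0 ?addr0; last by ring.
  by rewrite lerDl mulr_ge0 ?subr_ge0 // ltW.
by move: h2; rewrite pmulr_rle0 // mulr_gt0 // exprn_gt0.
Qed.

(** The summand 6 r contributes 6 N, which outweighs all negative terms in N; the gradient term of 8
    t absorbs the product of a and x. *)
Lemma num_N t r it N a1 a2 x1 x2 E :
  5 / 6 <= t <= 9 / 10 -> t * it = 1 -> 0 <= r * it -> r * it <= 23 / 25 -> 0 <= N ->
  x1 ^+ 2 + x2 ^+ 2 <= N * r -> 0 <= E ->
  E + (3 * (1 - t) - r * it) ^+ 2 * r + (x1 ^+ 2 + x2 ^+ 2) * it + 4 * (1 - t) * N
  + 2 * ((3 * (1 - t) - r * it) * N - 2 * ((x1 ^+ 2 + x2 ^+ 2) * it))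
  + 2 * (r * it * it - 3) * (a1 * x1 + a2 * x2)
  + 6 * ((3 * (1 - t) - r * it) * r + N)
  + 8 * ((2 - 3 * t) * t + r + (a1 ^+ 2 + a2 ^+ 2) * it) <= 0 ->
  N <= 4.
Proof.
move=> /andP[tl tu] tK; set s := r * it => s0 s1 N0 cs E0.
have t0 : 0 < t by lra.
have it0 : 0 < it by rewrite -(pmulr_rgt0 _ t0) tK.
have rs : r = s * t by rewrite /s -mulrA (mulrC it) tK mulr1.
have itl : 10 / 9 <= it.
  by have := ler_wpM2r (ltW it0) tu; rewrite tK; lra.
have itu : it <= 6 / 5.
  by have := ler_wpM2r (ltW it0) tl; rewrite tK; lra.
have r0 : 0 <= r by rewrite rs mulr_ge0 // ltW.
have ru : r <= 207 / 250.
  by rewrite rs; have := ler_pM s0 (ltW t0) s1 tu; lra.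
set X := x1 ^+ 2 + x2 ^+ 2 in cs *; set A := a1 ^+ 2 + a2 ^+ 2.
have X0 : 0 <= X by rewrite addr_ge0 ?sqr_ge0.
have A0 : 0 <= A by rewrite addr_ge0 ?sqr_ge0.
have Xit : X * it <= N * s.
  have := ler_wpM2r (ltW it0) cs; by rewrite -mulrA.
set q := s * it - 3.
have q1 : - 3 <= q by rewrite /q; have := mulr_ge0 s0 (ltW it0); lra.
have q2 : q <= 0.
  by rewrite /q; have := ler_pM s0 (ltW it0) s1 itu; lra.
(* Completing the square works because 44/5 times 45/44 is 9 and [q ^+ 2 <= 9]; the value 44/5 lies
   just below the coefficient 80/9 that 8 t supplies. *)
have cross : 0 <= 44 / 5 * A + 2 * q * (a1 * x1 + a2 * x2) + 45 / 44 * X.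
  have -> : 44 / 5 * A + 2 * q * (a1 * x1 + a2 * x2) + 45 / 44 * X =
    5 / 44 * ((44 / 5 * a1 + q * x1) ^+ 2 + (44 / 5 * a2 + q * x2) ^+ 2)
    + 5 / 44 * (9 - q ^+ 2) * X by rewrite /A /X; field.
  have c0 : 0 <= 5 / 44 :> R by lra.
  have q9 : 0 <= 9 - q ^+ 2 by rewrite subr_ge0 expr2; nra.
  apply: addr_ge0; first by apply: mulr_ge0 => //; apply: addr_ge0; exact: sqr_ge0.
  by apply: mulr_ge0 => //; exact: mulr_ge0.
have Ait : 80 / 9 * A <= 8 * (A * it) by have := ler_wpM2l A0 itl; lra.
have XN : X <= N * (207 / 250) by apply: le_trans cs _; rewrite ler_wpM2l.
have Ns : N * s <= N * (23 / 25) by rewrite ler_wpM2l.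
have Nt : N * t <= N * (9 / 10) by rewrite ler_wpM2l.
have sr : s * r <= 23 / 25 * r by rewrite ler_wpM2r.
have tr : t * r <= r by rewrite ler_piMl //; lra.
have sq0 : 0 <= (3 * (1 - t) - s) ^+ 2 * r by rewrite mulr_ge0 ?sqr_ge0.
have tt : t * (2 - 3 * t) >= - (63 / 100) by nra.
move: sq0; move: ((3 * (1 - t) - s) ^+ 2 * r) => Y Y0 h.
have {}h : E + Y + X * it + 4 * (N - N * t) + 2 * (3 * N - 3 * (N * t) - N * s - 2 * (X * it))
  + 2 * q * (a1 * x1 + a2 * x2) + 6 * (3 * r - 3 * (t * r) - s * r + N)
  + 8 * (t * (2 - 3 * t) + r) + 8 * (A * it) <= 0.
  by apply: le_trans h; rewrite le_eqVlt /q; apply/orP; left; apply/eqP; ring.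
lra.
Qed.

(** Since t >= 5/6, the term 50 t (2 - 3 t) is at most - 41/2, whereas N, 53 r and the gradient term
    together stay below 17. The equations for x1 and x2 express that r + 50 t is critical; with
    Cauchy-Schwarz they make the gradient of t small. *)
Lemma num_r0 t r it N a1 a2 x1 x2 :
  5 / 6 <= t <= 9 / 10 -> t * it = 1 -> 0 <= r -> r <= 12 / 100 -> 0 <= N -> N <= 10 ->
  x1 = - 50 * a1 -> x2 = - 50 * a2 -> x1 ^+ 2 + x2 ^+ 2 <= N * r ->
  (3 * (1 - t) - r * it) * r + N
  + 50 * ((2 - 3 * t) * t + r + (a1 ^+ 2 + a2 ^+ 2) * it) < 0.
Proof.
move=> /andP[tl tu] tK r0 r1 N0 N1 -> -> cs.
have t0 : 0 < t by lra.
have it0 : 0 < it by rewrite -(pmulr_rgt0 _ t0) tK.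
have itu : it <= 6 / 5.
  by have := ler_wpM2r (ltW it0) tl; rewrite tK; lra.
set A := a1 ^+ 2 + a2 ^+ 2.
have A0 : 0 <= A by rewrite addr_ge0 ?sqr_ge0.
have Nr : N * r <= 10 * r by exact: ler_wpM2r.
have A1 : A <= 1 / 100.
  have e : (- 50 * a1) ^+ 2 + (- 50 * a2) ^+ 2 = 50 * (50 * A) by rewrite /A; ring.
  by rewrite e in cs; lra.
have Ait : A * it <= A * (6 / 5) by exact: ler_wpM2l.
have tr : t * r >= 0 by rewrite mulr_ge0 // ltW.
have ir : r * it * r >= 0 by rewrite !mulr_ge0 // ltW.
have tt : t * (2 - 3 * t) <= - (41 / 100) by nra.
have -> : (3 * (1 - t) - r * it) * r + N + 50 * ((2 - 3 * t) * t + r + A * it) =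
  3 * r - 3 * (t * r) - r * it * r + N + 50 * (t * (2 - 3 * t)) + 50 * r + 50 * (A * it) by ring.
lra.
Qed.

(** [lw] is the Laplacian of w = t r tau by the product rule; in w lw the terms r / t and tau / r
    cancel, and |Dw|^2 appears as a sum of squares. *)
Lemma num_w t r ta it ir N a1 a2 x1 x2 b1 b2 G lw :
  0 < t -> 0 < r -> 0 < ta -> t * it = 1 -> r * ir = 1 ->
  ta = N - (x1 ^+ 2 + x2 ^+ 2) * ir -> b1 ^+ 2 + b2 ^+ 2 <= G * ta ->
  lw = ((2 - 3 * t) * t + r + (a1 ^+ 2 + a2 ^+ 2) * it) * r * ta
    + t * ((3 * (1 - t) - r * it) * r + N) * ta
    + t * r * ((4 * (1 - t) - ta * ir) * ta + G)
    + 2 * (a1 * x1 + a2 * x2) * ta + 2 * (a1 * b1 + a2 * b2) * r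
    + 2 * (x1 * b1 + x2 * b2) * t ->
  (t * r * ta) ^+ 2 * (9 - 10 * t) <= (t * r * ta) * lw.
Proof.
move=> t0 r0 ta0 tK rK taE cs ->.
have NE : N = ta + (x1 ^+ 2 + x2 ^+ 2) * ir by rewrite taE subrK.
set X := x1 ^+ 2 + x2 ^+ 2 in NE *; set A := a1 ^+ 2 + a2 ^+ 2.
(* The components of the derivative of w. *)
pose d1 := a1 * r * ta + t * x1 * ta + t * r * b1.
pose d2 := a2 * r * ta + t * x2 * ta + t * r * b2.
rewrite -subr_ge0.
have -> : t * r * ta *
  (((2 - 3 * t) * t + r + A * it) * r * ta + t * ((3 * (1 - t) - r * it) * r + N) * ta +
   t * r * ((4 * (1 - t) - ta * ir) * ta + G) + 2 * (a1 * x1 + a2 * x2) * ta +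
   2 * (a1 * b1 + a2 * b2) * r + 2 * (x1 * b1 + x2 * b2) * t) -
  (t * r * ta) ^+ 2 * (9 - 10 * t) =
  d1 ^+ 2 + d2 ^+ 2 + (t * r) ^+ 2 * (G * ta - (b1 ^+ 2 + b2 ^+ 2))
  + (t * it - 1) * (r ^+ 2 * ta ^+ 2 * A - t * r ^+ 3 * ta ^+ 2)
  + (r * ir - 1) * (t ^+ 2 * ta ^+ 2 * X - t ^+ 2 * r * ta ^+ 3).
  by rewrite NE /d1 /d2 /A /X; ring.
rewrite tK rK !subrr !mul0r !addr0 addr_ge0 // ?addr_ge0 ?sqr_ge0 //.
by rewrite mulr_ge0 ?sqr_ge0 // subr_ge0.
Qed.

(* v = 1 / (t r), at a point where tau = 0. *)
Lemma num_v t r it ir N a1 a2 x1 x2 v v1 v2 lv :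
  0 < t -> 0 < r -> t * it = 1 -> r * ir = 1 -> N = (x1 ^+ 2 + x2 ^+ 2) * ir ->
  t * r * v = 1 ->
  (a1 * r + t * x1) * v + t * r * v1 = 0 ->
  (a2 * r + t * x2) * v + t * r * v2 = 0 ->
  (((2 - 3 * t) * t + r + (a1 ^+ 2 + a2 ^+ 2) * it) * r
    + t * ((3 * (1 - t) - r * it) * r + N) + 2 * (a1 * x1 + a2 * x2)) * v
    + t * r * lv + 2 * ((a1 * r + t * x1) * v1 + (a2 * r + t * x2) * v2) = 0 ->
  lv = (v1 ^+ 2 + v2 ^+ 2) * (t * r) + (6 * t - 5) * v.
Proof.
move=> t0 r0 tK rK NE vK e1 e2.
set u1 := a1 * r + t * x1 in e1 *; set u2 := a2 * r + t * x2 in e2 *.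
have tr0 : t * r != 0 by rewrite mulf_neq0 // gt_eqF.
have f1 : u1 = - (t * r) ^+ 2 * v1.
  transitivity (u1 * (t * r * v)); first by rewrite vK mulr1.
  transitivity (t * r * (u1 * v + t * r * v1) - (t * r) ^+ 2 * v1); first by ring.
  by rewrite e1; ring.
have f2 : u2 = - (t * r) ^+ 2 * v2.
  transitivity (u2 * (t * r * v)); first by rewrite vK mulr1.
  transitivity (t * r * (u2 * v + t * r * v2) - (t * r) ^+ 2 * v2); first by ring.
  by rewrite e2; ring.
set lu := _ + 2 * (a1 * x1 + a2 * x2) => e.
(* This is lap log (t r) = 5 - 6 t, multiplied by (t r)^2; [lu] is the Laplacian of t r. *)
have luE : t * r * lu = (t * r) ^+ 2 * (5 - 6 * t) + (u1 ^+ 2 + u2 ^+ 2).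
  rewrite /lu NE /u1 /u2.
  transitivity ((t * r) ^+ 2 * (5 - 6 * t) + ((a1 * r + t * x1) ^+ 2 + (a2 * r + t * x2) ^+ 2)
   + (t * it - 1) * (r ^+ 2 * (a1 ^+ 2 + a2 ^+ 2) - t * r ^+ 3)
   + (r * ir - 1) * (t ^+ 2 * (x1 ^+ 2 + x2 ^+ 2))); first by ring.
  by rewrite tK rK !subrr !mul0r !addr0.
apply: (mulfI tr0); apply: (mulfI tr0).
have : t * r * v * lu + (t * r) ^+ 2 * lv
   + 2 * (t * r) * (u1 * v1 + u2 * v2) = 0.
  by rewrite -[RHS](mulr0 (t * r)) -e; ring.
have -> : t * r * v * lu = v * ((t * r) ^+ 2 * (5 - 6 * t) + (u1 ^+ 2 + u2 ^+ 2)).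
  by rewrite -luE; ring.
rewrite f1 f2 => {}e.
have -> : t * r * (t * r * lv) = (t * r) ^+ 2 * lv by ring.
have {e}-> : (t * r) ^+ 2 * lv = - (v * ((t * r) ^+ 2 * (5 - 6 * t) +
   ((- (t * r) ^+ 2 * v1) ^+ 2 + (- (t * r) ^+ 2 * v2) ^+ 2)))
   - 2 * (t * r) * (- (t * r) ^+ 2 * v1 * v1 + - (t * r) ^+ 2 * v2 * v2).
  by apply/eqP; rewrite -subr_eq0; apply/eqP; rewrite -[RHS]e; ring.
transitivity ((t * r) ^+ 2 * ((6 * t - 5) * v) + 2 * (t * r) ^+ 3 * (v1 ^+ 2 + v2 ^+ 2)
  - (t * r * v) * (t * r) ^+ 3 * (v1 ^+ 2 + v2 ^+ 2)); first by ring.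
by rewrite vK; ring.
Qed.
End Numeric.

(** * Cauchy-Schwarz inequality and evaluation of the identities at a point *)

Section Cauchy.
Variables (R : realFieldType) (n : nat).
Notation hmR := (hm (@cjx R)).
Implicit Types u v : 'rV[cx R]_n.
Definition cn (z : cx R) : R := re z ^+ 2 + im z ^+ 2.
Lemma cn_ge0 z : 0 <= cn z. Proof. by rewrite addr_ge0 ?sqr_ge0. Qed.

(** The zero derivation makes the general rules for [hm] available for numerical vectors. *)
Lemma cjx_CD : conj_derivation (@cjx R) (fun=> 0).
Proof. by split=> *; apply: cx_eq => //=; ring. Qed.

Lemma hmRE u : hmR u u = cxr (\sum_j cn (u 0 j)).
Proof.
have e j : u 0 j * (vc (@cjx R) u) 0 j = cxr (cn (u 0 j)).
  by rewrite mxE; apply: cx_eq => /=; rewrite /cn; ring.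
rewrite /hm /dot (eq_bigr _ (fun j _ => e j)); apply: esym.
by apply: (big_morph (@cxr R)) => // a b; exact: cxrD.
Qed.

Lemma hmR_ge0 u : 0 <= re (hmR u u).
Proof. by rewrite hmRE /= sumr_ge0 // => j _; exact: cn_ge0. Qed.

Lemma hmR_cauchy u v : cn (hmR u v) <= re (hmR u u) * re (hmR v v).
Proof.
set B := re (hmR v v); have B0 : 0 <= B := hmR_ge0 v.
have vB : hmR v v = cxr B by rewrite /B hmRE.
have uA : hmR u u = cxr (re (hmR u u)) by rewrite hmRE.
have [Bz|Bnz] := eqVneq B 0.
  have v0 : v = 0.
    apply/rowP => j; rewrite mxE; have := Bz; rewrite /B hmRE /= => /eqP.
    rewrite psumr_eq0 => [/allP/(_ j)|k _]; last exact: cn_ge0.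
    rewrite mem_index_enum => /(_ isT) /=; rewrite /cn paddr_eq0 ?sqr_ge0 // !sqrf_eq0.
    by move=> /andP[/eqP a /eqP b]; apply: cx_eq.
  have -> : hmR u v = 0.
    by rewrite v0 -[0](scale0r v) (hmZr cjx_CD) (cj0 cjx_CD) mul0r.
  by rewrite Bz mulr0 /cn /= expr2 mulr0 addr0.
have {}B0 : 0 < B by rewrite lt_neqAle eq_sym Bnz.
set h := hmR u v; have hC : hmR v u = cjx h by rewrite (cj_hm cjx_CD).
(* The squared length of B u - h v is B (A B - |h|^2), where A is that of u. *)
have := hmR_ge0 (cxr B *: u + (- h) *: v).
rewrite (hmDl) (hmDr cjx_CD) (hmDr cjx_CD) !hmZl !(hmZr cjx_CD) -/h hC vB uA.
have hh : h * cjx h = cxr (cn h) by apply: cx_eq => /=; rewrite /cn; ring.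
have cB : cjx (cxr B) = cxr B by apply: cx_eq; rewrite //= oppr0.
set A := re (hmR u u).
have -> : cxr B * (cjx (cxr B) * cxr A) + cxr B * (cjx (- h) * h) +
    (- h * (cjx (cxr B) * cjx h) + - h * (cjx (- h) * cxr B)) = cxr (B * (A * B - cn h)).
  have gen (b a y y' : cx R) : b * (b * a) + b * (- y' * y) +
    (- y * (b * y') + - y * (- y' * b)) = b * (b * a) - b * (y * y') by ring.
  by rewrite cB (cjN cjx_CD) gen hh; apply: cx_eq => /=; ring.
by rewrite /= pmulr_rge0 // subr_ge0.
Qed.
End Cauchy.

Section Eval.
Variables (R : realFieldType) (C : comPzRingType) (cj D : C -> C) (rho : C).
Hypothesis CD : conj_derivation cj D.
Variable ev : C -> cx R.
Hypothesis evD : forall a b, ev (a + b) = ev a + ev b.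
Hypothesis evM : forall a b, ev (a * b) = ev a * ev b.
Hypothesis ev1 : ev 1 = 1.
Hypothesis evcj : forall a, ev (cj a) = cjx (ev a).

Lemma ev0 : ev 0 = 0.
Proof. by apply: (addIr (ev 0)); rewrite -evD !add0r. Qed.
Lemma evN a : ev (- a) = - ev a.
Proof. by apply: (addIr (ev a)); rewrite -evD !addNr ev0. Qed.
Lemma evMn a k : ev (a *+ k) = ev a *+ k.
Proof. by elim: k => [|k IH]; rewrite ?ev0 // !mulrS evD IH. Qed.

Lemma ev_real a : cj a = a -> ev a = cxr (re (ev a)).
Proof.
move=> e; apply: (@cx_real _ (ev a)); last by rewrite -evcj e.
by move=> b b0; apply/eqP; move/eqP: b0; rewrite -mulr2n mulrn_eq0.
Qed.

Lemma ev_hm n (u v : 'rV[C]_n) : ev (hm cj u v) = hm (@cjx R) (map_mx ev u) (map_mx ev v).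
Proof.
rewrite /hm /dot (big_morph ev evD ev0); apply: eq_bigr => j _.
by rewrite evM !mxE evcj.
Qed.

Lemma ev_ge0 n (u : 'rV[C]_n) : 0 <= re (ev (hm cj u u)).
Proof. by rewrite ev_hm hmR_ge0. Qed.
Lemma ev_cauchy n (u v : 'rV[C]_n) :
  cn (ev (hm cj u v)) <= re (ev (hm cj u u)) * re (ev (hm cj v v)).
Proof. by rewrite !ev_hm hmR_cauchy. Qed.

(* The value of x at a point, the two components of its derivative along the
   frame, and its Laplacian. *)
Definition j0 x := re (ev x).
Definition j1 x := re (ev (D x)).
Definition j1' x := im (ev (D x)).
Definition j2 x := re (ev (lap cj D rho x)).

Lemma jD x y : [/\ j0 (x + y) = j0 x + j0 y, j1 (x + y) = j1 x + j1 y,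
  j1' (x + y) = j1' x + j1' y & j2 (x + y) = j2 x + j2 y].
Proof. by rewrite /j0 /j1 /j1' /j2 (derD CD) (lapD CD) !evD. Qed.

Lemma jMn x k : [/\ j0 (x *+ k) = j0 x *+ k, j1 (x *+ k) = j1 x *+ k,
  j1' (x *+ k) = j1' x *+ k & j2 (x *+ k) = j2 x *+ k].
Proof.
have lap0 : lap cj D rho 0 = 0 by rewrite /lap comm_0 (der0 CD) (Db0 CD); ring.
elim: k => [|k [h1 h2 h3 h4]].
  by rewrite /j0 /j1 /j1' /j2 (der0 CD) lap0 ev0.
by rewrite !mulrS; have [-> -> -> ->] := jD x (x *+ k); rewrite h1 h2 h3 h4.
Qed.

Lemma jM x y : cj x = x -> cj y = y ->
  [/\ j0 (x * y) = j0 x * j0 y, j1 (x * y) = j1 x * j0 y + j0 x * j1 y,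
  j1' (x * y) = j1' x * j0 y + j0 x * j1' y &
  j2 (x * y) = j2 x * j0 y + j0 x * j2 y + 2 * (j1 x * j1 y + j1' x * j1' y)].
Proof.
move=> ex ey; have hx := ev_real ex; have hy := ev_real ey.
have bx : Db cj D x = cj (D x) by rewrite /Db ex.
have by_ : Db cj D y = cj (D y) by rewrite /Db ey.
rewrite /j0 /j1 /j1' /j2 (derM CD) (lapM CD) bx by_ !(evD, evM) !evcj hx hy !reimE /=.
by split; ring.
Qed.

Lemma jN x : j0 x + j0 (- x) = 0 /\ [/\ j1 (- x) = - j1 x,
  j1' (- x) = - j1' x & j2 (- x) = - j2 x].
Proof.
have e : lap cj D rho (- x) = - lap cj D rho x.
  by rewrite /lap !comm_0 (derN CD) (DbN CD); ring.
by rewrite /j0 /j1 /j1' /j2 (derN CD) e !evN subrr.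
Qed.

Hypothesis comm : forall a,
  D (Db cj D a) - Db cj D (D a) = rho * Db cj D a - cj rho * D a.
Variables (n : nat) (f1 : 'rV[C]_n) (ti ri : C).
Notation mf2 := (mf2 D rho f1).
Notation mt := (mt cj D rho f1).
Notation mpsi3 := (mpsi3 cj D rho f1 ti).
Notation mr := (mr cj D rho f1 ti).
Notation meta := (meta cj D rho f1 ti).
Notation mN := (mN cj D rho f1 ti).
Notation mxi := (mxi cj D rho f1 ti).
Notation mpsi4 := (mpsi4 cj D rho f1 ti ri).
Notation mtau := (mtau cj D rho f1 ti ri).
Hypothesis f2f1 : hm cj mf2 f1 = 0.
Hypothesis f2n : hm cj mf2 (vdb cj D rho 1 f1) = 0.
Hypothesis db_f2 : vdb cj D rho 2 mf2 = - mt *: f1.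
Hypothesis gauss : frK cj D rho = 1 - mt.
Hypothesis tK : mt * ti = 1.

Let t := j0 mt.
Let r := j0 mr.
Let N := j0 mN.
Let it := j0 ti.
Let a1 := j1 mt.
Let a2 := j1' mt.
Let x1 := j1 mr.
Let x2 := j1' mr.

Let rt : cj mt = mt. Proof. exact: mt_real. Qed.
Let rr : cj mr = mr. Proof. exact: mr_real. Qed.
Let rN : cj mN = mN. Proof. exact: mN_real. Qed.
Let rti : cj ti = ti. Proof. exact: ti_real tK. Qed.

Lemma tK0 : t * it = 1.
Proof.
have := congr1 (fun x => re (ev x)) tK; rewrite evM ev1.
by rewrite (ev_real rt) (ev_real rti) reimE /= mul0r subr0.
Qed.

Lemma r_ge0 : 0 <= r. Proof. exact: ev_ge0. Qed.
Lemma N_ge0 : 0 <= N. Proof. exact: ev_ge0. Qed.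

Lemma xi_cauchy : x1 ^+ 2 + x2 ^+ 2 <= N * r.
Proof.
rewrite /x1 /x2 /j1 /j1' (D_mr CD comm f2f1 db_f2 tK).
exact: (ev_cauchy meta mpsi3).
Qed.

Lemma j2t : j2 mt = (2 - 3 * t) * t + r + (a1 ^+ 2 + a2 ^+ 2) * it.
Proof.
rewrite /j2 (lap_mt CD comm f2f1 db_f2 gauss tK) !(evD, evM, evN, evMn) ev1 !evcj.
rewrite (ev_real rt) (ev_real rti) (ev_real rr) !reimE /= -/(j0 mt) -/(j0 mr) -/(j0 ti) -/t -/r -/it.
by rewrite -/(j1 mt) -/(j1' mt) -/a1 -/a2; ring.
Qed.

Lemma j2r : j2 mr = (3 * (1 - t) - r * it) * r + N.
Proof.
rewrite /j2 (lap_mr CD comm f2f1 db_f2 gauss tK) !(evD, evM, evN, evMn) ev1.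
rewrite (ev_real rt) (ev_real rti) (ev_real rr) (ev_real rN) !reimE /=.
by rewrite -/(j0 mt) -/(j0 mr) -/(j0 ti) -/(j0 mN) -/t -/r -/it -/N; ring.
Qed.

Lemma j2N : exists2 E, 0 <= E & j2 mN =
  E + (3 * (1 - t) - r * it) ^+ 2 * r + (x1 ^+ 2 + x2 ^+ 2) * it + 4 * (1 - t) * N
  + 2 * ((3 * (1 - t) - r * it) * N - 2 * ((x1 ^+ 2 + x2 ^+ 2) * it))
  + 2 * (r * it * it - 3) * (a1 * x1 + a2 * x2).
Proof.
exists (re (ev (hm cj (vdd D rho 4 meta) (vdd D rho 4 meta)))); first exact: ev_ge0.
rewrite /j2 (lap_mN CD comm f2f1 f2n db_f2 gauss tK).
rewrite !expr2 !(evD, evM, evN, evMn) ev1 !evcj.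
rewrite (ev_real rt) (ev_real rti) (ev_real rr) (ev_real rN) !reimE /=.
rewrite -/(j0 mt) -/(j0 mr) -/(j0 ti) -/(j0 mN) -/t -/r -/it -/N.
rewrite -(D_mr CD comm f2f1 db_f2 tK) -/(j1 mt) -/(j1' mt) -/(j1 mr) -/(j1' mr) -/a1 -/a2 -/x1 -/x2.
by ring.
Qed.

Lemma ev_D0 x : ev (D x) = 0 -> j1 x = 0 /\ j1' x = 0.
Proof. by rewrite /j1 /j1' => ->. Qed.

Lemma t3r_max : 0 < t -> 0 < r ->
  ev (D (mt * (mt * (mt * mr)))) = 0 -> j2 (mt * (mt * (mt * mr))) <= 0 ->
  9 * t - 12 * t ^+ 2 + 2 * r <= 0.
Proof.
move=> t0 r0 /ev_D0; have r1 : cj (mt * mr) = mt * mr by rewrite (cjM CD) rt rr.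
have r2 : cj (mt * (mt * mr)) = mt * (mt * mr) by rewrite (cjM CD) rt r1.
have [_ -> -> ->] := jM rt r2; have [-> -> -> ->] := jM rt r1; have [-> -> -> ->] := jM rt rr.
rewrite -/t -/r -/a1 -/a2 -/x1 -/x2 j2t j2r => -[e1 e2] h.
have t20 : t ^+ 2 != 0 by rewrite expf_neq0 // gt_eqF.
apply: (@num_t3r _ t r it N a1 a2 x1 x2) => //; [exact: tK0| | |exact: xi_cauchy|].
- by apply: (mulfI t20); apply/eqP; rewrite -subr_eq0; apply/eqP; rewrite -[RHS]e1; ring.
- by apply: (mulfI t20); apply/eqP; rewrite -subr_eq0; apply/eqP; rewrite -[RHS]e2; ring.
apply: le_trans h; rewrite le_eqVlt; apply/orP; left; apply/eqP; ring.
Qed.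

Lemma N_max : 5 / 6 <= t <= 9 / 10 -> r * it <= 23 / 25 ->
  j2 (mN + mr *+ 6 + mt *+ 8) <= 0 -> N <= 4.
Proof.
move=> tb s1; have [_ _ _ ->] := jD (mN + mr *+ 6) (mt *+ 8).
have [_ _ _ ->] := jD mN (mr *+ 6); have [_ _ _ ->] := jMn mr 6.
have [_ _ _ ->] := jMn mt 8; have [E E0 ->] := j2N; rewrite j2t j2r => h.
have t0 : 0 < t by case/andP: tb => h1 _; lra.
have it0 : 0 <= it by rewrite ltW // -(pmulr_rgt0 _ t0) tK0.
apply: (@num_N _ t r it N a1 a2 x1 x2 E) => //.
- exact: tK0.
- by rewrite mulr_ge0 // r_ge0.
- exact: N_ge0.
- exact: xi_cauchy.
by apply: le_trans h; rewrite le_eqVlt; apply/orP; left; apply/eqP; ring.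
Qed.

Lemma r_min : 5 / 6 <= t <= 9 / 10 -> r <= 12 / 100 -> N <= 10 ->
  ev (D (- (mr + mt *+ 50))) = 0 -> j2 (- (mr + mt *+ 50)) <= 0 -> False.
Proof.
move=> tb r1 N1 /ev_D0; have [_ [-> -> ->]] := jN (mr + mt *+ 50).
have [_ -> -> ->] := jD mr (mt *+ 50); have [_ -> -> ->] := jMn mt 50.
rewrite -/x1 -/x2 -/a1 -/a2 j2t j2r => -[e1 e2] h.
have := @num_r0 _ t r it N a1 a2 x1 x2 tb tK0 r_ge0 r1 N_ge0 N1.
have f1' : x1 = - 50 * a1 by move: e1; rewrite -mulr_natl; move=> e; lra.
have f2' : x2 = - 50 * a2 by move: e2; rewrite -mulr_natl; move=> e; lra.
move=> /(_ f1' f2' xi_cauchy); move: h; rewrite -mulr_natl => h1 h2; lra.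
Qed.

Hypothesis rK : mr * ri = 1.
Let rri : cj ri = ri. Proof. exact: (cj_inv CD rr rK). Qed.
Let rta : cj mtau = mtau. Proof. exact: mtau_real. Qed.
Let ir := j0 ri.
Let ta := j0 mtau.
Let b1 := j1 mtau.
Let b2 := j1' mtau.

Lemma rK0 : r * ir = 1.
Proof.
have := congr1 (fun x => re (ev x)) rK; rewrite evM ev1.
by rewrite (ev_real rr) (ev_real rri) reimE /= mul0r subr0.
Qed.

Lemma taE : ta = N - (x1 ^+ 2 + x2 ^+ 2) * ir.
Proof.
rewrite /ta /j0 (mtauE CD comm f2f1 db_f2 tK rK) -(D_mr CD comm f2f1 db_f2 tK).
rewrite !(evD, evM, evN) !evcj (ev_real rN) (ev_real rri) !reimE /=.
by rewrite -/(j0 mN) -/(j0 ri) -/(j1 mr) -/(j1' mr) -/ir -/N -/x1 -/x2; ring.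
Qed.

Lemma w_lap : 0 < t -> 0 < r -> 0 < ta ->
  (t * r * ta) ^+ 2 * (9 - 10 * t) <= (t * r * ta) * j2 (mt * mr * mtau).
Proof.
move=> t0 r0 ta0.
pose G := re (ev (hm cj (vdd D rho 4 mpsi4) (vdd D rho 4 mpsi4))).
have r1 : cj (mt * mr) = mt * mr by rewrite (cjM CD) rt rr.
apply: (@num_w _ t r ta it ir N a1 a2 x1 x2 b1 b2 G) => //.
- exact: tK0.
- exact: rK0.
- exact: taE.
- rewrite /b1 /b2 /j1 /j1' (D_mtau CD comm f2f1 db_f2 tK rK); exact: ev_cauchy.
have ltau : j2 mtau = (4 * (1 - t) - ta * ir) * ta + G.
  rewrite /j2 (lap_mtau CD comm f2f1 db_f2 gauss tK rK) !(evD, evM, evN, evMn) ev1.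
  rewrite (ev_real rt) (ev_real rri) (ev_real rta) !reimE /= -/G.
  by rewrite -/(j0 mt) -/(j0 ri) -/(j0 mtau) -/t -/ir -/ta; ring.
have [_ _ _ ->] := jM r1 rta; have [-> -> -> ->] := jM rt rr.
rewrite ltau j2t j2r -/t -/r -/ta -/a1 -/a2 -/x1 -/x2 -/b1 -/b2; ring.
Qed.

Lemma v_lap : 0 < t -> 0 < r -> ta = 0 ->
  j2 (ti * ri) = (j1 (ti * ri) ^+ 2 + j1' (ti * ri) ^+ 2) * (t * r) + (6 * t - 5) * (it * ir).
Proof.
move=> t0 r0 ta0.
have r1 : cj (mt * mr) = mt * mr by rewrite (cjM CD) rt rr.
have r2 : cj (ti * ri) = ti * ri by rewrite (cjM CD) rti rri.
have v0 : j0 (ti * ri) = it * ir by have [-> _ _ _] := jM rti rri.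
have vK : mt * mr * (ti * ri) = 1.
  by transitivity ((mt * ti) * (mr * ri)); [ring|rewrite tK rK mulr1].
have lap1 : lap cj D rho 1 = 0 by rewrite /lap comm_0 (der1 CD) (Db0 CD); ring.
have [u0 u1 u2 u3] := jM rt rr.
have [] := jM r1 r2; rewrite vK u0 u1 u2 u3 v0 j2t j2r.
rewrite /j0 /j1 /j1' /j2 (der1 CD) lap1 ev0 ev1 /=.
rewrite -/(j1 _) -/(j1' _) -/(j2 _) -/(j0 _) => /esym e0 /esym e1 /esym e2 /esym e3.
apply: (@num_v _ t r it ir N a1 a2 x1 x2 (it * ir)) => //.
- exact: tK0.
- exact: rK0.
- by have := taE; rewrite ta0 => /eqP; rewrite eq_sym subr_eq0 => /eqP.
Qed.
End Eval.

Section Scaled.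
Variables (C : comPzRingType) (cj D : C -> C) (kap : C) (n : nat) (F : 'rV[C]_n).
Hypothesis CD : conj_derivation cj D.
Hypothesis kap_real : cj kap = kap.
Hypothesis D_kap : D kap = 0.
Hypothesis comm : forall a, D (Db cj D a) - Db cj D (D a) =
  fr_rho cj D F * Db cj D a - cj (fr_rho cj D F) * D a.
Hypothesis half : forall a : C, a + a = 0 -> a = 0.
Hypothesis F_real : vc cj F = F.
Hypothesis F_unit : dot F F = 1.
Hypothesis f1_null : dot (fr1 D F) (fr1 D F) = 0.
Hypothesis f1_unit : hm cj (fr1 D F) (fr1 D F) = 1.
Hypothesis H_parallel : exists x y,
  vD D (fr_H cj D F) = x *: fr1 D F + y *: vc cj (fr1 D F).
Hypothesis Q0 : fr_Q cj D F = 0.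
Hypothesis kapK : kap ^+ 2 * (1 + fr_hh cj D F) = 1.

Notation kt := (kt cj D kap F).
Notation kti := (kti cj D kap F).
Notation kr := (kr cj D kap F).
Notation kri := (kri cj D kap F).
Notation kN := (kN cj D kap F).
Notation ktau := (ktau cj D kap F).
Notation krho := (krho cj D kap F).
Notation kD := (kD D kap).
Notation L := (lap cj D (fr_rho cj D F)).

Let CDk := kD_CD kap CD.
Let commk := kcomm CD kap_real D_kap comm.
Let f2f1k := kf2f1 kap f1_unit.
Let f2nk := kf2n CD kap_real comm half F_real F_unit f1_null Q0.
Let db_f2k := kdb_f2 CD kap_real D_kap comm half F_real F_unit f1_null f1_unit H_parallel Q0.
Let gaussk := kgauss CD kap_real D_kap comm half F_real F_unit f1_null f1_unit H_parallel kapK.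
Hypothesis tK : exists ti, kt * ti = 1.
Let tiK : kt * kti = 1. Proof. by have [ti /mul_cinv] := tK. Qed.

Lemma kt_real : cj kt = kt. Proof. exact: (mt_real CDk). Qed.
Lemma kr_real : cj kr = kr. Proof. exact: (mr_real CDk). Qed.
Lemma kN_real : cj kN = kN. Proof. exact: (mN_real CDk). Qed.
Lemma ktau_real : cj ktau = ktau. Proof. exact: (mtau_real CDk). Qed.
Lemma kti_real : cj kti = kti. Proof. exact: (cj_inv CD kt_real tiK). Qed.

Variables (R : realFieldType) (ev : C -> cx R).
Hypothesis evD : forall a b, ev (a + b) = ev a + ev b.
Hypothesis evM : forall a b, ev (a * b) = ev a * ev b.
Hypothesis ev1 : ev 1 = 1.
Hypothesis evcj : forall a, ev (cj a) = cjx (ev a).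
Variable k0 : R.
Hypothesis evk : ev kap = cxr k0.
Hypothesis k0_gt0 : 0 < k0.

Let t := re (ev kt).
Let r := re (ev kr).
Let N := re (ev kN).
Let it := re (ev kti).
Let Lv x := re (ev (L x)).

(** The maximum principles concern the Laplacian of the original frame; the scaled one differs from
    it by a positive constant, so signs carry over. *)
Lemma j2k x : j2 cj kD krho ev x = k0 ^+ 2 * Lv x.
Proof.
by rewrite /j2 (klap F CD kap_real D_kap) expr2 !evM evk /Lv !reimE /=; ring.
Qed.

Lemma j2k_le x : Lv x <= 0 -> j2 cj kD krho ev x <= 0.
Proof. by rewrite j2k => h; rewrite pmulr_rle0 // exprn_gt0. Qed.

Lemma evkD x : ev (D x) = 0 -> ev (kD x) = 0.
Proof. by move=> e; rewrite -[kD x]/(kap * D x) evM e mulr0. Qed.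

Lemma kt_inv : t * it = 1. Proof. exact: (tK0 CDk evM ev1 evcj tiK). Qed.
Lemma kr_ge0 : 0 <= r. Proof. exact: (ev_ge0 evD evM evcj). Qed.
Lemma kt3r_max : 0 < t -> 0 < r ->
  ev (D (kt * (kt * (kt * kr)))) = 0 -> Lv (kt * (kt * (kt * kr))) <= 0 ->
  9 * t - 12 * t ^+ 2 + 2 * r <= 0.
Proof.
move=> t0 r0 /evkD e1 /j2k_le e2.
exact: (t3r_max CDk evD evM ev1 evcj commk f2f1k db_f2k gaussk tiK t0 r0 e1 e2).
Qed.

Lemma kN_max : 5 / 6 <= t <= 9 / 10 -> r <= 23 / 25 * t ->
  Lv (kN + kr *+ 6 + kt *+ 8) <= 0 -> N <= 4.
Proof.
move=> tb rb /j2k_le h.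
apply: (N_max CDk evD evM ev1 evcj commk f2f1k f2nk db_f2k gaussk tiK tb) => //.
have t0 : 0 < t by case/andP: tb => h1 _; lra.
have it0 : 0 <= it by rewrite ltW // -(pmulr_rgt0 _ t0) kt_inv.
have e : 23 / 25 * t * it = 23 / 25 by rewrite -mulrA kt_inv mulr1.
exact: le_trans (ler_wpM2r it0 rb) (eq_ind_r (fun x => x <= _) (lexx _) e).
Qed.

Lemma kr_min : 5 / 6 <= t <= 9 / 10 -> r <= 12 / 100 -> N <= 10 ->
  ev (D (- (kr + kt *+ 50))) = 0 -> Lv (- (kr + kt *+ 50)) <= 0 -> False.
Proof.
move=> tb r1 N1 /evkD e1 /j2k_le e2.
exact: (r_min CDk evD evM ev1 evcj commk f2f1k db_f2k gaussk tiK tb r1 N1 e1 e2).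
Qed.

Hypothesis rK : exists ri, kr * ri = 1.
Let riK : kr * kri = 1. Proof. by have [ri /mul_cinv] := rK. Qed.
Let ta := re (ev ktau).
Let ir := re (ev kri).

Lemma kri_real : cj kri = kri. Proof. exact: (cj_inv CD kr_real riK). Qed.
Lemma ktau_ge0 : 0 <= ta. Proof. exact: (ev_ge0 evD evM evcj). Qed.
Lemma kr_inv : r * ir = 1. Proof. exact: (rK0 CDk evM ev1 evcj riK). Qed.

Lemma kw_lap : 0 < t -> 0 < r -> 0 < ta ->
  (t * r * ta) ^+ 2 * (9 - 10 * t) <= (t * r * ta) * (k0 ^+ 2 * Lv (kt * kr * ktau)).
Proof.
move=> t0 r0 ta0; rewrite -j2k.
exact: (w_lap CDk evD evM ev1 evcj commk f2f1k db_f2k gaussk tiK riK t0 r0 ta0).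
Qed.

(** G is the gradient term of [v_lap]. Its sign gives subharmonicity, and its vanishing at critical
    points gives the equality case once t r is known to be constant. *)
Lemma kv_lap : 0 < t -> 0 < r -> ta = 0 ->
  exists2 G, 0 <= G & k0 ^+ 2 * Lv (kti * kri) = G + (6 * t - 5) * (it * ir) /\
    (ev (D (kti * kri)) = 0 -> G = 0).
Proof.
move=> t0 r0 ta0; rewrite -j2k.
exists ((j1 kD ev (kti * kri) ^+ 2 + j1' kD ev (kti * kri) ^+ 2) * (t * r)).
  by rewrite mulr_ge0 ?addr_ge0 ?sqr_ge0 // mulr_ge0 // ltW.
split; first exact: (v_lap CDk evD evM ev1 evcj commk f2f1k db_f2k gaussk tiK riK t0 r0 ta0).
by move=> /evkD; rewrite /j1 /j1' => -> /=; rewrite expr0n /= addr0 mul0r.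
Qed.
End Scaled.

(** * Curvature in a chart *)

Section Evaluation.
Variables (R : realType) (M : topologicalType) (At : surface_atlas R M) (W : opens M).
Notation A := (sfun At W).
Implicit Types a b : A.

Lemma sfun_half a : a + a = 0 -> a = 0.
Proof.
move=> e; apply: sfun_eq => p Wp; have : (a + a) p = (0 : A) p by rewrite e.
by rewrite (sfunD a a Wp) (sfun0 At Wp) => h; lra.
Qed.

Lemma sfun_sqrt_inv a : (forall p, oset W p -> 0 < a p) -> exists b, b * b * a = 1.
Proof.
move=> a0.
pose b := mk_sfun (msmooth_sqrt a0).
have b0 p : oset W p -> b p != 0.
  by move=> Wp; rewrite mk_sfunE // gt_eqF // sqrtr_gt0 a0.
exists (mk_sfun (msmooth_inv b0)); apply: sfun_eq => p Wp.
rewrite !sfunM // sfun1 // !(mk_sfunE _ Wp) -invfM -expr2 sqr_sqrtr ?ltW ?a0 //.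
by rewrite mulVf // gt_eqF // a0.
Qed.

Lemma sfun_inv a : (forall p, oset W p -> a p != 0) -> exists b, a * b = 1.
Proof.
move=> a0; exists (mk_sfun (msmooth_inv a0)); apply: sfun_eq => p Wp.
by rewrite sfunM // sfun1 // (mk_sfunE _ Wp) mulfV // a0.
Qed.

(** The reciprocal 1 / sqrt a, well behaved where a is positive. *)
Definition isqrt a : A := xget 0 [set b | b * b * a = 1].
Lemma isqrtE a : (forall p, oset W p -> 0 < a p) -> isqrt a * isqrt a * a = 1.
Proof. by move=> /sfun_sqrt_inv; exact: xgetPex. Qed.

Variable p : M.
Hypothesis Wp : oset W p.

Lemma sfun_det a b c : (a * b - c * c) p = a p * b p - c p * c p.
Proof.
rewrite (sfunD (a * b) (- (c * c)) Wp) (sfunN (c * c) Wp).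
by rewrite (sfunM a b Wp) (sfunM c c Wp).
Qed.

Definition evr n (v : 'rV[A]_n) : 'rV[R]_n := map_mx (fun a : A => a p) v.

Lemma sfun_sum (I : finType) (G : I -> A) : (\sum_i G i) p = \sum_i G i p.
Proof.
elim/big_rec2 : _ => [|i x y _ <-]; first exact: sfun0.
exact: sfunD.
Qed.

Lemma evr_dot n (u v : 'rV[A]_n) : dot u v p = dot (evr u) (evr v).
Proof.
rewrite /dot sfun_sum; apply: eq_bigr => j _; rewrite !mxE; exact: sfunM.
Qed.
Lemma evrD n (u v : 'rV[A]_n) : evr (u + v) = evr u + evr v.
Proof. by apply/rowP => j; rewrite !mxE; exact: sfunD. Qed.
Lemma evrN n (u : 'rV[A]_n) : evr (- u) = - evr u.
Proof. by apply/rowP => j; rewrite !mxE; exact: sfunN. Qed.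
Lemma evrZ n a (u : 'rV[A]_n) : evr (a *: u) = a p *: evr u.
Proof. by apply/rowP => j; rewrite !mxE; exact: sfunM. Qed.
Lemma evr_sum n (I : finType) (G : I -> 'rV[A]_n) :
  evr (\sum_i G i) = \sum_i evr (G i).
Proof.
elim/big_rec2 : _ => [|i x y _ <-]; last exact: evrD.
by apply/rowP => j; rewrite !mxE; exact: sfun0.
Qed.
End Evaluation.

Lemma evr_rproj (R : realType) (M : topologicalType) (At : surface_atlas R M)
  (W : opens M) p n g (e : 'I_2 -> 'rV[sfun At W]_n) F v : oset W p ->
  evr p (rproj g e F v) =
  evr p v - \sum_a \sum_b (g a b p * dot (evr p v) (evr p (e b))) *: evr p (e a)
  - dot (evr p v) (evr p F) *: evr p F.
Proof.
move=> Wp; rewrite /rproj (evrD Wp) (evrN Wp) (evrZ Wp) (evrD Wp) (evrN Wp).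
rewrite -(evr_dot Wp); congr (_ - _ - _); rewrite !sum2 !(evrD Wp) !(evrZ Wp).
by rewrite !(sfunM _ _ Wp) !(evr_dot Wp).
Qed.

Lemma evr_sqnorm (R : realType) (M : topologicalType) (At : surface_atlas R M)
  (W : opens M) p n (g : 'I_2 -> 'I_2 -> sfun At W)
  (h : 'I_2 -> 'I_2 -> 'rV[sfun At W]_n) : oset W p ->
  (\sum_a \sum_b \sum_c \sum_e g a c * g b e * dot (h a b) (h c e)) p =
  \sum_a \sum_b \sum_c \sum_e g a c p * g b e p * dot (evr p (h a b)) (evr p (h c e)).
Proof.
move=> Wp; rewrite (sfun_sum Wp); apply: eq_bigr => a _.
rewrite (sfun_sum Wp); apply: eq_bigr => b _.
rewrite (sfun_sum Wp); apply: eq_bigr => c _.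
rewrite (sfun_sum Wp); apply: eq_bigr => e _.
rewrite (sfunM (g a c * g b e) (dot (h a b) (h c e)) Wp).
by rewrite (sfunM (g a c) (g b e) Wp) -(evr_dot Wp).
Qed.

Definition inv2 (R : realType) (E F G q : R) : 'M[R]_2 :=
  \matrix_(a, b) (if a == 0 then if b == 0 then q * G else - (q * F)
                  else if b == 0 then - (q * F) else q * E).

Lemma invmx2 (R : realType) (m : 'M[R]_2) (E F G q : R) :
  m 0 0 = E -> m 0 1 = F -> m 1 0 = F -> m 1 1 = G -> q * (E * G - F * F) = 1 ->
  invmx m = inv2 E F G q.
Proof.
move=> m00 m01 m10 m11 h.
have e : m *m inv2 E F G q = 1%:M.
  apply/matrixP => a b; rewrite !mxE sum2 !mxE /=.
  by have [->|->] := ord2 a; have [->|->] := ord2 b; rewrite ?m00 ?m01 ?m10 ?m11 /= -?h; ring.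
have [u1 _] := mulmx1_unit e.
by rewrite -[RHS](mulKmx u1) e mulmx1.
Qed.

Lemma dotvE (R : realType) N (u v : 'rV[R]_N.+1) : dotv u v = dot u v.
Proof. by []. Qed.

Lemma dot_ge0 (R : realType) n (u : 'rV[R]_n) : 0 <= dot u u.
Proof. by apply: sumr_ge0 => j _; rewrite -expr2 sqr_ge0. Qed.

Lemma dot_gt0 (R : realType) n (u : 'rV[R]_n) : u != 0 -> 0 < dot u u.
Proof.
move=> u0; rewrite lt_neqAle dot_ge0 andbT eq_sym; apply: contra u0 => /eqP e.
apply/eqP/rowP => j; rewrite mxE; apply/eqP; rewrite -sqrf_eq0 expr2; apply/eqP.
have := e; rewrite /dot => /psumr_eq0P; apply => // k _.
by rewrite -expr2 sqr_ge0.
Qed.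

Section Immersion.
Variables (R : realType) (N : nat) (M : topologicalType) (At : surface_atlas R M).
Variable f : M -> 'rV[R]_N.+1.
Hypothesis f_imm : smooth_immersion_in_sphere At f.

Lemma msmooth_comp (O : set M) j : open O -> msmooth At O (fun p => f p 0 j).
Proof.
move=> oO i k; have [_ sf _] := f_imm.
apply: (@Ck_sub _ _ k (dom i)); first by move=> x [].
have oi : open (dom i) by exact: dom_open.
have ck : C_on k (dom i) (f \o par i) by exact: sf.
exact: (C_on_coord j oi ck).
Qed.

Definition Fv (W : opens M) : 'rV[sfun At W]_N.+1 :=
  \row_j mk_sfun (msmooth_comp j (oset_open W)).

Lemma evr_Fv (W : opens M) p : oset W p -> evr p (Fv W) = f p.
Proof. by move=> Wp; apply/rowP => j; rewrite !mxE mk_sfunE. Qed.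

Lemma Fv_unit (W : opens M) : dot (Fv W) (Fv W) = 1.
Proof.
apply: sfun_eq => p Wp; rewrite evr_dot // evr_Fv // sfun1 //.
by have [sph _ _] := f_imm; exact: sph.
Qed.

Section Chart.
Variables (i : chart At) (W : opens M).
Hypothesis Wi : oset W `<=` img i.
Notation A := (sfun At W).
Let F := Fv W.
Definition cder (k : 'I_2) : A -> A := sf_pd Wi k.
Let d := cder.

Lemma cderD k a b : d k (a + b) = d k a + d k b. Proof. exact: sf_pdD. Qed.
Lemma cderM k a b : d k (a * b) = d k a * b + a * d k b. Proof. exact: sf_pdM. Qed.
Lemma cderC a : d 0 (d 1 a) = d 1 (d 0 a). Proof. exact: sf_pdC. Qed.

Section Point.
Variable p : M.
Hypothesis Wp : oset W p.
Let x := coord i p.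
Let oW : open (rdom i (oset W)). Proof. exact/rdom_open/oset_open. Qed.
Let dx : dom i x. Proof. exact/coord_dom/Wi. Qed.

Lemma evr_dF k : evr p (dv d k F) = partial k (f \o par i) x.
Proof.
have [_ sf _] := f_imm; have df := (sf i 1%N).1 _ dx.
rewrite /partial derive_mx; last exact: diff_derivable.
apply/rowP => j; rewrite !mxE.
apply: etrans (sf_pdE Wi k _ Wp) _.
apply: (eq_pd k oW).
  by move=> y [dy Wy]; exact: mk_sfunE.
by apply: coord_rdom => //; exact: Wi.
Qed.

Lemma evr_ddF k l : evr p (dv d k (dv d l F)) = partial k (partial l (f \o par i)) x.
Proof.
have [_ sf _] := f_imm; have df := ((sf i 2%N).2 l).1 _ dx.
rewrite /partial -/(partial l (f \o par i)) derive_mx; last exact: diff_derivable.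
apply/rowP => j; rewrite !mxE.
apply: etrans (sf_pdE Wi k _ Wp) _.
apply: (eq_pd k oW); last first.
  by apply: coord_rdom => //; exact: Wi.
move=> y [dy Wy].
apply: etrans (sf_pdE Wi l _ Wy) _.
rewrite parK // /partial derive_mx; last by apply: diff_derivable; exact: (sf i 1%N).1 _ dy.
rewrite !mxE; apply: (eq_pd l oW) => //.
by move=> y' [dy' Wy']; rewrite /comp; apply: etrans (mk_sfunE _ Wy') _.
Qed.

Let J := 'J (f \o par i) x.

Lemma dF_jac k : evr p (dv d k F) = delta_mx 0 k *m J.
Proof.
rewrite evr_dF /partial deriveEjacobian //.
by have [_ sf _] := f_imm; exact: (sf i 1%N).1 _ dx.
Qed.

Lemma jac_free (v : 'rV[R]_2) : v != 0 -> v *m J != 0.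
Proof.
have [_ _ /(_ i x dx) rf] := f_imm.
by apply: contra => /eqP e; apply/eqP/(row_free_inj rf); rewrite e mul0mx.
Qed.

Lemma gE_p : gE d F p = dot (evr p (dv d 0 F)) (evr p (dv d 0 F)).
Proof. exact: (evr_dot Wp). Qed.
Lemma gF_p : gF d F p = dot (evr p (dv d 0 F)) (evr p (dv d 1 F)).
Proof. exact: (evr_dot Wp). Qed.
Lemma gG_p : gG d F p = dot (evr p (dv d 1 F)) (evr p (dv d 1 F)).
Proof. exact: (evr_dot Wp). Qed.

Lemma gE_gt0 : 0 < gE d F p.
Proof.
apply: (@eq_ind_r _ _ (fun a => 0 < a) _ _ gE_p); rewrite dF_jac; apply/dot_gt0/jac_free.
by apply/eqP => /rowP/(_ 0); rewrite !mxE eqxx => /eqP; rewrite oner_eq0.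
Qed.

(** The vector E e1 - F e0 has squared length E (E G - F^2), and it is the image of a nonzero vector
    under the injective differential. *)
Lemma gram_gt0 : 0 < (gE d F * gG d F - gF d F * gF d F) p.
Proof.
have gen (a b c : R) (e0 e1 : 'rV[R]_N.+1) : a = dot e0 e0 -> c = dot e0 e1 ->
    b = dot e1 e1 -> e0 = delta_mx 0 0 *m J -> e1 = delta_mx 0 1 *m J ->
    0 < a -> 0 < a * b - c * c.
  move=> -> -> -> e0J e1J E0.
  have : 0 < dot (dot e0 e0 *: e1 - dot e0 e1 *: e0) (dot e0 e0 *: e1 - dot e0 e1 *: e0).
    apply: dot_gt0; rewrite e0J e1J !scalemxAl -mulmxBl; apply: jac_free.
    apply/eqP => /rowP/(_ 1); rewrite !mxE /= mulr0 mulr1 subr0 => h.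
    by move: E0; rewrite e0J h ltxx.
  rewrite !(dotDl, dotDr, dotNl, dotNr, dotZl, dotZr) (dotC e1 e0) => h.
  rewrite -(pmulr_rgt0 _ E0); apply: lt_le_trans h _.
  by rewrite le_eqVlt; apply/orP; left; apply/eqP; ring.
apply: (@eq_ind_r _ _ (fun a => 0 < a) _ _ (sfun_det Wp (gE d F) (gG d F) (gF d F))).
exact: gen gE_p gF_p gG_p (dF_jac 0) (dF_jac 1) gE_gt0.
Qed.
End Point.

Definition fs : A := isqrt (gE d F *+ 2).
Definition fr : A := isqrt (gE d F * gG d F - gF d F * gF d F).

Lemma fsE : fs * fs * (gE d F *+ 2) = 1.
Proof.
apply: isqrtE => p Wp; rewrite mulr2n (sfunD (gE d F) (gE d F) Wp) addr_gt0 //; exact: gE_gt0.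
Qed.

Lemma frE : fr * fr * (gE d F * gG d F - gF d F * gF d F) = 1.
Proof. by apply: isqrtE => p Wp; exact: gram_gt0. Qed.

Definition chZ := gsZ d F fs fr.

Section Values.
Variable p : M.
Hypothesis Wp : oset W p.
Let x := coord i p.
Let dx : dom i x. Proof. exact/coord_dom/Wi. Qed.
Let P := f \o par i.

Lemma metric_invE a b : metric_inv P x a b = gi d F fr a b p.
Proof.
have m k l : metric P x k l = dot (evr p (dv d k F)) (evr p (dv d l F)).
  by rewrite mxE dotvE -!evr_dF.
have q : (fr p * fr p) * (gE d F p * gG d F p - gF d F p * gF d F p) = 1.
  have := frE => /(congr1 (fun u : A => u p)) e.
  apply: etrans (etrans e (sfun1 At Wp)).
  rewrite (sfunM (fr * fr) (gE d F * gG d F - gF d F * gF d F) Wp) (sfunM fr fr Wp).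
  by rewrite (sfun_det Wp (gE d F) (gG d F) (gF d F)).
have m00 := etrans (m 0 0) (esym (gE_p Wp)).
have m01 := etrans (m 0 1) (esym (gF_p Wp)).
have m10 := etrans (m 1 0) (etrans (dotC _ _) (esym (gF_p Wp))).
have m11 := etrans (m 1 1) (esym (gG_p Wp)).
rewrite /metric_inv (invmx2 m00 m01 m10 m11 q) mxE /gi.
case: (a == 0); case: (b == 0).
- by rewrite (sfunM (fr * fr) (gG d F) Wp) (sfunM fr fr Wp).
- by rewrite (sfunN (fr * fr * gF d F) Wp) (sfunM (fr * fr) (gF d F) Wp) (sfunM fr fr Wp).
- by rewrite (sfunN (fr * fr * gF d F) Wp) (sfunM (fr * fr) (gF d F) Wp) (sfunM fr fr Wp).
- by rewrite (sfunM (fr * fr) (gE d F) Wp) (sfunM fr fr Wp).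
Qed.

Lemma Fx : P x = evr p F.
Proof. by rewrite evr_Fv // /P /= coordK //; exact: Wi. Qed.

Lemma normal_partE v : normal_part P x (evr p v) = evr p (npA d F fr v).
Proof.
rewrite /normal_part /npA (evr_rproj _ _ _ _ Wp) Fx dotvE.
congr (_ - _ - _); apply: eq_bigr => a _; apply: eq_bigr => b _.
by rewrite metric_invE dotvE (evr_dF Wp) (evr_dF Wp).
Qed.

Lemma second_ffE a b : second_ff P x a b = evr p (hA d F fr a b).
Proof. by rewrite /second_ff /hA -normal_partE (evr_ddF Wp). Qed.

End Values.

End Chart.

End Immersion.

Section ChartCurvature.
Variables (R : realType) (N : nat) (M : topologicalType) (At : surface_atlas R M).
Variable f : M -> 'rV[R]_N.+1.
Hypothesis f_imm : smooth_immersion_in_sphere At f.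
Variables (i : chart At) (W : opens M).
Hypothesis Wi : oset W `<=` img i.
Notation A := (sfun At W).
Let F := Fv f_imm W.
Let d := cder Wi.
Let fr := fr f_imm Wi.
Let Z := chZ f_imm Wi.
Definition cjA := @cjx A.
Definition cFv := cF F.
Definition ch_t := re (hm cjA (fr2 cjA Z cFv) (fr2 cjA Z cFv)).
Definition ch_hh := re (fr_hh cjA Z cFv).
Definition ch_H : 'rV[A]_N.+1 := map_mx (@re A) (fr_H cjA Z cFv).

Lemma ch_S p : oset W p ->
  second_ff_sqnorm (f \o par i) (coord i p) = (ch_t p + ch_hh p) *+ 2.
Proof.
move=> Wp.
have := S_coord (@sfun_half _ _ At W) (cderD Wi) (cderM Wi) (cderC Wi) (fsE f_imm Wi) (frE f_imm Wi) (Fv_unit f_imm W).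
move=> /(congr1 (@re A)) e.
have e1 : \sum_a \sum_b \sum_k \sum_l gi d F fr a k * gi d F fr b l *
    dot (hA d F fr a b) (hA d F fr k l) = (ch_t + ch_hh) *+ 2.
  by apply: etrans e _; rewrite reMn.
move/(congr1 (fun u : A => u p)) : e1; rewrite (evr_sqnorm _ _ Wp) => e1.
rewrite mulr2n -(sfunD ch_t ch_hh Wp) -(sfunD (ch_t + ch_hh) (ch_t + ch_hh) Wp) -mulr2n -e1.
rewrite /second_ff_sqnorm; do 4!(apply: eq_bigr => ? _).
by rewrite !(metric_invE f_imm Wi Wp) !(second_ffE f_imm Wi Wp).
Qed.

Lemma ch_HE p : oset W p ->
  mean_curvature_vec (f \o par i) (coord i p) = evr p ch_H.
Proof.
move=> Wp.
have e := H_coord (@sfun_half _ _ At W) (cderD Wi) (cderM Wi) (cderC Wi) (fsE f_imm Wi) (frE f_imm Wi) (Fv_unit f_imm W).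
have e1 : \sum_a \sum_b gi d F fr a b *: hA d F fr a b = ch_H + ch_H.
  apply/rowP => j; move/rowP/(_ j)/(congr1 (@re A)) : e; rewrite [X in re X]mxE.
  move=> /= ->; rewrite [X in re X]mxE reD [RHS]mxE /ch_H.
  by rewrite ![(map_mx _ _) _ _]mxE.
move/(congr1 (fun u : 'rV[A]_N.+1 => evr p u)) : e1; rewrite (evrD Wp) (evr_sum Wp) => e1.
rewrite /mean_curvature_vec; apply: (@scalerI _ _ 2); first by rewrite pnatr_eq0.
rewrite scalerA mulfV ?pnatr_eq0 // scale1r scaler_nat mulr2n -e1.
apply: eq_bigr => a _; rewrite (evr_sum Wp); apply: eq_bigr => b _.
by rewrite (evrZ Wp) (metric_invE f_imm Wi Wp) (second_ffE f_imm Wi Wp).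
Qed.

End ChartCurvature.

(** * Transition between charts *)

Section Restriction.
Variables (R : realType) (M : topologicalType) (At : surface_atlas R M).
Variables (W V : opens M).
Hypothesis VW : oset V `<=` oset W.

Lemma msmooth_res (a : sfun At W) : msmooth At (oset V) a.
Proof.
move=> i k; apply: (@Ck_sub _ _ k (rdom i (oset W))); last exact: sfun_Ck.
by move=> x [dx Vx]; split => //; exact: VW.
Qed.

Definition res (a : sfun At W) : sfun At V := mk_sfun (msmooth_res a).
Definition cres (x : cx (sfun At W)) : cx (sfun At V) := Cx (res (re x)) (res (im x)).

Lemma resE a p : oset V p -> res a p = a p. Proof. exact: mk_sfunE. Qed.

Lemma resD a b : res (a + b) = res a + res b.
Proof.
apply: sfun_eq => p Vp; apply: etrans (resE _ Vp) _.
apply: etrans (sfunD a b (VW Vp)) _; apply: esym; apply: etrans (sfunD _ _ Vp) _.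
by congr (_ + _); exact: resE.
Qed.
Lemma resM a b : res (a * b) = res a * res b.
Proof.
apply: sfun_eq => p Vp; apply: etrans (resE _ Vp) _.
apply: etrans (sfunM a b (VW Vp)) _; apply: esym; apply: etrans (sfunM _ _ Vp) _.
by congr (_ * _); exact: resE.
Qed.
Lemma resN a : res (- a) = - res a.
Proof.
apply: sfun_eq => p Vp; apply: etrans (resE _ Vp) _.
apply: etrans (sfunN a (VW Vp)) _; apply: esym; apply: etrans (sfunN _ Vp) _.
by congr (- _); exact: resE.
Qed.
Lemma res_cst c : res (sfC At W c) = sfC At V c.
Proof.
apply: sfun_eq => p Vp; apply: etrans (resE _ Vp) _.
by apply: etrans (sfCE At c (VW Vp)) _; rewrite sfCE.
Qed.
Lemma res0 : res 0 = 0. Proof. exact: res_cst. Qed.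
Lemma res1 : res 1 = 1. Proof. exact: res_cst. Qed.

Lemma cresD x y : cres (x + y) = cres x + cres y.
Proof. by apply: cx_eq; rewrite /= resD. Qed.
Lemma cresM x y : cres (x * y) = cres x * cres y.
Proof. by apply: cx_eq; rewrite /= resD ?resN !resM. Qed.
Lemma cres_comb x y z t : cres (x * y + z * t) = cres x * cres y + cres z * cres t.
Proof. by rewrite cresD !cresM. Qed.
Lemma cres_cj x : cres (cjx x) = cjx (cres x).
Proof. by apply: cx_eq; rewrite //= resN. Qed.
Lemma cres1 : cres 1 = 1.
Proof. by apply: cx_eq; [exact: res1|exact: res0]. Qed.

Section ChartRes.
Variables (i : chart At) (Wi : oset W `<=` img i) (Vi : oset V `<=` img i).
Lemma res_pd k a : res (cder Wi k a) = cder Vi k (res a).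
Proof.
apply: sfun_eq => p Vp; apply: etrans (resE _ Vp) _.
apply: etrans (sf_pdE Wi k a (VW Vp)) _; apply: esym.
apply: etrans (sf_pdE Vi k _ Vp) _.
apply: (eq_pd k (rdom_open (i := i) (oset_open V))).
  by move=> x [dx Vx]; exact: resE.
by apply: coord_rdom => //; exact: Vi.
Qed.
Lemma cres_dx k x : cres (dx (cder Wi) k x) = dx (cder Vi) k (cres x).
Proof. by apply: cx_eq; exact: res_pd. Qed.
End ChartRes.
End Restriction.

Section ChainRule.
Variables (R : realType) (M : topologicalType) (At : surface_atlas R M).
Variables (V : opens M) (i j : chart At).
Hypotheses (Vi : oset V `<=` img i) (Vj : oset V `<=` img j).

Lemma msmooth_coord k : msmooth At (oset V) (fun p => coord i p 0 k).
Proof.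
move=> l n.
apply: (@Ck_sub _ _ n (dom l `&` par l @^-1` (par i @` dom i))).
  by move=> x [dx Vx]; split => //; exact: Vi.
have oU : open (dom l `&` par l @^-1` (par i @` dom i)).
  exact: (@rdom_open _ _ At l (img i) (@image_open _ _ At i)).
exact: (C_on_coord k oU (transition_smooth l i n)).
Qed.

Definition coordf k : sfun At V := mk_sfun (msmooth_coord k).

Lemma cder_chain l a : cder Vj l a = \sum_k cder Vj l (coordf k) * cder Vi k a.
Proof.
apply: sfun_eq => p Vp; apply: etrans (sf_pdE Vj l a Vp) _; apply: esym.
apply: etrans (sfun_sum Vp _) _.
have oV : open (rdom j (oset V)) by exact/rdom_open/oset_open.
have xV : rdom j (oset V) (coord j p) by apply: coord_rdom => //; exact: Vj.
have pj : par j (coord j p) = p by apply: coordK; exact: Vj.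
have dtr : differentiable (coord i \o par j) (coord j p).
  apply: (transition_smooth j i 1%N).1; split; first exact: xV.1.
  by rewrite /= pj; exact: Vi.
have e0 : pd l (a \o par j) (coord j p) = pd l ((a \o par i) \o (coord i \o par j)) (coord j p).
  apply: (eq_pd l oV) => // x [dx Vx] /=; rewrite coordK //; exact: Vi.
apply: esym; apply: etrans e0 _.
have fp : (coord i \o par j) (coord j p) = coord i p by rewrite /= pj.
rewrite pd_chain //; last by rewrite fp; exact: (sfun_diff Vi).
apply: eq_bigr => k _; apply: esym; apply: etrans (sfunM _ _ Vp) _.
congr (_ * _).
  apply: etrans (sf_pdE Vj l _ Vp) _; apply: (eq_pd l oV) => //.
  by move=> x [dx Vx]; exact: mk_sfunE.
by rewrite fp; exact: sf_pdE.
Qed.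

Lemma dx_chain l x : dx (cder Vj) l x = \sum_k cxr (cder Vj l (coordf k)) * dx (cder Vi) k x.
Proof.
apply: cx_eq; rewrite ?(re_sum, im_sum) /= cder_chain; apply: eq_bigr => k _ /=.
  by rewrite mul0r subr0.
by rewrite mul0r addr0.
Qed.
End ChainRule.

Section NullFrames.
Variables (C : comPzRingType) (cj D : C -> C) (CD : conj_derivation cj D).
Hypothesis half : forall a : C, a + a = 0 -> a = 0.
Variables (n : nat) (g p q : 'rV[C]_n) (al be : C).
Hypotheses (gE : g = al *: p + be *: q) (qE : q = vc cj p) (pp : dot p p = 0)
  (pq : dot p q = 1).

Let qq : dot q q = 0. Proof. by rewrite qE -(cj_dot CD) pp (cj0 CD). Qed.

Lemma null_coef : dot g q = al.
Proof. by rewrite gE dotDl !dotZl pq qq mulr1 mulr0 addr0. Qed.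

(** With p, q the frame of one chart and g the null vector of another, this is the alternative
    between preserved orientation, be = 0, and reversed orientation, al = 0, wherever one of the two
    is invertible. *)
Lemma null_null : dot g g = 0 -> al * be = 0.
Proof.
rewrite gE !(dotDl, dotDr, dotZl, dotZr) pp qq (dotC q p) pq => e.
by apply: half; rewrite -[RHS]e; ring.
Qed.

Lemma null_unit : hm cj g g = 1 -> al * cj al + be * cj be = 1.
Proof.
rewrite gE /hm (vcD CD) !(vcZ CD) -qE (_ : vc cj q = p); last by rewrite qE (vcK CD).
rewrite !(dotDl, dotDr, dotZl, dotZr) pp qq (dotC q p) pq => e.
by rewrite -[RHS]e; ring.
Qed.
End NullFrames.

Section Transition.
Variables (R : realType) (N : nat) (M : topologicalType) (At : surface_atlas R M).
Variable f : M -> 'rV[R]_N.+1.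
Hypothesis f_imm : smooth_immersion_in_sphere At f.

Definition Oi (i : chart At) : opens M := Opens (@image_open _ _ At i).
Definition Oii (i : chart At) : oset (Oi i) `<=` img i := fun p h => h.
Notation AA W := (sfun At W).
Notation cj W := (@cjx (sfun At W)).

Definition Zc (i : chart At) := chZ f_imm (@Oii i).
Definition cFc (i : chart At) := cF (Fv f_imm (Oi i)).

Arguments Zc i x : clear implicits.
Arguments cFc i : clear implicits.

Lemma Zc_CD i : conj_derivation (cj (Oi i)) (Zc i).
Proof. exact: (gs_CD (cderD (@Oii i)) (cderM (@Oii i))). Qed.
Lemma cx_sfun_half (W : opens M) (x : cx (AA W)) : x + x = 0 -> x = 0.
Proof. exact: (cx_half (@sfun_half _ _ At W)). Qed.
Lemma cFc_real i : vc (cj (Oi i)) (cFc i) = cFc i.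
Proof. exact: cF_real. Qed.
Lemma cFc_unit i : dot (cFc i) (cFc i) = 1.
Proof. by rewrite [LHS]dot_cxr (Fv_unit f_imm). Qed.
Lemma f1c_null i : dot (fr1 (Zc i) (cFc i)) (fr1 (Zc i) (cFc i)) = 0.
Proof.
exact: (gs_null (cderD (@Oii i)) (fs f_imm (@Oii i)) (frE f_imm (@Oii i))).
Qed.
Lemma f1c_unit i : hm (cj (Oi i)) (fr1 (Zc i) (cFc i)) (fr1 (Zc i) (cFc i)) = 1.
Proof.
exact: (gs_unit (cderD (@Oii i)) (cderM (@Oii i)) (fsE f_imm (@Oii i)) (frE f_imm (@Oii i))).
Qed.
Lemma Zc_comm i a :
  Zc i (Db (cj (Oi i)) (Zc i) a) - Db (cj (Oi i)) (Zc i) (Zc i a) =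
  fr_rho (cj (Oi i)) (Zc i) (cFc i) * Db (cj (Oi i)) (Zc i) a
  - cjx (fr_rho (cj (Oi i)) (Zc i) (cFc i)) * Zc i a.
Proof.
exact: (gs_comm (@sfun_half _ _ At (Oi i)) (cderD (@Oii i)) (cderM (@Oii i))
  (cderC (@Oii i)) (fsE f_imm (@Oii i)) (frE f_imm (@Oii i)) a).
Qed.

Section Overlap.
Variables (i j : chart At) (V : opens M).
Hypotheses (Vi : oset V `<=` img i) (Vj : oset V `<=` img j).
Let Vi' : oset V `<=` oset (Oi i) := Vi.
Let Vj' : oset V `<=` oset (Oi j) := Vj.
Let ri := @cres R M At (Oi i) V Vi'.
Let rj := @cres R M At (Oi j) V Vj'.
Let zj := gsz (cder (@Oii j)) (Fv f_imm (Oi j)) (fs f_imm (@Oii j)) (fr f_imm (@Oii j)).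
Let pi := gsp (cder (@Oii i)) (Fv f_imm (Oi i)) (fs f_imm (@Oii i)) (fr f_imm (@Oii i)).
(** The frame derivation of chart j, acting on functions on the overlap. *)
Definition ovD : cx (AA V) -> cx (AA V) := Zf (cder Vj) (fun l => rj (zj l)).
Let D' := ovD.
Definition ovF : 'rV[cx (AA V)]_N.+1 := cF (Fv f_imm V).

Lemma ovD_CD : conj_derivation (cj V) D'.
Proof. exact: (Zf_derivation (cderD Vj) (cderM Vj)). Qed.

Lemma ovD_rj x : D' (rj x) = rj (Zc j x).
Proof.
have e k : dx (cder Vj) k (rj x) = rj (dx (cder (@Oii j)) k x).
  exact: esym (cres_dx Vj' (@Oii j) Vj k x).
apply: etrans (esym (cres_comb Vj' (zj 0) (dx (cder (@Oii j)) 0 x) (zj 1)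
  (dx (cder (@Oii j)) 1 x))).
by rewrite -/rj -!e.
Qed.

(** The frame of chart j is written in the coordinates of j, then in those of i by the chain rule,
    then in the frame of i by [gs_dual]; [ov_al] and [ov_be] are the resulting coefficients of Z and
    of its conjugate. *)
Definition ov_al : cx (AA V) :=
  \sum_l \sum_k rj (zj l) * cxr (cder Vj l (coordf Vi k)) * ri (pi k).
Definition ov_be : cx (AA V) :=
  \sum_l \sum_k rj (zj l) * cxr (cder Vj l (coordf Vi k)) * cjx (ri (pi k)).

Let cc l k := cxr (cder Vj l (coordf Vi k)).
Lemma ov_alE : ov_al =
  (rj (zj 0) * cc 0 0 * ri (pi 0) + rj (zj 0) * cc 0 1 * ri (pi 1))
  + (rj (zj 1) * cc 1 0 * ri (pi 0) + rj (zj 1) * cc 1 1 * ri (pi 1)).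
Proof. by apply: etrans (sum2 _) _; congr (_ + _); exact: sum2. Qed.
Lemma ov_beE : ov_be =
  (rj (zj 0) * cc 0 0 * cjx (ri (pi 0)) + rj (zj 0) * cc 0 1 * cjx (ri (pi 1)))
  + (rj (zj 1) * cc 1 0 * cjx (ri (pi 0)) + rj (zj 1) * cc 1 1 * cjx (ri (pi 1))).
Proof. by apply: etrans (sum2 _) _; congr (_ + _); exact: sum2. Qed.

Lemma ovD_ri x : D' (ri x) = ov_al * ri (Zc i x) + ov_be * ri (Db (cj (Oi i)) (Zc i) x).
Proof.
have dual k : dx (cder Vi) k (ri x) =
    ri (pi k) * ri (Zc i x) + cjx (ri (pi k)) * ri (Db (cj (Oi i)) (Zc i) x).
  apply: etrans (esym (cres_dx Vi' (@Oii i) Vi k x)) _.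
  apply: etrans (congr1 ri (gs_dual (cderD (@Oii i)) (cderM (@Oii i))
    (fsE f_imm (@Oii i)) (frE f_imm (@Oii i)) k x)) _.
  apply: etrans (cres_comb Vi' _ _ _ _) _.
  by congr (_ + _ * _); exact: cres_cj.
have gen (z0 z1 p0 p1 u v : cx (AA V)) (c : 'I_2 -> 'I_2 -> cx (AA V))
    (w0 w1 y0 y1 al be : cx (AA V)) :
  al = (z0 * c 0 0 * p0 + z0 * c 0 1 * p1) + (z1 * c 1 0 * p0 + z1 * c 1 1 * p1) ->
  be = (z0 * c 0 0 * cjx p0 + z0 * c 0 1 * cjx p1)
    + (z1 * c 1 0 * cjx p0 + z1 * c 1 1 * cjx p1) ->
  y0 = c 0 0 * w0 + c 0 1 * w1 -> y1 = c 1 0 * w0 + c 1 1 * w1 ->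
  w0 = p0 * u + cjx p0 * v -> w1 = p1 * u + cjx p1 * v ->
  z0 * y0 + z1 * y1 = al * u + be * v.
  by move=> -> -> -> -> -> ->; ring.
have ch l := etrans (dx_chain Vi Vj l (ri x)) (sum2 _).
exact: (gen _ _ _ _ _ _ _ _ _ _ _ _ _ ov_alE ov_beE (ch 0) (ch 1) (dual 0) (dual 1)).
Qed.

Lemma res_cF (W : opens M) (VW : oset V `<=` oset W) :
  map_mx (cres VW) (cF (Fv f_imm W)) = ovF.
Proof.
apply/rowP => k; rewrite !mxE; apply: cx_eq => /=; last exact: res0.
apply: sfun_eq => p Vp; apply: etrans (resE _ _ Vp) _.
apply: etrans (mk_sfunE _ (VW _ Vp)) _; apply: esym.
exact: (mk_sfunE _ Vp).
Qed.

Let f1i := map_mx ri (fr1 (Zc i) (cFc i)).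
Let fmi := map_mx ri (vc (cj (Oi i)) (fr1 (Zc i) (cFc i))).
Let f1j := map_mx rj (fr1 (Zc j) (cFc j)).

Lemma cres_dot (W : opens M) (VW : oset V `<=` oset W) n (u v : 'rV[cx (AA W)]_n) :
  cres VW (dot u v) = dot (map_mx (cres VW) u) (map_mx (cres VW) v).
Proof.
rewrite /dot (big_morph (cres VW) (cresD VW) (_ : _ = 0)); last first.
  by apply: cx_eq; exact: res0.
by apply: eq_bigr => k _; rewrite cresM !mxE.
Qed.

Lemma cres_vc (W : opens M) (VW : oset V `<=` oset W) n (u : 'rV[cx (AA W)]_n) :
  map_mx (cres VW) (vc (cj W) u) = vc (cj V) (map_mx (cres VW) u).
Proof. by apply/rowP => k; rewrite !mxE cres_cj. Qed.

Lemma f1j_comb : f1j = ov_al *: f1i + ov_be *: fmi.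
Proof.
have comb n (x y : cx (AA V)) (u v : 'rV[cx (AA V)]_n) k :
  (x *: u + y *: v) 0 k = x * u 0 k + y * v 0 k by rewrite !mxE.
apply/rowP => k; apply: etrans _ (esym (comb _ _ _ _ _ k)).
have ej : f1j 0 k = rj (Zc j (cFc j 0 k)) by rewrite /f1j mxE /fr1 mxE.
have ei : f1i 0 k = ri (Zc i (cFc i 0 k)) by rewrite /f1i mxE /fr1 mxE.
have em : fmi 0 k = ri (Db (cj (Oi i)) (Zc i) (cFc i 0 k)).
  rewrite /fmi mxE /vc mxE /fr1 mxE /Db; congr (ri (cjx (Zc i _))).
  by have /rowP/(_ k) := cFc_real i; rewrite mxE => ->.
have eF : rj (cFc j 0 k) = ri (cFc i 0 k).
  have /rowP/(_ k) := res_cF Vj'; have /rowP/(_ k) := res_cF Vi'.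
  rewrite mxE => ei'; rewrite mxE => ej'; exact: etrans ej' (esym ei').
apply: etrans ej _; apply: etrans (esym (ovD_rj _)) _; apply: etrans (congr1 D' eF) _.
apply: etrans (ovD_ri _) _; congr (_ * _ + _ * _); exact: esym.
Qed.

Let i11 : dot f1i f1i = 0.
Proof. by rewrite -cres_dot f1c_null; apply: cx_eq; exact: res0. Qed.
Let i1m : dot f1i fmi = 1.
Proof. by rewrite -cres_dot [dot _ _]f1c_unit (cres1 At Vi'). Qed.
Let fmiE : fmi = vc (cj V) f1i.
Proof. exact: cres_vc. Qed.
(** In contrast to the definition of [ov_al], this expression visibly commutes with restriction to a
    smaller open set, which is how [ov_al_res] is obtained. *)
Lemma ov_al_dot : dot f1j fmi = ov_al.
Proof. exact: (null_coef ovD_CD f1j_comb fmiE i11 i1m). Qed.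

Lemma ov_null : ov_al * ov_be = 0.
Proof.
apply: (null_null ovD_CD (@cx_sfun_half V) f1j_comb fmiE i11 i1m).
apply: etrans (esym (cres_dot Vj' _ _)) _; apply: etrans (congr1 rj (f1c_null j)) _.
by apply: cx_eq; exact: res0.
Qed.

Lemma ov_unit : ov_al * cjx ov_al + ov_be * cjx ov_be = 1.
Proof.
apply: (null_unit ovD_CD f1j_comb fmiE i11 i1m).
apply: etrans (congr1 (dot f1j) (esym (cres_vc Vj' _))) _.
apply: etrans (esym (cres_dot Vj' _ _)) _; apply: etrans (congr1 rj (f1c_unit j)) _.
exact: cres1.
Qed.

Lemma ov_morph_al : ov_be = 0 -> frame_morph (cj (Oi i)) (Zc i) (cj V) D' ri ov_al.
Proof.
move=> b0; split; [exact: cresD|exact: cresM|exact: cres_cj| |].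
  by move=> a; rewrite ovD_ri b0 mul0r addr0.
by have := ov_unit; rewrite b0 mul0r addr0.
Qed.

Lemma ov_morph_be : ov_al = 0 ->
  frame_morph (cj (Oi i)) (Zc i) (cj V) D' (ri \o cj (Oi i)) ov_be.
Proof.
move=> a0; split.
- by move=> a b /=; rewrite cjxD /ri cresD.
- by move=> a b /=; rewrite cjxM /ri cresM.
- by move=> a /=; rewrite !/ri (cres_cj Vi').
- by move=> a /=; rewrite ovD_ri a0 mul0r add0r /Db cjxK.
by have := ov_unit; rewrite a0 mul0r add0r.
Qed.

Lemma ov_morph_j : frame_morph (cj (Oi j)) (Zc j) (cj V) D' rj 1.
Proof.
split; [exact: cresD|exact: cresM|exact: cres_cj| |].
  by move=> a; rewrite mul1r ovD_rj.
by rewrite mul1r (cj1 ovD_CD).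
Qed.
End Overlap.

End Transition.

Section Continuity.
Variables (R : realType) (M : topologicalType) (At : surface_atlas R M).

Lemma msmooth_continuous (W : set M) (u : M -> R) p :
  open W -> msmooth At W u -> W p -> {for p, continuous u}.
Proof.
move=> oW su Wp; pose i := chart_at At p; have ip : img i p by exact: chart_atP.
have h : {for p, continuous ((u \o par i) \o coord i)}.
  apply: (@continuous_comp _ _ _ (coord i) (u \o par i)); first exact: coord_continuous.
  by apply: (smooth_continuous (su i)); exact: coord_rdom.
move: h; rewrite /prop_for /continuous_at /comp (coordK ip) => h.
apply: cvg_trans h; apply: (@near_eq_cvg _ _ (nbhs p)).
have : nbhs p (img i) by apply: open_nbhs_nbhs; split => //; exact: image_open.
by apply: filterS => q iq; rewrite (coordK iq).
Qed.

Lemma sfun_continuous (W : opens M) (a : sfun At W) p : oset W p -> {for p, continuous a}.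
Proof. exact: (msmooth_continuous (oset_open W) (sfun_smooth a)). Qed.

Lemma open_gt (W : opens M) (a : sfun At W) (r : R) : open (oset W `&` [set p | r < a p]).
Proof.
rewrite openE => p [Wp ap].
have h1 : nbhs p (oset W) by apply: open_nbhs_nbhs; split => //; exact: oset_open.
exact: filterI h1 (cvgr_gt (a p) (sfun_continuous Wp) r ap).
Qed.

Lemma open_lt (W : opens M) (a : sfun At W) (r : R) : open (oset W `&` [set p | a p < r]).
Proof.
rewrite openE => p [Wp ap].
have h1 : nbhs p (oset W) by apply: open_nbhs_nbhs; split => //; exact: oset_open.
exact: filterI h1 (cvgr_lt (a p) (sfun_continuous Wp) r ap).
Qed.
End Continuity.

Section Transition.
Variables (R : realType) (N : nat) (M : topologicalType) (At : surface_atlas R M).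
Variable f : M -> 'rV[R]_N.+1.
Hypothesis f_imm : smooth_immersion_in_sphere At f.
Notation AA W := (sfun At W).
Notation cj W := (@cjx (sfun At W)).

Notation Z i := (@Zc R N M At f f_imm i).
Notation cF' i := (@cFc R N M At f f_imm i).

Section Restrict.
Variables (i j : chart At) (W V : opens M).
Hypotheses (Wi : oset W `<=` img i) (Wj : oset W `<=` img j).
Hypothesis (VW : oset V `<=` oset W).
Let Vi : oset V `<=` img i := fun p h => Wi (VW h).
Let Vj : oset V `<=` img j := fun p h => Wj (VW h).

Lemma cres_cres (U : opens M) (WU : oset W `<=` oset U) (VU : oset V `<=` oset U) (x : cx (AA U)) :
  cres VW (cres WU x) = cres VU x.
Proof.
have e (a : AA U) : res VW (res WU a) = res VU a.
  apply: sfun_eq => p Vp; apply: etrans (resE _ _ Vp) _.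
  by apply: etrans (resE _ _ (VW Vp)) _; apply: esym; exact: resE.
by apply: cx_eq; exact: e.
Qed.

Lemma ov_al_res : ov_al f_imm Vi Vj = cres VW (ov_al f_imm Wi Wj).
Proof.
apply: etrans (esym (ov_al_dot f_imm Vi Vj)) _.
apply: etrans _ (congr1 (cres VW) (ov_al_dot f_imm Wi Wj)).
apply: etrans _ (esym (cres_dot VW _ _)).
by congr dot; apply/rowP => k; rewrite [LHS]mxE [RHS]mxE [X in cres VW X]mxE; apply: esym; exact: cres_cres.
Qed.
End Restrict.

(** The product of [ov_al] and [ov_be] is zero, so one factor vanishes as soon as the other is
    invertible on the whole open set. *)
Lemma ov_be0 (i j : chart At) (V : opens M) (Vi : oset V `<=` img i) (Vj : oset V `<=` img j) :
  (forall p, oset V p -> 0 < re (ov_al f_imm Vi Vj * cjx (ov_al f_imm Vi Vj)) p) ->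
  ov_be f_imm Vi Vj = 0.
Proof.
set al := ov_al _ _ _; set be := ov_be _ _ _ => h.
have [b bE] : exists b, re (al * cjx al) * b = 1.
  by apply: sfun_inv => p /h h0; rewrite gt_eqF.
have e : al * cjx al * cxr b = 1.
  apply: cx_eq => /=; last by ring.
  by rewrite -bE /=; ring.
rewrite -[LHS]mul1r -e; transitivity (al * be * (cjx al * cxr b)); first by ring.
by rewrite (ov_null f_imm Vi Vj) mul0r.
Qed.

Lemma ov_al0 (i j : chart At) (V : opens M) (Vi : oset V `<=` img i) (Vj : oset V `<=` img j) :
  (forall p, oset V p -> re (ov_al f_imm Vi Vj * cjx (ov_al f_imm Vi Vj)) p < 1) ->
  ov_al f_imm Vi Vj = 0.
Proof.
set al := ov_al _ _ _; set be := ov_be f_imm Vi Vj => h.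
have u : al * cjx al + be * cjx be = 1 by exact: ov_unit.
have [b bE] : exists b, re (be * cjx be) * b = 1.
  apply: sfun_inv => p Vp; have := h p Vp.
  have := congr1 (@re _) u => /(congr1 (fun a : AA V => a p)) u1.
  have := etrans (esym (sfunD (re (al * cjx al)) (re (be * cjx be)) Vp)) (etrans u1 (sfun1 At Vp)).
  move: (re (al * cjx al) p) (re (be * cjx be) p) => a c e1 e2.
  by rewrite gt_eqF //; lra.
have e : be * cjx be * cxr b = 1.
  apply: cx_eq => /=; last by ring.
  by rewrite -bE /=; ring.
rewrite -[LHS]mul1r -e; transitivity (al * be * (cjx be * cxr b)); first by ring.
by rewrite (ov_null f_imm Vi Vj) mul0r.
Qed.

(** The overlap is covered by the open sets |al|^2 > 1/2 and |al|^2 < 1. On the first, be = 0 and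
    the frames differ by a rotation. On the second, |be|^2 = 1 - |al|^2 is invertible, so al = 0 and
    the orientation is reversed, whence the conjugation inside [th]. On real parts both transports
    are plain restriction. *)
Lemma transition (i j : chart At) p : img i p -> img j p ->
  exists (V : opens M) (Vi : oset V `<=` img i) (Vj : oset V `<=` img j),
  oset V p /\ exists (th : cx (AA (Oi i)) -> cx (AA V)) lam,
  [/\ frame_morph (cj (Oi i)) (Z i) (cj V) (ovD f_imm Vj) th lam,
    th 1 = 1, map_mx th (cF' i) = ovF f_imm V,
    forall x q, oset V q -> re (th x) q = re x q
  & forall c, th (cxr (sfC At (Oi i) c)) = cxr (sfC At V c)].
Proof.
move=> ip jp.
pose W := Opens (openI (@image_open _ _ At i) (@image_open _ _ At j)).
have Wi : oset W `<=` img i by move=> q [].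
have Wj : oset W `<=` img j by move=> q [].
pose ka := re (ov_al f_imm Wi Wj * cjx (ov_al f_imm Wi Wj)).
have kaV (V : opens M) (VW : oset V `<=` oset W) q : oset V q ->
    re (ov_al f_imm (fun p h => Wi p (VW p h)) (fun p h => Wj p (VW p h)) *
       cjx (ov_al f_imm (fun p h => Wi p (VW p h)) (fun p h => Wj p (VW p h)))) q = ka q.
  move=> Vq; apply: etrans (resE VW ka Vq); congr (sval _ q).
  rewrite (ov_al_res Wi Wj VW) -(cres_cj VW) -(cresM VW).
  by [].
have res_sfC V (VW : oset V `<=` oset (Oi i)) c :
    cres VW (cxr (sfC At (Oi i) c)) = cxr (sfC At V c).
  by apply: cx_eq; [exact: res_cst|exact: res0].
have creal (V : opens M) (VO : oset V `<=` oset (Oi i)) (x : cx (AA (Oi i))) :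
    im x = 0 -> cres VO (cjx x) = cres VO x.
  by move=> x0; have -> : cjx x = x by apply: cx_eq; rewrite //= x0 oppr0.
have [k1|k1] := ltP (2^-1) (ka p).
  pose V := Opens (open_gt ka 2^-1); have VW : oset V `<=` oset W by move=> q [].
  exists V, (fun p h => Wi p (VW p h)), (fun p h => Wj p (VW p h)); split; first by split.
  exists (@cres R M At (Oi i) V (fun p h => Wi p (VW p h))), (ov_al f_imm (fun p h => Wi p (VW p h)) (fun p h => Wj p (VW p h))); split.
  - apply: ov_morph_al; apply: ov_be0 => q Vq.
    apply: (@eq_ind_r _ _ (fun a => 0 < a) _ _ (kaV V VW q Vq)).
    by case: Vq => _ /=; apply: lt_trans; rewrite invr_gt0.
  - exact: cres1.
  - exact: res_cF.
  - by move=> x q Vq; exact: resE.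
  - by move=> c; exact: res_sfC.
pose V := Opens (open_lt ka 1); have VW : oset V `<=` oset W by move=> q [].
exists V, (fun p h => Wi p (VW p h)), (fun p h => Wj p (VW p h)); split.
  by split => //=; apply: le_lt_trans k1 _; rewrite invf_lt1 // ltr1n.
exists (@cres R M At (Oi i) V (fun p h => Wi p (VW p h)) \o cj (Oi i)),
  (ov_be f_imm (fun p h => Wi p (VW p h)) (fun p h => Wj p (VW p h))); split.
- apply: ov_morph_be; apply: ov_al0 => q Vq.
  apply: (@eq_ind_r _ _ (fun a => a < 1) _ _ (kaV V VW q Vq)).
  by case: Vq.
- by apply: etrans (creal _ _ _ _) _ => //; exact: cres1.
- apply: etrans (@res_cF _ _ _ _ _ f_imm V (Oi i) (fun p h => Wi p (VW p h))).
  apply/rowP => k; rewrite [LHS]mxE [RHS]mxE /=; apply: creal.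
  by rewrite mxE.
- by move=> x q Vq; exact: resE.
- by move=> c; exact: (etrans (creal V _ (cxr (sfC At (Oi i) c)) erefl) (res_sfC _ _ c)).
Qed.
End Transition.

(** * Functions on the surface from expressions in charts *)

Section Global.
Variables (R : realType) (N : nat) (M : topologicalType) (At : surface_atlas R M).
Variable f : M -> 'rV[R]_N.+1.
Hypothesis f_imm : smooth_immersion_in_sphere At f.
Notation AA W := (sfun At W).
Notation cj W := (@cjx (sfun At W)).
Notation Z i := (@Zc R N M At f f_imm i).
Notation cF' i := (@cFc R N M At f f_imm i).
Notation Oc i := (@Oi R M At i).

(* X i is the expression in the frame of chart i of a function on M; invariant
   says that it is transported by every change of frame, so that gl X does not
   depend on the charts chosen. *)
Definition gl (X : forall i : chart At, cx (AA (Oc i))) (p : M) : R :=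
  re (X (chart_at At p)) p.

Definition invariant (X : forall i : chart At, cx (AA (Oc i))) : Prop :=
  forall (V : opens M) (j : chart At) (Vj : oset V `<=` img j),
  exists Y : cx (AA V), forall i th lam,
    frame_morph (cj (Oc i)) (Z i) (cj V) (ovD f_imm Vj) th lam ->
    th 1 = 1 -> map_mx th (cF' i) = ovF f_imm V ->
    (forall c, th (cxr (sfC At (Oc i) c)) = cxr (sfC At V c)) ->
    th (X i) = Y.

Lemma invariant_eq X : invariant X -> forall i j p, img i p -> img j p ->
  re (X i) p = re (X j) p.
Proof.
move=> iX i j p ip jp.
have [V [Vi [Vj [Vp [th [lam [FM th1 thF thv thc]]]]]]] := transition f_imm ip jp.
have [Y hY] := iX V j Vj.
have e1 := hY i th lam FM th1 thF thc.
(* Chart j reaches the overlap by plain restriction, a change of frame with factor 1. *)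
have e2 := hY j _ _ (ov_morph_j f_imm Vj) (cres1 At _) (@res_cF _ _ _ _ _ f_imm V (Oc j) Vj).
have hc c : @cres R M At (Oc j) V Vj (cxr (sfC At (Oc j) c)) = cxr (sfC At V c).
  by apply: cx_eq; [exact: res_cst|exact: res0].
have {}e2 := e2 hc.
have v1 := thv (X i) p Vp.
have v2 : re (@cres R M At (Oc j) V Vj (X j)) p = re (X j) p by exact: resE.
by apply: etrans (esym v1) _; apply: etrans _ v2; rewrite e1 e2.
Qed.

Lemma gl_chart X i p : invariant X -> img i p -> gl X p = re (X i) p.
Proof. by move=> iX ip; apply: invariant_eq => //; exact: chart_atP. Qed.

Lemma gl_smooth X : invariant X -> msmooth At setT (gl X).
Proof.
move=> iX i k; apply: (@eq_Ck _ _ k _ (re (X i) \o par i)).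
- exact/rdom_open/openT.
- by move=> x [dx _] /=; apply: esym; apply: gl_chart => //; exact: par_img.
apply: (@Ck_sub _ _ k (rdom i (oset (Oc i)))); last exact: sfun_Ck.
by move=> x [dx _]; split => //; exact: par_img.
Qed.

Definition tI i := hm (cj (Oc i)) (fr2 (cj (Oc i)) (Z i) (cF' i)) (fr2 (cj (Oc i)) (Z i) (cF' i)).
Definition hhI i := fr_hh (cj (Oc i)) (Z i) (cF' i).
Definition HI k i := fr_H (cj (Oc i)) (Z i) (cF' i) 0 k.
Definition QI i := fr_Q (cj (Oc i)) (Z i) (cF' i) * cjx (fr_Q (cj (Oc i)) (Z i) (cF' i)).

Lemma tI_inv : invariant tI.
Proof.
move=> V j Vj; exists (hm (cj V) (fr2 (cj V) (ovD f_imm Vj) (ovF f_imm V)) (fr2 (cj V) (ovD f_imm Vj) (ovF f_imm V))).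
move=> i th lam FM th1 thF _.
exact: (esym (th_t0 (ovD_CD f_imm Vj) FM (esym thF) (f1c_unit f_imm i) th1)).
Qed.

Lemma hhI_inv : invariant hhI.
Proof.
move=> V j Vj; exists (fr_hh (cj V) (ovD f_imm Vj) (ovF f_imm V)).
move=> i th lam FM th1 thF _.
exact: (esym (th_hh (ovD_CD f_imm Vj) FM (esym thF) (f1c_unit f_imm i) th1)).
Qed.

Lemma QI_inv : invariant QI.
Proof.
move=> V j Vj; exists (fr_Q (cj V) (ovD f_imm Vj) (ovF f_imm V) * cjx (fr_Q (cj V) (ovD f_imm Vj) (ovF f_imm V))).
move=> i th lam FM th1 thF _.
exact: (esym (th_QQ (ovD_CD f_imm Vj) FM (esym thF) (f1c_unit f_imm i) th1)).
Qed.

Lemma HI_inv k : invariant (HI k).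
Proof.
move=> V j Vj; exists (fr_H (cj V) (ovD f_imm Vj) (ovF f_imm V) 0 k).
move=> i th lam FM th1 thF _.
have := tv_H (ovD_CD f_imm Vj) FM (esym thF) (f1c_unit f_imm i) th1.
by move=> /rowP/(_ k) e; apply: esym; apply: etrans e _; rewrite mxE.
Qed.
End Global.

Section Values.
Variables (R : realType) (N : nat) (M : topologicalType) (At : surface_atlas R M).
Variable f : M -> 'rV[R]_N.+1.
Hypothesis f_imm : smooth_immersion_in_sphere At f.
Notation AA W := (sfun At W).
Notation cj W := (@cjx (sfun At W)).
Notation Z i := (@Zc R N M At f f_imm i).
Notation cF' i := (@cFc R N M At f f_imm i).
Notation Oc i := (@Oi R M At i).
Notation tI := (@tI R N M At f f_imm).
Notation hhI := (@hhI R N M At f f_imm).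
Notation HI := (@HI R N M At f f_imm).
Notation QI := (@QI R N M At f f_imm).

Lemma S_gl p : S_ At f p = (gl tI p + gl hhI p) *+ 2.
Proof. exact: (@ch_S _ _ _ _ _ f_imm (chart_at At p) (Oc (chart_at At p)) _ p (chart_atP At p)). Qed.

Lemma Hvec_gl p k : Hvec At f p 0 k = gl (HI k) p.
Proof.
have := @ch_HE _ _ _ _ _ f_imm (chart_at At p) (Oc (chart_at At p)) (@Oii _ _ _ _) p (chart_atP At p).
move=> /rowP/(_ k) e; apply: etrans e _; rewrite mxE; congr (sval _ p).
by rewrite [LHS]mxE.
Qed.

Lemma Hvec_chart i p k : img i p -> Hvec At f p 0 k = re (HI k i) p.
Proof. by move=> ip; apply: etrans (Hvec_gl p k) _; exact: (gl_chart (@HI_inv _ _ _ _ _ f_imm k)). Qed.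

Lemma HI_real i : vc (cj (Oc i)) (fr_H (cj (Oc i)) (Z i) (cF' i)) = fr_H (cj (Oc i)) (Z i) (cF' i).
Proof. exact: (H_real (Zc_CD f_imm i) (cFc_real f_imm i) (Zc_comm f_imm (i := i))). Qed.

Definition Hr i : 'rV[AA (Oc i)]_N.+1 := map_mx (@re (AA (Oc i))) (fr_H (cj (Oc i)) (Z i) (cF' i)).

Lemma evr_Hr i p : img i p -> evr p (Hr i) = Hvec At f p.
Proof.
move=> ip; apply/rowP => k; apply: etrans _ (esym (Hvec_chart k ip)).
by rewrite mxE; congr (sval _ p); rewrite mxE.
Qed.

Lemma hh_val p : gl hhI p = dot (Hvec At f p) (Hvec At f p).
Proof.
set i := chart_at At p; have ip : img i p by exact: chart_atP.
have e : fr_hh (cj (Oc i)) (Z i) (cF' i) = cxr (dot (Hr i) (Hr i)).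
  have emb : fr_H (cj (Oc i)) (Z i) (cF' i) = map_mx (@cxr _) (Hr i).
    apply/rowP => k; rewrite [RHS]mxE /Hr [X in cxr X]mxE.
    apply: (cx_real (@sfun_half _ _ At (Oc i))).
    by have /rowP/(_ k) := HI_real i; rewrite mxE.
  by rewrite /fr_hh emb [LHS]dot_cxr.
apply: etrans (congr1 (fun x : cx (AA (Oc i)) => re x p) e) _.
apply: etrans (@evr_dot _ _ _ (Oc i) p ip _ (Hr i) (Hr i)) _.
by rewrite evr_Hr.
Qed.

Lemma hh_ge0 p : 0 <= gl hhI p. Proof. by rewrite hh_val dot_ge0. Qed.

Lemma H_gl p : H_ At f p ^+ 2 = gl hhI p.
Proof. by rewrite hh_val /H_ sqr_sqrtr // dotvE dot_ge0. Qed.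

Hypothesis H_par : parallel_mean_curvature At f.

(** The hypothesis concerns the field [Hvec] at each point; here it becomes an identity in the ring
    of chart i, checked point by point. *)
Lemma chart_parallel i : exists x y, vD (Z i) (fr_H (cj (Oc i)) (Z i) (cF' i)) =
  x *: fr1 (Z i) (cF' i) + y *: vc (cj (Oc i)) (fr1 (Z i) (cF' i)).
Proof.
pose d := cder (@Oii _ _ At i).
apply: (@parallel_tangential _ d (@sfun_half _ _ At (Oc i)) (cderD _) (cderM _)
  (cderC _) _ _ _ _ (fsE f_imm _) (frE f_imm _) (Fv_unit f_imm _)) => a.
apply/rowP => k; apply: sfun_eq => p ip.
have oi : open (rdom i (oset (Oc i))) by exact/rdom_open/oset_open.
have rp : rdom i (oset (Oc i)) (coord i p) by exact: coord_rdom.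
have dH k' : differentiable (fun y => Hvec At f (par i y) 0 k') (coord i p).
  apply: (@eq_differentiable _ _ _ (Hr i 0 k' \o par i) _ _ oi) => //.
    move=> y [dy _]; apply: etrans _ (esym (Hvec_chart k' (par_img dy))).
    by rewrite /= /Hr mxE.
  exact: (@sfun_diff _ _ At (Oc i) i (@Oii _ _ At i) (Hr i 0 k') p ip).
have eH : evr p (dv d a (Hr i)) = partial a (Hvec At f \o par i) (coord i p).
  rewrite /partial derive_mx; last first.
    by apply/derivable_mxP => i0 k'; rewrite ord1; exact: diff_derivable.
  apply/rowP => k'; rewrite [RHS]mxE.
  have -> : evr p (dv d a (Hr i)) 0 k' = d a (Hr i 0 k') p.
    by rewrite mxE [dv _ _ _ _ _]mxE.
  apply: etrans (sf_pdE (@Oii _ _ At i) a _ ip) _.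
  apply: (eq_pd a oi) => // y [dy _].
  by apply: etrans _ (esym (Hvec_chart k' (par_img dy))); rewrite /= /Hr mxE.
have np := normal_partE f_imm (@Oii _ _ At i) ip (dv d a (Hr i)).
have h0 : normal_part (f \o par i) (coord i p) (partial a (Hvec At f \o par i) (coord i p)) = 0.
  by apply: H_par; exact: coord_dom.
have := etrans (esym np) (etrans (congr1 _ eH) h0) => /rowP/(_ k).
rewrite mxE [RHS]mxE => e; apply: etrans e _; rewrite mxE.
exact: esym (sfun0 At ip).
Qed.

Lemma chart_gauss i : frK (cj (Oc i)) (Z i) (fr_rho (cj (Oc i)) (Z i) (cF' i)) = 1 + hhI i - tI i.
Proof.
exact: (Gauss (Zc_CD f_imm i) (@cx_sfun_half _ _ At _) (cFc_real f_imm i) (cFc_unit f_imm i)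
  (f1c_null f_imm i) (f1c_unit f_imm i) (Zc_comm f_imm (i := i)) (chart_parallel i)).
Qed.

Lemma chart_Dhh i : Z i (hhI i) = 0.
Proof.
exact: (D_hh (Zc_CD f_imm i) (@cx_sfun_half _ _ At _) (cFc_real f_imm i) (cFc_unit f_imm i)
  (f1c_null f_imm i) (f1c_unit f_imm i) (Zc_comm f_imm (i := i)) (chart_parallel i)).
Qed.

Lemma chart_lapQ i : lap (cj (Oc i)) (Z i) (fr_rho (cj (Oc i)) (Z i) (cF' i)) (QI i) =
  (1 + hhI i - tI i) *+ 2 * QI i +
  dd (Z i) (fr_rho (cj (Oc i)) (Z i) (cF' i)) 2 (fr_Q (cj (Oc i)) (Z i) (cF' i)) *
  cjx (dd (Z i) (fr_rho (cj (Oc i)) (Z i) (cF' i)) 2 (fr_Q (cj (Oc i)) (Z i) (cF' i))).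
Proof.
rewrite -chart_gauss.
exact: (lap_Q (Zc_CD f_imm i) (@cx_sfun_half _ _ At _) (cFc_real f_imm i) (cFc_unit f_imm i)
  (f1c_null f_imm i) (f1c_unit f_imm i) (Zc_comm f_imm (i := i)) (chart_parallel i)).
Qed.

End Values.

(** * Maximum principles *)

Section Ev.
Variables (R : realType) (M : topologicalType) (At : surface_atlas R M) (W : opens M).
Variables (p : M) (Wp : oset W p).
Notation C := (cx (sfun At W)).
Definition evc (x : C) : cx R := Cx (re x p) (im x p).
Lemma evcD x y : evc (x + y) = evc x + evc y.
Proof. by apply: cx_eq; exact: sfunD. Qed.
Lemma evcN x : evc (- x) = - evc x.
Proof. by apply: cx_eq; exact: sfunN. Qed.
Lemma evcM x y : evc (x * y) = evc x * evc y.
Proof.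
apply: cx_eq => /=.
  apply: etrans (sfunD (re x * re y) (- (im x * im y)) Wp) _.
  by rewrite (sfunN (im x * im y) Wp) (sfunM (re x) (re y) Wp) (sfunM (im x) (im y) Wp).
apply: etrans (sfunD (re x * im y) (im x * re y) Wp) _.
by rewrite (sfunM (re x) (im y) Wp) (sfunM (im x) (re y) Wp).
Qed.
Lemma evc0 : evc 0 = 0. Proof. by apply: cx_eq; exact: sfun0. Qed.
Lemma evc1 : evc 1 = 1. Proof. by apply: cx_eq; [exact: sfun1|exact: sfun0]. Qed.
Lemma evc_cj x : evc (cjx x) = cjx (evc x).
Proof. by apply: cx_eq => //=; exact: sfunN. Qed.
Lemma evcMn x k : evc (x *+ k) = evc x *+ k.
Proof. by elim: k => [|k IH]; [exact: evc0|rewrite !mulrS evcD IH]. Qed.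
Lemma evc_r a : evc (cxr a) = cxr (a p).
Proof. by apply: cx_eq => //=; exact: sfun0. Qed.
End Ev.

Section LapFormula.
Variables (A : comPzRingType) (d : 'I_2 -> A -> A).
Hypothesis dD : forall k a b, d k (a + b) = d k a + d k b.
Hypothesis dM : forall k a b, d k (a * b) = d k a * b + a * d k b.
Variables (z : 'I_2 -> cx A) (rho : cx A) (u : A).
Let Z := Zf d z.
Let cj := @cjx A.

Lemma Zf_real : Z (cxr u) = z 0 * cxr (d 0 u) + z 1 * cxr (d 1 u).
Proof.
by congr (_ * _ + _ * _); apply: cx_eq; rewrite //= (d_0 dD).
Qed.

Lemma lap_coord : lap cj Z rho (cxr u) =
  cj (z 0) * z 0 * cxr (d 0 (d 0 u)) + cj (z 0) * z 1 * cxr (d 0 (d 1 u))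
  + cj (z 1) * z 0 * cxr (d 1 (d 0 u)) + cj (z 1) * z 1 * cxr (d 1 (d 1 u))
  + (Db cj Z (z 0) - cj rho * z 0) * cxr (d 0 u)
  + (Db cj Z (z 1) - cj rho * z 1) * cxr (d 1 u).
Proof.
have DbE y : Db cj Z y = cj (z 0) * dx d 0 y + cj (z 1) * dx d 1 y.
  by rewrite /Db /Z /Zf /cj cjxD !cjxM !(dx_cj dD) !cjxK.
have dr k v : dx d k (cxr v) = cxr (d k v) by apply: cx_eq; rewrite //= (d_0 dD).
rewrite /lap comm_0 Zf_real !DbE !(dxD dD) !(dxM dD dM) !dr; ring.
Qed.
End LapFormula.

Lemma pd_lin2 (R : realType) m (g h : 'rV[R]_m -> R) (c e : R) a x :
  differentiable g x -> differentiable h x ->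
  pd a ((cst c \* g) \+ (cst e \* h)) x = c * pd a g x + e * pd a h x.
Proof.
move=> dg dh; have dc b : differentiable (cst b : 'rV[R]_m -> R) x by exact: differentiable_cst.
apply: etrans (pdD a (differentiableM (dc c) dg) (differentiableM (dc e) dh)) _.
apply: etrans (f_equal2 +%R (pdM a (dc c) dg) (pdM a (dc e) dh)) _.
by rewrite (pd_cst c a x) (pd_cst e a x) !mulr0 !addr0.
Qed.

Section Chart.
Variables (R : realType) (N : nat) (M : topologicalType) (At : surface_atlas R M).
Variable f : M -> 'rV[R]_N.+1.
Hypothesis f_imm : smooth_immersion_in_sphere At f.
Variable i : chart At.
Notation O := (@Oi R M At i).
Notation A := (sfun At O).
Notation cj := (@cjx A).
Notation Z := (@Zc R N M At f f_imm i).
Notation F := (@cFc R N M At f f_imm i).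
Notation d := (cder (@Oii R M At i)).
Notation rho := (fr_rho cj Z F).
Notation L := (lap cj Z rho).

(** The real part of the Hermitian form given by w is the sum of two squares of real directions, the
    real and the imaginary part of w; along each one the second derivative test applies. *)
Lemma max_second (U : set 'rV[R]_2) (g : 'rV[R]_2 -> R) (x : 'rV[R]_2) (w : 'I_2 -> cx R) :
  open U -> smooth U g -> U x -> (forall y, U y -> g y <= g x) ->
  re (cjx (w 0) * w 0) * pd 0 (pd 0 g) x + re (cjx (w 0) * w 1) * pd 0 (pd 1 g) x
  + re (cjx (w 1) * w 0) * pd 1 (pd 0 g) x + re (cjx (w 1) * w 1) * pd 1 (pd 1 g) x <= 0.
Proof.
move=> oU sg Ux mx.
have h (v : 'rV[R]_2) : v 0 0 * (v 0 0 * pd 0 (pd 0 g) x + v 0 1 * pd 0 (pd 1 g) x)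
  + v 0 1 * (v 0 0 * pd 1 (pd 0 g) x + v 0 1 * pd 1 (pd 1 g) x) <= 0.
  have sd := smooth_dir v oU sg.
  have e a : pd a ('D_v g) x = v 0 0 * pd a (pd 0 g) x + v 0 1 * pd a (pd 1 g) x.
    have e0 y : U y -> 'D_v g y = ((cst (v 0 0) \* pd 0 g) \+ (cst (v 0 1) \* pd 1 g)) y.
      by move=> Uy; rewrite (derive_dir v (smooth_differentiable sg Uy)) sum2.
    have dp k : differentiable (pd k g) x by exact: smooth_differentiable (smooth_pd k sg) Ux.
    by apply: etrans (eq_pd a oU e0 Ux) _; exact: pd_lin2.
  have e2 : 'D_v ('D_v g) x = v 0 0 * pd 0 ('D_v g) x + v 0 1 * pd 1 ('D_v g) x.
    exact: etrans (derive_dir v (smooth_differentiable sd Ux)) (sum2 _).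
  have gen (a b a' b' c c' q : R) : q = a * c + b * c' -> c = a' -> c' = b' ->
      q <= 0 -> a * a' + b * b' <= 0 by move=> -> -> ->.
  exact: gen e2 (e 0) (e 1) (max_derive2 v oU sg Ux mx).
have gen (p00 p01 p10 p11 : R) (w0 w1 : cx R) :
  (forall v : 'rV[R]_2, v 0 0 * (v 0 0 * p00 + v 0 1 * p01)
     + v 0 1 * (v 0 0 * p10 + v 0 1 * p11) <= 0) ->
  re (cjx w0 * w0) * p00 + re (cjx w0 * w1) * p01 + re (cjx w1 * w0) * p10
  + re (cjx w1 * w1) * p11 <= 0.
  move=> {}h.
  have h1 := h (\row_k re (if k == 0 then w0 else w1)).
  have h2 := h (\row_k im (if k == 0 then w0 else w1)).
  move: h1 h2; rewrite !mxE /=; move: (re w0) (im w0) (re w1) (im w1) => a b c e h1 h2.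
  by lra.
exact: gen h.
Qed.

Lemma chart_max (U : set 'rV[R]_2) (u : A) p : img i p -> open U -> U `<=` dom i ->
  U (coord i p) -> (forall y, U y -> u (par i y) <= u p) ->
  [/\ evc p (Z (cxr u)) = 0 & re (L (cxr u)) p <= 0].
Proof.
move=> ip oU Ud Ux mx; set g := u \o par i; set x := coord i p.
have px : par i x = p by exact: coordK.
have sg : smooth U g.
  move=> k; apply: (@Ck_sub _ _ k (rdom i (oset O))); last exact: sfun_Ck.
  by move=> y /Ud dy; split => //; exact: par_img.
have mg y : U y -> g y <= g x by move=> Uy; rewrite /g /= px; exact: mx.
have d0 k : d k u p = 0.
  by apply: etrans (sf_pdE (@Oii _ _ At i) k u ip) _; exact: max_pd oU sg Ux mg.
have d2 k l : d k (d l u) p = pd k (pd l g) x.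
  apply: etrans (sf_pdE (@Oii _ _ At i) k _ ip) _.
  apply: (eq_pd k oU) => // y Uy /=.
  have Oy : oset O (par i y) by exact/par_img/Ud.
  apply: etrans (sf_pdE (@Oii _ _ At i) l u Oy) _.
  by rewrite parK //; exact: Ud.
have dD := cderD (@Oii R M At i); have dM := cderM (@Oii R M At i).
have Op : oset O p := ip.
split.
  apply: etrans (congr1 (evc p) (Zf_real dD _ u)) _.
  apply: etrans (evcD Op _ _) _.
  apply: etrans (f_equal2 +%R (evcM Op _ _) (evcM Op _ _)) _.
  apply: etrans (f_equal2 (fun a b => _ * a + _ * b) (evc_r Op (d 0 u)) (evc_r Op (d 1 u))) _.
  by rewrite !d0 (_ : cxr 0 = 0) // !mulr0 addr0.
pose zz := gsz d (Fv f_imm O) (fs f_imm (@Oii _ _ At i)) (fr f_imm (@Oii _ _ At i)).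
pose w k := evc p (zz k).
have e : evc p (L (cxr u)) =
  cjx (w 0) * w 0 * cxr (d 0 (d 0 u) p) + cjx (w 0) * w 1 * cxr (d 0 (d 1 u) p)
  + cjx (w 1) * w 0 * cxr (d 1 (d 0 u) p) + cjx (w 1) * w 1 * cxr (d 1 (d 1 u) p).
  apply: etrans (congr1 (evc p) (lap_coord dD dM zz rho u)) _.
  have gen (a b c e h1 h2 k1 k2 y0 y1 y2 y3 t0 t1 : cx A) :
    evc p t0 = 0 -> evc p t1 = 0 ->
    evc p (cj a * a * y0 + cj a * b * y1 + cj b * a * y2 + cj b * b * y3 + h1 * t0 + h2 * t1)
    = cjx (evc p a) * evc p a * evc p y0 + cjx (evc p a) * evc p b * evc p y1
     + cjx (evc p b) * evc p a * evc p y2 + cjx (evc p b) * evc p b * evc p y3.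
    by move=> t00 t10; rewrite !(evcD Op, evcM Op, evc_cj Op) t00 t10; ring.
  have r0 k : evc p (cxr (d k u)) = 0 by apply: etrans (evc_r Op _) _; rewrite d0.
  apply: etrans (gen _ _ 0 0 _ _ 0 0 _ _ _ _ _ _ (r0 0) (r0 1)) _.
  by congr (_ * _ + _ * _ + _ * _ + _ * _); exact: evc_r.
have gen (w0 w1 q : cx R) (p00 p01 p10 p11 g00 g01 g10 g11 : R) :
  q = cjx w0 * w0 * cxr p00 + cjx w0 * w1 * cxr p01 + cjx w1 * w0 * cxr p10
      + cjx w1 * w1 * cxr p11 ->
  p00 = g00 -> p01 = g01 -> p10 = g10 -> p11 = g11 ->
  re (cjx w0 * w0) * g00 + re (cjx w0 * w1) * g01 + re (cjx w1 * w0) * g10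
  + re (cjx w1 * w1) * g11 <= 0 -> re q <= 0.
  move=> -> -> -> -> ->; apply: le_trans; rewrite /=.
  by rewrite le_eqVlt; apply/orP; left; apply/eqP; ring.
exact: gen e (d2 0 0) (d2 0 1) (d2 1 0) (d2 1 1) (max_second w oU sg Ux mg).
Qed.
End Chart.

(** * Touching balls and the barrier of Hopf's principle *)

Section Euclid.
Variable R : realType.
Implicit Types x y v : 'rV[R]_2.
(** The squared Euclidean norm: the norm of ['rV] is the maximum norm, whose balls are not round,
    and the barrier needs round ones. *)
Definition nn v := v 0 0 ^+ 2 + v 0 1 ^+ 2.

Lemma nn_ge0 v : 0 <= nn v. Proof. by rewrite addr_ge0 ?sqr_ge0. Qed.
Lemma nnD u v : nn (u + v) <= 2 * nn u + 2 * nn v.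
Proof.
rewrite /nn !mxE; have := sqr_ge0 (u 0 0 - v 0 0); have := sqr_ge0 (u 0 1 - v 0 1).
by rewrite !expr2; lra.
Qed.
Lemma nnN v : nn (- v) = nn v.
Proof. by rewrite /nn !mxE !sqrrN. Qed.

Lemma cont_nn y : continuous (fun x => nn (x - y)).
Proof.
have h k : continuous (fun x : 'rV[R]_2 => (x - y) 0 k).
  move=> x; apply: (@continuous_comp _ _ _ (fun x => x - y) (fun v : 'rV[R]_2 => v 0 k)).
    by apply: continuousB => //; exact: cst_continuous.
  exact: differentiable_continuous (differentiable_coord _ _ _).
pose g k (x : 'rV[R]_2) : R := (x - y) 0 k.
have -> : (fun x => nn (x - y)) = (g 0 \* g 0) \+ (g 1 \* g 1).
  by apply/funext => x; rewrite /nn !expr2.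
by move=> x; apply: continuousD; apply: continuousM; exact: h.
Qed.

Lemma norm_nn v e : 0 <= e -> nn v <= e ^+ 2 -> `|v| <= e.
Proof.
move=> e0 h; rewrite /Num.Def.normr /= mx_normrE; apply: bigmax_le => // -[a k] _ /=.
rewrite ord1 -ler_sqr ?nnegrE // real_normK ?num_real //; apply: le_trans h.
have [->|->] := ord2 k; rewrite /nn; [rewrite lerDl|rewrite lerDr]; exact: sqr_ge0.
Qed.

Lemma nbhs_nn x (U : set 'rV[R]_2) : nbhs x U ->
  exists2 e : R, 0 < e & forall y, nn (y - x) <= e -> U y.
Proof.
move=> /nbhs_ballP[r /= r0 rU]; exists ((r / 2) ^+ 2); first by rewrite exprn_gt0 // divr_gt0.
move=> y h; apply: rU; rewrite -ball_normE /= distrC; apply: (@le_lt_trans _ _ (r / 2)).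
  by apply: norm_nn h; rewrite divr_ge0 // ltW.
by rewrite ltr_pdivrMr // ltr_pMr // ltr1n.
Qed.

Lemma open_nn x e : open [set y | nn (y - x) < e].
Proof.
by apply: (open_comp (f := fun y => nn (y - x)) (D := [set r | r < e])) => // y _; exact: cont_nn.
Qed.

Lemma compact_nn x (e : R) (B : set 'rV[R]_2) : closed B ->
  compact (B `&` [set y | nn (y - x) <= e]).
Proof.
move=> cB; apply: bounded_closed_compact.
  exists (`|x| + (`|e| + 1)); split; first exact: num_real.
  move=> m hm y [_ /= h]; apply: le_trans (ltW hm).
  rewrite -[y](subrK x) addrC; apply: le_trans (ler_normD _ _) _; rewrite lerD2l.
  apply: norm_nn; first by rewrite addr_ge0.
  apply: le_trans h _; apply: le_trans (ler_norm _) _.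
  by have := normr_ge0 e; nra.
apply: closedI => //.
by apply: (preimage_closed (f := fun y => nn (y - x)) (D := [set r | r <= e])) => // y _; exact: cont_nn.
Qed.
End Euclid.

Section Chart.
Variables (R : realType) (N : nat) (M : topologicalType) (At : surface_atlas R M).
Variable f : M -> 'rV[R]_N.+1.
Hypothesis f_imm : smooth_immersion_in_sphere At f.
Variable i : chart At.
Notation O := (@Oi R M At i).
Notation A := (sfun At O).
Notation cj := (@cjx A).
Notation Z := (@Zc R N M At f f_imm i).
Notation F := (@cFc R N M At f f_imm i).
Notation d := (cder (@Oii R M At i)).
Notation rho := (fr_rho cj Z F).
Notation L := (lap cj Z rho).

Lemma frame_nondeg (u : A) p k : img i p -> evc p (Z (cxr u)) = 0 -> d k u p = 0.
Proof.
move=> ip; have Op : oset O p := ip; move=> e.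
have h := gs_dual (cderD (@Oii R M At i)) (cderM (@Oii R M At i)) (fsE f_imm _) (frE f_imm _) k (cxr u).
have hb : Db cj Z (cxr u) = cjx (Z (cxr u)).
  rewrite /Db; apply: congr1; apply: congr1; apply: cx_eq => //=; exact: oppr0.
have gen (a b x y : cx A) : y = cjx x -> evc p x = 0 -> re (a * x + b * y) p = 0.
  move=> -> x0; rewrite -[LHS]/(re (evc p (a * x + b * cjx x))).
  by rewrite (evcD Op) !(evcM Op) (evc_cj Op) x0; rewrite /=; ring.
exact: (etrans (congr1 (fun x : cx A => re x p) h) (gen _ _ _ _ hb e)).
Qed.

(** At a zero of s, the square adds a positive multiple of |Z s|^2, so a large m makes the Laplacian
    positive where s has a gradient; this polynomial does the work of the exponential in the
    classical barrier. *)
Lemma L_barrier (s : A) (m : R) p : img i p -> s p = 0 ->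
  re (L (cxr (s + sfC At O m * (s * s)))) p =
  re (L (cxr s)) p + 2 * m * (re (evc p (Z (cxr s))) ^+ 2 + im (evc p (Z (cxr s))) ^+ 2).
Proof.
move=> ip; have Op : oset O p := ip; move=> s0.
have CD := Zc_CD f_imm i.
set c := sfC At O m.
have dc0 k : d k c = 0.
  apply: sfun_eq => q Oq; apply: etrans (sf_pdE (@Oii _ _ At i) k c Oq) _.
  apply: etrans (eq_pd k (rdom_open (oset_open O)) (g := cst m) _ (coord_rdom Oq Oq)) _.
    by move=> y [dy Oy]; exact: sfCE.
  by rewrite pd_cst; apply: esym; exact: sfun0.
have Zc0 : Z (cxr c) = 0.
  apply: etrans (Zf_real (cderD _) _ c) _; rewrite !dc0 (_ : cxr 0 = 0) //.
  by rewrite !mulr0 addr0.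
have cjs (a : A) : cjx (cxr a) = cxr a by apply: cx_eq => //=; exact: oppr0.
have Dbr (a : A) : Db cj Z (cxr a) = cjx (Z (cxr a)) by rewrite /Db cjs.
have LE : L (cxr (s + c * (s * s))) = L (cxr s) + cxr c * ((L (cxr s) * cxr s) *+ 2 +
    (Z (cxr s) * cjx (Z (cxr s))) *+ 2).
  have Lc : L (cxr c) = 0.
    by rewrite /lap comm_0 Zc0 (Db0 CD); ring.
  rewrite cxrD !cxrM (lapD CD) !(lapM CD) Lc !Dbr Zc0.
  have -> : cjx 0 = 0 :> cx A by apply: cx_eq => //=; exact: oppr0.
  ring.
have gen (l zs cc ss : cx A) : evc p cc = cxr m -> evc p ss = 0 ->
  re (l + cc * ((l * ss) *+ 2 + (zs * cjx zs) *+ 2)) p =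
  re l p + 2 * m * (re (evc p zs) ^+ 2 + im (evc p zs) ^+ 2).
  move=> c1 s1; rewrite -[LHS]/(re (evc p (l + cc * ((l * ss) *+ 2 + (zs * cjx zs) *+ 2)))).
  rewrite (evcD Op) (evcM Op) (evcD Op) !(evcMn Op) !(evcM Op) (evc_cj Op) c1 s1.
  rewrite !reimE /=; ring.
apply: etrans (congr1 (fun x : cx A => re x p) LE) _.
apply: gen; first by apply: etrans (evc_r Op _) _; rewrite (sfCE At m Op).
by apply: etrans (evc_r Op _) _; rewrite s0.
Qed.
End Chart.

Section Chart.
Variables (R : realType) (N : nat) (M : topologicalType) (At : surface_atlas R M).
Variable f : M -> 'rV[R]_N.+1.
Hypothesis f_imm : smooth_immersion_in_sphere At f.
Variable i : chart At.
Notation O := (@Oi R M At i).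
Notation A := (sfun At O).
Notation cj := (@cjx A).
Notation Z := (@Zc R N M At f f_imm i).
Notation F := (@cFc R N M At f f_imm i).
Notation d := (cder (@Oii R M At i)).
Notation rho := (fr_rho cj Z F).
Notation L := (lap cj Z rho).

Lemma d_cst c k : d k (sfC At O c) = 0.
Proof.
apply: sfun_eq => q Oq; apply: etrans (sf_pdE (@Oii _ _ At i) k _ Oq) _.
apply: etrans (eq_pd k (rdom_open (oset_open O)) (g := cst c) _ (coord_rdom Oq Oq)) _.
  by move=> y [dy Oy]; exact: sfCE.
by rewrite pd_cst; apply: esym; exact: sfun0.
Qed.

Lemma L_lin (u v : A) (m : R) p : img i p ->
  re (L (cxr (u + sfC At O m * v))) p = re (L (cxr u)) p + m * re (L (cxr v)) p.
Proof.
move=> ip; have Op : oset O p := ip; have CD := Zc_CD f_imm i.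
set c := sfC At O m.
have Zc0 : Z (cxr c) = 0.
  apply: etrans (Zf_real (cderD _) _ c) _; rewrite !d_cst (_ : cxr 0 = 0) //.
  by rewrite !mulr0 addr0.
have cjs (a : A) : cjx (cxr a) = cxr a by apply: cx_eq => //=; exact: oppr0.
have Dbr (a : A) : Db cj Z (cxr a) = cjx (Z (cxr a)) by rewrite /Db cjs.
have LE : L (cxr (u + c * v)) = L (cxr u) + cxr c * L (cxr v).
  have Lc : L (cxr c) = 0 by rewrite /lap comm_0 Zc0 (Db0 CD); ring.
  rewrite cxrD !cxrM (lapD CD) !(lapM CD) Lc !Dbr Zc0.
  have -> : cjx 0 = 0 :> cx A by apply: cx_eq => //=; exact: oppr0.
  move: (lap cj Z rho (cxr u)) (lap cj Z rho (cxr v)) (Z (cxr v)) (cxr v) (cxr c) => l l' z v' c'.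
  ring.
have gen (l ll cc : cx A) : evc p cc = cxr m -> re (l + cc * ll) p = re l p + m * re ll p.
  move=> c1; rewrite -[LHS]/(re (evc p (l + cc * ll))).
  by rewrite (evcD Op) (evcM Op) c1 reimE /=; ring.
apply: etrans (congr1 (fun x : cx A => re x p) LE) _.
by apply: gen; apply: etrans (evc_r Op _) _; rewrite (sfCE At m Op).
Qed.

Definition cw k : A := coordf (@Oii R M At i) k.

Lemma cwE k p : img i p -> cw k p = coord i p 0 k.
Proof. by move=> ip; have Op : oset O p := ip; exact: (mk_sfunE _ Op). Qed.

Lemma d_cw l k : d l (cw k) = sfC At O (l == k)%:R.
Proof.
apply: sfun_eq => q Oq; apply: etrans (sf_pdE (@Oii _ _ At i) l _ Oq) _.
apply: etrans (eq_pd l (rdom_open (oset_open O)) (g := fun y : 'rV[R]_2 => y 0 k) _ (coord_rdom Oq Oq)) _.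
  by move=> y [dy Oy]; apply: etrans (cwE k Oy) _; rewrite parK.
rewrite sfCE //; have := @derive_id R 'rV[R]_2 (coord i q) (delta_mx 0 l).
rewrite derive_mx; last exact: derivable_id.
by move=> /rowP/(_ k); rewrite !mxE eqxx eq_sym /= => <-.
Qed.

(* The barrier s vanishes at z, its gradient there is that of the sphere of
   centre y through z, and s >= 0 away from z only inside that sphere. *)
Definition sq (y : 'rV[R]_2) : A :=
  (cw 0 - sfC At O (y 0 0)) * (cw 0 - sfC At O (y 0 0)) +
  (cw 1 - sfC At O (y 0 1)) * (cw 1 - sfC At O (y 0 1)).
Definition barrier (y z : 'rV[R]_2) : A := sfC At O (nn (z - y)) - sq y - sq z.

Lemma sqE y p : img i p -> sq y p = nn (coord i p - y).
Proof.
move=> ip; have Op : oset O p := ip.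
have e k : (cw k - sfC At O (y 0 k)) p = (coord i p - y) 0 k.
  apply: etrans (sfunD _ _ Op) _; rewrite (cwE k ip) mxE; congr (_ + _).
  by apply: etrans (sfunN _ Op) _; rewrite (sfCE At _ Op) mxE.
rewrite /sq; move: (e 0) (e 1); move: (cw 0 - _) (cw 1 - _) => a b ea eb.
apply: etrans (sfunD _ _ Op) _.
apply: etrans (f_equal2 +%R (sfunM a a Op) (sfunM b b Op)) _.
by rewrite ea eb /nn !expr2.
Qed.

Lemma barrierE y z p : img i p ->
  barrier y z p = nn (z - y) - nn (coord i p - y) - nn (coord i p - z).
Proof.
move=> ip; have Op : oset O p := ip; rewrite /barrier.
have := sqE y ip; have := sqE z ip; move: (sq y) (sq z) => a b eb ea.
apply: etrans (sfunD _ _ Op) _; apply: etrans (f_equal2 +%R (sfunD _ _ Op) (sfunN _ Op)) _.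
by rewrite (sfunN _ Op) ea eb (sfCE At _ Op).
Qed.

Lemma d_barrier y z l : dom i z ->
  d l (barrier y z) (par i z) = - (z - y) 0 l *+ 2.
Proof.
move=> dz; have Op : oset O (par i z) := par_img dz.
have dNl (a : A) : d l (- a) = - d l a by exact: (dN (cderD _)).
have dsq w : d l (sq w) = (cw l - sfC At O (w 0 l)) *+ 2.
  have e k : d l (cw k - sfC At O (w 0 k)) = sfC At O (l == k)%:R.
    by rewrite cderD dNl d_cst d_cw subr0.
  have s1 : sfC At O 1 = 1 by [].
  have s0 : sfC At O 0 = 0 by [].
  rewrite /sq cderD !cderM !e.
  have [->|->] := ord2 l; rewrite /= ?eqxx /= ?(_ : (0 == 1 :> 'I_2) = false) ?(_ : (1 == 0 :> 'I_2) = false) //.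
    by rewrite mulr1n mulr0n s1 s0; ring.
  by rewrite mulr1n mulr0n s1 s0; ring.
rewrite /barrier cderD cderD !dNl d_cst !dsq.
have e (w : 'rV[R]_2) : (cw l - sfC At O (w 0 l)) (par i z) = (z - w) 0 l.
  apply: etrans (sfunD _ _ Op) _; rewrite (cwE l (par_img dz)) parK // mxE; congr (_ + _).
  by apply: etrans (sfunN _ Op) _; rewrite (sfCE At _ Op) mxE.
move: (e y) (e z); move: (cw l - _) (cw l - _) => b a ea eb.
have -> : 0 - a *+ 2 - b *+ 2 = - (a + a) - (b + b) by ring.
apply: etrans (sfunD _ _ Op) _; rewrite !(sfunN _ Op) (sfunD a a Op) (sfunD b b Op).
have z0 : (z - z) 0 l = 0 by rewrite subrr mxE.
by rewrite ea eb z0; ring.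
Qed.
End Chart.

Lemma closed_ge_fun (R : realType) (T : topologicalType) (h : T -> R) c :
  continuous h -> closed [set y | c <= h y].
Proof.
move=> ch; have -> : [set y | c <= h y] = h @^-1` [set r | c <= r] by [].
by apply: preimage_closed; [move=> y _; exact: ch|exact: closed_ge].
Qed.

Section Geometric.
Variables (R : realType) (g : 'rV[R]_2 -> R) (U : set 'rV[R]_2) (m : R).
Hypotheses (oU : open U) (cg : forall y, U y -> {for y, continuous g}).
Hypothesis gm : forall y, U y -> g y <= m.

(** g is continuous only on U; the level set is therefore obtained by removing from a closed ball
    the open set where g < m. *)
Lemma compact_level x e : (forall y, nn (y - x) <= e -> U y) ->
  compact [set y | nn (y - x) <= e /\ g y = m].
Proof.
move=> eU.
have -> : [set y | nn (y - x) <= e /\ g y = m] =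
    ~` (U `&` [set y | g y < m]) `&` [set y | nn (y - x) <= e].
  apply/seteqP; split=> y /= [a b]; split => //.
    by move=> [_ /=]; rewrite b ltxx.
  apply/eqP; rewrite eq_le gm /=; last exact: eU.
  rewrite leNgt; apply/negP => lt.
  by apply: a; split => //; exact: eU.
apply: compact_nn; apply: open_closedC; rewrite openE => y [Uy gy].
have h1 : nbhs y U by apply: open_nbhs_nbhs.
exact: filterI h1 (cvgr_lt (g y) (cg Uy) m gy).
Qed.

(* The ball around y0 is the largest one on which g < m. *)
Lemma touching_ball x : U x -> g x = m ->
  ~ (exists2 e, 0 < e & forall y, nn (y - x) < e -> g y = m) ->
  exists y0 z, [/\ U z, g z = m, z != y0 &
    forall y, nn (y - y0) < nn (z - y0) -> U y /\ g y < m].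
Proof.
move=> Ux gx nloc.
have [e e0 eU] := nbhs_nn (open_nbhs_nbhs (conj oU Ux)).
(* The point z of the level set nearest to y0 is no farther than x, and by [nnD] the factor 1/4
   keeps the whole ball around y0 inside the region [nn (y - x) <= e]. *)
have [y0 /not_implyP[y0x gy0]] : exists y0, ~ (nn (y0 - x) < e / 4 -> g y0 = m).
  apply/existsNP => h; apply: nloc; exists (e / 4) => //; lra.
pose K := [set y | nn (y - x) <= e /\ g y = m].
have K0 : K !=set0 by exists x; split => //; rewrite subrr /nn !mxE; lra.
have [z zK zmin] := compact_EVT_min K0 (compact_level eU) (continuous_subspaceT (@cont_nn R y0)).
have [zx gz] : K z by rewrite inE in zK.
have Uz := eU z zx.
have D : nn (z - y0) <= nn (y0 - x).
  rewrite -[X in _ <= X]nnN opprB; apply: (zmin x); rewrite inE; split => //.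
  by rewrite subrr /nn !mxE; lra.
have zy : z != y0.
  apply/eqP => E; apply: gy0; rewrite -E //.
exists y0, z; split => // y yz.
have yx : nn (y - x) <= e.
  have -> : y - x = (y - y0) + (y0 - x) by rewrite addrA subrK.
  apply: le_trans (nnD _ _) _; lra.
have Uy := eU y yx; split => //; rewrite lt_neqAle gm // andbT; apply/eqP => gy.
have : nn (z - y0) <= nn (y - y0) by apply: zmin; rewrite inE.
lra.
Qed.

(** On the boundary [nn (y - z) = e] the perturbed function stays below its value m at z, so its
    maximum is interior. Where S < 0 the barrier is negative, as 1 + mu S > 0. Where S >= 0 the
    point lies inside the touching ball; compactness gives g <= m - k there, and eta is so small
    that the barrier adds at most k / 2. *)
Lemma barrier_max y0 z e mu : U z -> g z = m -> 0 < e -> 0 <= mu ->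
  (forall y, nn (y - y0) < nn (z - y0) -> U y /\ g y < m) ->
  let S y := nn (z - y0) - nn (y - y0) - nn (y - z) in
  (forall y, nn (y - z) <= e -> U y /\ 0 < 1 + mu * S y) ->
  exists eta y1, [/\ 0 < eta, nn (y1 - z) < e &
    forall y, nn (y - z) < e ->
      g y + eta * (S y + mu * (S y * S y)) <= g y1 + eta * (S y1 + mu * (S y1 * S y1))].
Proof.
move=> Uz gz e0 mu0 inner S eU.
have cS : continuous S.
  have c0 : continuous (cst (nn (z - y0)) \- (fun y => nn (y - y0))).
    by move=> y; apply: continuousB; [exact: cst_continuous|exact: cont_nn].
  by move=> y; apply: (@continuousB _ _ _ (cst (nn (z - y0)) \- (fun y => nn (y - y0))) (fun y => nn (y - z))); [exact: c0|exact: cont_nn].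
have Sz : S z = 0 by rewrite /S subrr; rewrite /nn !mxE; lra.
set D := nn (z - y0); have D0 : 0 <= D := nn_ge0 _.
have SD y : S y <= D by rewrite /S -/D; have := nn_ge0 (y - y0); have := nn_ge0 (y - z); lra.
pose V := D + mu * (D * D) + 1.
have V0 : 0 < V by rewrite /V; have := mulr_ge0 mu0 (mulr_ge0 D0 D0); lra.
pose B := ([set y | e <= nn (y - z)] `&` [set y | 0 <= S y]) `&` [set y | nn (y - z) <= e].
have cB : compact B.
  apply: compact_nn; apply: closedI.
    exact: (closed_ge_fun (@cont_nn R z)).
  exact: closed_ge_fun.
have Blt y : B y -> g y < m.
  move=> [[/= a b] _]; apply: (inner y _).2; rewrite -/D; move: b; rewrite /S -/D; lra.
have [k k0 kB] : exists2 k, 0 < k & forall y, B y -> g y <= m - k.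
  have [B0|B0] := pselect (B !=set0); last by exists 1 => // y By; case: B0; exists y.
  have wB : {within B, continuous g}.
    apply: continuous_in_subspaceT => y; rewrite inE => -[_ /= h].
    by apply: cg; exact: (eU y h).1.
  have [y yB ymax] := compact_EVT_max B0 cB wB.
  exists (m - g y); first by rewrite subr_gt0; apply: Blt; rewrite inE in yB.
  by move=> y' By'; have := ymax y'; rewrite inE => /(_ By'); lra.
pose eta := k / (2 * V).
have eta0 : 0 < eta by rewrite divr_gt0 // mulr_gt0.
have etaV : eta * V = k / 2 by rewrite /eta; field; rewrite gt_eqF.
pose v y := S y + mu * (S y * S y); pose w y := g y + eta * v y.
pose C := [set: 'rV[R]_2] `&` [set y | nn (y - z) <= e].
have cC : compact C by apply: compact_nn; exact: closedT.
have C0 : C !=set0 by exists z; split => //=; rewrite subrr /nn !mxE; lra.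
have cv : continuous v.
  have c1 : continuous (cst mu \* (S \* S)).
    by move=> y; apply: continuousM; [exact: cst_continuous|apply: continuousM; exact: cS].
  by move=> y; apply: (@continuousD _ _ _ S (cst mu \* (S \* S))); [exact: cS|exact: c1].
have wC : {within C, continuous w}.
  apply: continuous_in_subspaceT => y; rewrite inE => -[_ /= h].
  apply: (@continuousD _ _ _ g (cst eta \* v)); first by apply: cg; exact: (eU y h).1.
  by apply: continuousM; [exact: cst_continuous|exact: cv].
have [y1 y1C y1max] := compact_EVT_max C0 cC wC.
have [_ /= y1e] : C y1 by rewrite inE in y1C.
exists eta, y1; split => //; last first.
  by move=> y ye; apply: y1max; rewrite inE; split => //=; exact: ltW.
rewrite lt_neqAle y1e andbT; apply/eqP => E.
have : m <= w y1.
  have -> : m = w z by rewrite /w /v Sz gz; ring.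
  by apply: y1max; rewrite inE; split => //=; rewrite subrr /nn !mxE; lra.
have [Uy1 mS] := eU y1 y1e.
have [S0|S0] := leP 0 (S y1).
  have gk : g y1 <= m - k by apply: kB; split => //; split => //=; rewrite E.
  have vV : v y1 <= V.
    rewrite /v /V; have := SD y1; have : mu * (S y1 * S y1) <= mu * (D * D) by apply: ler_wpM2l => //; apply: ler_pM.
    by lra.
  have : eta * v y1 <= eta * V by rewrite ler_pM2l.
  by rewrite etaV /w; lra.
have v0 : v y1 < 0.
  have -> : v y1 = S y1 * (1 + mu * S y1) by rewrite /v; ring.
  by rewrite nmulr_rlt0.
have : eta * v y1 < 0 by rewrite pmulr_rlt0.
by have := gm Uy1; rewrite /w; lra.
Qed.
End Geometric.

Lemma perturbed_pos (R : realType) (a b c e : R) : 0 < e ->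
  a = b + e * c -> a <= 0 -> 0 <= b -> 0 < c -> False.
Proof.
move=> e0 -> h1 h2 h3; have : 0 < e * c by rewrite mulr_gt0.
lra.
Qed.

Section Chart.
Variables (R : realType) (N : nat) (M : topologicalType) (At : surface_atlas R M).
Variable f : M -> 'rV[R]_N.+1.
Hypothesis f_imm : smooth_immersion_in_sphere At f.
Variable i : chart At.
Notation O := (@Oi R M At i).
Notation A := (sfun At O).
Notation cj := (@cjx A).
Notation Z := (@Zc R N M At f f_imm i).
Notation F := (@cFc R N M At f f_imm i).
Notation rho := (fr_rho cj Z F).
Notation L := (lap cj Z rho).

Lemma sfun_par_cont (a : A) y : dom i y -> {for y, continuous (a \o par i)}.
Proof.
move=> dy; apply: (smooth_continuous (sfun_sm a i)); split => //; exact: par_img.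
Qed.

Lemma sfun_near_gt (a : A) c y : dom i y -> c < a (par i y) ->
  \forall x \near y, c < a (par i x).
Proof. by move=> dy h; exact: (cvgr_gt (a (par i y)) (sfun_par_cont (a := a) dy) c h). Qed.

Lemma barrier_grad (y0 z : 'rV[R]_2) : dom i z -> z != y0 ->
  0 < re (evc (par i z) (Z (cxr (barrier i y0 z)))) ^+ 2
    + im (evc (par i z) (Z (cxr (barrier i y0 z)))) ^+ 2.
Proof.
move=> dz zy; set p := par i z; have ip : img i p := par_img dz.
rewrite lt_neqAle addr_ge0 ?sqr_ge0 // andbT eq_sym.
rewrite paddr_eq0 ?sqr_ge0 // !sqrf_eq0; apply/negP => /andP[/eqP a /eqP b].
have e : evc p (Z (cxr (barrier i y0 z))) = 0 by apply: cx_eq.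
have h l : (z - y0) 0 l = 0.
  have := etrans (esym (d_barrier y0 l dz)) (frame_nondeg l ip e).
  by move: ((z - y0) 0 l) => t; lra.
by move: zy; rewrite -subr_eq0 => /eqP; apply; apply/rowP => l; rewrite h mxE.
Qed.

(** Otherwise some ball touches the level set from outside at z. Adding a small multiple of the
    barrier produces an interior maximum near z, where the Laplacian of the sum is positive; this
    contradicts [chart_max]. *)
Lemma hopf_local (u : A) (m : R) (U : set 'rV[R]_2) x : open U -> U `<=` dom i ->
  U x -> (forall y, U y -> u (par i y) <= m) -> u (par i x) = m ->
  (forall y, U y -> 0 <= re (L (cxr u)) (par i y)) ->
  exists2 e, 0 < e & forall y, nn (y - x) < e -> u (par i y) = m.
Proof.
move=> oU Ud Ux um ux Lu; apply: contrapT => nloc.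
have cu y : U y -> {for y, continuous (u \o par i)} by move=> Uy; apply/sfun_par_cont/Ud.
have [y0 [z [Uz gz zy inner]]] := touching_ball oU cu um Ux ux nloc.
have dz : dom i z := Ud z Uz; set p := par i z; have ip : img i p := par_img dz.
pose s := barrier i y0 z.
pose q := re (evc p (Z (cxr s))) ^+ 2 + im (evc p (Z (cxr s))) ^+ 2.
have q0 : 0 < q by exact: barrier_grad.
(* With this mu the added term 2 mu q equals 2 (|l| + 1) and outweighs [l]. *)
pose l := re (L (cxr s)) p; pose mu := (`|l| + 1) / q.
have mu0 : 0 <= mu by apply: divr_ge0; [apply: addr_ge0|exact: ltW].
pose v := s + sfC At O mu * (s * s).
have sE y : dom i y -> s (par i y) = nn (z - y0) - nn (y - y0) - nn (y - z).
  by move=> dy; apply: etrans (barrierE _ _ (par_img dy)) _; rewrite parK.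
have sz : s p = 0 by rewrite sE // subrr [X in _ - X](_ : _ = 0) ?subr0 // /nn !mxE; ring.
have vE y : dom i y -> v (par i y) = s (par i y) + mu * (s (par i y) * s (par i y)).
  move=> dy; have Oy : oset O (par i y) := par_img dy.
  apply: etrans (sfunD s (sfC At O mu * (s * s)) Oy) _; congr (_ + _).
  apply: etrans (sfunM (sfC At O mu) (s * s) Oy) _.
  by rewrite (sfCE At mu Oy) (sfunM s s Oy).
have Lv : 0 < re (L (cxr v)) p.
  have -> : re (L (cxr v)) p = l + 2 * mu * q by exact: L_barrier.
  have -> : l + 2 * mu * q = l + 2 * (`|l| + 1) by rewrite /mu; field; rewrite gt_eqF.
  have := ler_norm (- l); rewrite normrN; have := normr_ge0 l; lra.
have nU : nbhs z U by apply: open_nbhs_nbhs.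
have nL : \forall y \near z, 0 < re (L (cxr v)) (par i y).
  exact: sfun_near_gt dz Lv.
(* The lower bound keeps 1 + mu s positive, as [barrier_max] requires. *)
have nS : \forall y \near z, - (mu + 1)^-1 < s (par i y).
  apply: (@sfun_near_gt s _ z dz).
  by rewrite -/p sz oppr_lt0 invr_gt0 ltr_wpDl.
have [e e0 eU] := nbhs_nn (filterI nU (filterI nL nS)).
have eU' y : nn (y - z) <= e -> U y /\ 0 < 1 + mu * (nn (z - y0) - nn (y - y0) - nn (y - z)).
  move=> /eU[Uy [_ h]]; split => //; rewrite -sE; last exact: Ud.
  have m1 : 0 < mu + 1 by rewrite ltr_wpDl.
  have i1 : (mu + 1) * (mu + 1)^-1 = 1 by rewrite divff // gt_eqF.
  have i0 : 0 < (mu + 1)^-1 by rewrite invr_gt0.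
  move: h i1 i0; move: ((mu + 1)^-1) (s _) => a b h i1 i0.
  have : mu * (- a) <= mu * b by rewrite ler_wpM2l // ltW.
  by lra.
have [eta [y1 [eta0 y1e y1max]]] := barrier_max cu um Uz gz e0 mu0 inner eU'.
have [Uy1 [Lv1 _]] := eU y1 (ltW y1e).
have dy1 := Ud _ Uy1.
pose w := u + sfC At O eta * v.
have wE y : dom i y -> w (par i y) = u (par i y) + eta * v (par i y).
  move=> dy; have Oy : oset O (par i y) := par_img dy.
  apply: etrans (sfunD u (sfC At O eta * v) Oy) _; congr (_ + _).
  by apply: etrans (sfunM (sfC At O eta) v Oy) _; rewrite (sfCE At eta Oy).
have [||||_] := @chart_max R N M At f f_imm i [set y | nn (y - z) < e] w (par i y1) (par_img dy1).
- exact: open_nn.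
- by move=> y /= h; apply: Ud; exact: (eU y (ltW h)).1.
- by rewrite parK.
- move=> y /= h; have dy : dom i y by apply: Ud; exact: (eU y (ltW h)).1.
  by rewrite !wE // !vE // !sE //; exact: y1max.
move=> hw; have E : re (L (cxr w)) (par i y1) = _ := L_lin f_imm u v eta (par_img dy1).
exact: perturbed_pos eta0 E hw (Lu y1 Uy1) Lv1.
Qed.
End Chart.

(** * Maximum principles on the closed surface *)

Section Maximum.
Variables (R : realType) (N : nat) (M : topologicalType) (At : surface_atlas R M).
Hypothesis M_closed : closed_surface M.
Variable f : M -> 'rV[R]_N.+1.
Hypothesis f_imm : smooth_immersion_in_sphere At f.
Notation cj i := (@cjx (sfun At (@Oi R M At i))).
Notation Z i := (@Zc R N M At f f_imm i).
Notation cF' i := (@cFc R N M At f f_imm i).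
Notation rho i := (fr_rho (cj i) (Z i) (cF' i)).
Notation L i := (lap (cj i) (Z i) (rho i)).

Lemma gl_continuous X : invariant f_imm X -> continuous (gl X).
Proof.
by move=> iX p; apply: (@msmooth_continuous R M At setT (gl X) p openT (gl_smooth iX)).
Qed.

Lemma gl_max X : invariant f_imm X -> exists p, forall q, gl X q <= gl X p.
Proof.
move=> iX; have [M0 _ cM _] := M_closed.
have [p _ pm] := compact_EVT_max M0 cM (continuous_subspaceT (gl_continuous iX)).
by exists p => q; apply: pm; rewrite inE.
Qed.

Lemma gl_par X i : invariant f_imm X -> forall y, dom i y -> gl X (par i y) = re (X i) (par i y).
Proof. by move=> iX y dy; apply: (gl_chart iX); exact: par_img. Qed.

Lemma real_cxr i (x : cx (sfun At (@Oi R M At i))) : im x = 0 -> x = cxr (re x).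
Proof. by move=> h; apply: cx_eq. Qed.

Lemma max_test X p i : invariant f_imm X -> im (X i) = 0 -> img i p ->
  (forall q, gl X q <= gl X p) -> evc p (Z i (X i)) = 0 /\ re (L i (X i)) p <= 0.
Proof.
move=> iX rX ip pm; rewrite (real_cxr rX).
have [||||a b] := @chart_max R N M At f f_imm i (dom i) (re (X i)) p ip; last by split.
- exact: dom_open.
- by [].
- exact: coord_dom.
- by move=> y dy; rewrite -gl_par // -(gl_chart iX ip).
Qed.

(** Subharmonicity is available only above the level c0, and the maximum lies above it. Near a
    maximum point [hopf_local] applies on the open set where X > c0, so the set of maximum points is
    open; it is closed and nonempty, and M is connected. *)
Lemma strong_max X (c0 : R) : invariant f_imm X -> (forall i, im (X i) = 0) ->
  (forall i p, img i p -> c0 < re (X i) p -> 0 <= re (L i (X i)) p) ->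
  (exists p, c0 < gl X p) -> forall p q, gl X p = gl X q.
Proof.
move=> iX rX LX [p0 p0c]; have [m mm] := gl_max iX.
suff E : [set q | gl X q = gl X m] = setT.
  have h p : gl X p = gl X m.
    by have : [set: M] p by []; rewrite -E.
  by move=> p q; rewrite !h.
have [_ _ _ coM] := M_closed.
have mc : c0 < gl X m := lt_le_trans p0c (mm p0).
apply: coM; first by exists m.
  exists [set q | gl X q = gl X m]; last by rewrite setTI.
  rewrite openE => q qE; pose i := chart_at At q; have iq : img i q by exact: chart_atP.
  pose U : set 'rV[R]_2 := rdom i [set p | c0 < gl X p].
  have oU : open U.
    apply: rdom_open; apply: (open_comp (f := gl X) (D := [set r | c0 < r])) => //.
    by move=> y _; exact: gl_continuous.
  have Ud : U `<=` dom i by move=> y [].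
  have Uq : U (coord i q) by apply: coord_rdom => //=; rewrite qE.
  have [|||e e0 eU] := @hopf_local R N M At f f_imm i (re (X i)) (gl X m) U _ oU Ud Uq.
  - by move=> y /Ud dy; rewrite -gl_par.
  - by rewrite -gl_par ?coordK //; exact: coord_dom.
  - move=> y [dy yc]; rewrite -(real_cxr (rX i)); apply: (LX i _ (par_img dy)).
    by rewrite -(gl_par iX dy).
  have n1 : nbhs q (img i) by apply: open_nbhs_nbhs; split => //; exact: image_open.
  have n2 : nbhs q (coord i @^-1` [set y | nn (y - coord i q) < e]).
    apply: (coord_continuous iq); apply: open_nbhs_nbhs; split; first exact: open_nn.
    by rewrite /= subrr /nn !mxE expr0n addr0.
  apply: filterS (filterI n1 n2) => p [ip /= pe].
  by rewrite (gl_chart iX ip) -(coordK ip); exact: eU.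
exists [set q | gl X q = gl X m]; last by rewrite setTI.
apply: (preimage_closed (f := gl X) (D := [set r | r = gl X m])); last exact: closed_eq.
by move=> y _; exact: gl_continuous.
Qed.

Lemma weak_max X : invariant f_imm X -> (forall i, im (X i) = 0) ->
  exists p, [/\ forall q, gl X q <= gl X p,
    forall i, img i p -> evc p (Z i (X i)) = 0 &
    forall i, img i p -> re (L i (X i)) p <= 0].
Proof.
move=> iX rX; have [p pm] := gl_max iX; exists p; split => // i ip;
  by have [] := max_test iX (rX i) ip pm.
Qed.
End Maximum.

(** * Global argument *)

Lemma max_nonpos (R : realFieldType) (l k q d : R) :
  l = 2 * k * q + d -> l <= 0 -> 0 < k -> 0 <= d -> q <= 0.
Proof.
move=> -> h1 k0 d0; rewrite leNgt; apply/negP => qp.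
have : 0 < k * q by rewrite mulr_gt0.
lra.
Qed.

Section Norm.
Variables (R : realType) (N : nat) (M : topologicalType) (At : surface_atlas R M).
Hypothesis M_closed : closed_surface M.
Variable f : M -> 'rV[R]_N.+1.
Hypothesis f_imm : smooth_immersion_in_sphere At f.
Hypothesis H_par : parallel_mean_curvature At f.
Notation AA W := (sfun At W).
Notation cj W := (@cjx (sfun At W)).
Notation Z i := (@Zc R N M At f f_imm i).
Notation cF' i := (@cFc R N M At f f_imm i).
Notation Oc i := (@Oi R M At i).
Notation rho i := (fr_rho (cj (Oc i)) (Z i) (cF' i)).
Notation L i := (lap (cj (Oc i)) (Z i) (rho i)).
Notation tI := (@tI R N M At f f_imm).
Notation hhI := (@hhI R N M At f f_imm).
Notation QI := (@QI R N M At f f_imm).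
Notation invariant := (@invariant R N M At f f_imm).

Lemma inv_mul X Y : invariant X -> invariant Y -> invariant (fun i => X i * Y i).
Proof.
move=> iX iY V j Vj; have [x hx] := iX V j Vj; have [y hy] := iY V j Vj.
by exists (x * y) => i th lam FM th1 thF thc; rewrite (thM FM) (hx i th lam FM th1 thF thc) (hy i th lam FM th1 thF thc).
Qed.
Lemma inv_add X Y : invariant X -> invariant Y -> invariant (fun i => X i + Y i).
Proof.
move=> iX iY V j Vj; have [x hx] := iX V j Vj; have [y hy] := iY V j Vj.
by exists (x + y) => i th lam FM th1 thF thc; rewrite (thD FM) (hx i th lam FM th1 thF thc) (hy i th lam FM th1 thF thc).
Qed.
Lemma inv_opp X : invariant X -> invariant (fun i => - X i).
Proof.
move=> iX V j Vj; have [x hx] := iX V j Vj.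
by exists (- x) => i th lam FM th1 thF thc; rewrite (thN FM) (hx i th lam FM th1 thF thc).
Qed.
Lemma inv_Mn X k : invariant X -> invariant (fun i => X i *+ k).
Proof.
move=> iX V j Vj; have [x hx] := iX V j Vj.
by exists (x *+ k) => i th lam FM th1 thF thc; rewrite (thMn FM) (hx i th lam FM th1 thF thc).
Qed.

Lemma im_real i (x : cx (AA (Oc i))) : cjx x = x -> im x = 0.
Proof. by move=> /(cx_real (@sfun_half _ _ At (Oc i))) ->. Qed.

Lemma hhI_real i : im (hhI i) = 0.
Proof.
apply: im_real.
by apply: etrans (cj_dot (Zc_CD f_imm i) _ _) _; rewrite (HI_real f_imm i).
Qed.

Lemma lap_hh i : L i (hhI i) = 0.
Proof.
rewrite /lap comm_0 (chart_Dhh f_imm H_par i) (Db0 (Zc_CD f_imm i)); ring.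
Qed.

Lemma hh_const p q : gl hhI p = gl hhI q.
Proof.
(* The Laplacian of |H|^2 is zero everywhere; the level - 1 is chosen below the nonnegative
   function. *)
apply: (strong_max M_closed (c0 := -1) (@hhI_inv R N M At f f_imm) hhI_real).
  move=> i x ix _; have Ox : oset (Oc i) x := ix.
  have gen (a : R) : a = 0 -> 0 <= a by move=> ->.
  exact: gen (etrans (congr1 (fun y : cx (AA (Oc i)) => re y x) (lap_hh i)) (sfun0 At Ox)).
by exists p; apply: lt_le_trans (hh_ge0 f_imm p); rewrite ltrN10.
Qed.

Variable h0 : R.
Hypothesis hhE : forall p, gl hhI p = h0.
Hypothesis t_pos : forall p, 0 < gl tI p.
Hypothesis t_lt : forall p, gl tI p < 1 + h0.

Lemma QI_real i : im (QI i) = 0.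
Proof.
have gen (q : cx (AA (Oc i))) : im (q * cjx q) = 0 by rewrite /=; ring.
exact: gen.
Qed.

Lemma Q_zero i : fr_Q (cj (Oc i)) (Z i) (cF' i) = 0.
Proof.
have iQ := @QI_inv R N M At f f_imm.
have [p [pm _ pl]] := weak_max M_closed iQ QI_real.
set i0 := chart_at At p; have ip : img i0 p by exact: chart_atP.
have Op : oset (Oc i0) p := ip.
have lq := pl i0 ip.
have lE := congr1 (fun x : cx (AA (Oc i0)) => re x p) (chart_lapQ f_imm H_par i0).
have hp : re (hhI i0) p = h0 := etrans (esym (gl_chart (@hhI_inv R N M At f f_imm) ip)) (hhE p).
have tp : re (tI i0) p = gl tI p := esym (gl_chart (@tI_inv R N M At f f_imm) ip).
have gen (hh t q d : cx (AA (Oc i0))) : im hh = 0 -> im t = 0 ->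
  re ((1 + hh - t) *+ 2 * (q * cjx q) + d * cjx d) p =
  2 * (1 + re hh p - re t p) * (re (evc p q) ^+ 2 + im (evc p q) ^+ 2)
  + (re (evc p d) ^+ 2 + im (evc p d) ^+ 2).
  move=> h1 h2; have e1 : hh = cxr (re hh) by exact: cx_eq.
  have e2 : t = cxr (re t) by exact: cx_eq.
  rewrite -[LHS]/(re (evc p ((1 + hh - t) *+ 2 * (q * cjx q) + d * cjx d))) e1 e2.
  rewrite !((evcD Op), (evcM Op), (evcMn Op), (evcN Op), (evc1 At Op), (evc_cj Op), (evc_r Op)).
  by rewrite !reimE /=; ring.
have tr : im (tI i0) = 0 by apply: im_real; exact: (cj_hm (Zc_CD f_imm i0)).
have {}lE := etrans lE (gen _ _ _ _ (hhI_real i0) tr).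
have q0 : gl QI p <= 0.
  have qE : gl QI p = re (evc p (fr_Q (cj (Oc i0)) (Z i0) (cF' i0))) ^+ 2
     + im (evc p (fr_Q (cj (Oc i0)) (Z i0) (cF' i0))) ^+ 2.
    have genq (q : cx (AA (Oc i0))) : re (q * cjx q) p = re (evc p q) ^+ 2 + im (evc p q) ^+ 2.
      rewrite -[LHS]/(re (evc p (q * cjx q))) (evcM Op) (evc_cj Op) /=; ring.
    exact: etrans (gl_chart iQ ip) (genq _).
  have gk (a b : R) : a = h0 -> b = gl tI p -> 0 < 1 + a - b.
    by move=> -> ->; rewrite subr_gt0; exact: t_lt.
  have gq (a b : R) : a = b -> b <= 0 -> a <= 0 by move=> ->.
  exact: gq qE (max_nonpos lE lq (gk _ _ hp tp) (addr_ge0 (sqr_ge0 _) (sqr_ge0 _))).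
have z q : img i q -> re (QI i) q <= 0.
  move=> iq; have gle (a b : R) : a = b -> a <= 0 -> b <= 0 by move=> ->.
  exact: gle (gl_chart iQ iq) (le_trans (pm q) q0).
have genz (x : cx (AA (Oc i))) : (forall q, img i q -> re (x * cjx x) q <= 0) -> x = 0.
  move=> h; suff hx q : img i q -> evc q x = 0.
    apply: cx_eq; apply: sfun_eq => q Oq; apply: etrans _ (esym (sfun0 At Oq)).
      exact: (congr1 (@re R) (hx q Oq)).
    exact: (congr1 (@im R) (hx q Oq)).
  move=> iq; have Oq : oset (Oc i) q := iq.
  have := h q iq; rewrite -[X in X <= 0 -> _]/(re (evc q (x * cjx x))) (evcM Oq) (evc_cj Oq).
  move: (evc q x) => y /= h1.
  have : re y ^+ 2 + im y ^+ 2 <= 0.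
    by apply: le_trans h1; rewrite le_eqVlt; apply/orP; left; apply/eqP; ring.
  move=> h2; have : re y ^+ 2 + im y ^+ 2 == 0 by rewrite eq_le h2 addr_ge0 ?sqr_ge0.
  rewrite paddr_eq0 ?sqr_ge0 // !sqrf_eq0 => /andP[/eqP a /eqP b].
  exact: cx_eq.
exact: genz.
Qed.

End Norm.

Section Norm2.
Variables (R : realType) (N : nat) (M : topologicalType) (At : surface_atlas R M).
Hypothesis M_closed : closed_surface M.
Variable f : M -> 'rV[R]_N.+1.
Hypothesis f_imm : smooth_immersion_in_sphere At f.
Hypothesis H_par : parallel_mean_curvature At f.
Notation AA W := (sfun At W).
Notation cj W := (@cjx (sfun At W)).
Notation Z i := (@Zc R N M At f f_imm i).
Notation cF' i := (@cFc R N M At f f_imm i).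
Notation Oc i := (@Oi R M At i).
Notation tI := (@tI R N M At f f_imm).
Notation hhI := (@hhI R N M At f f_imm).
Notation invariant := (@invariant R N M At f f_imm).

Variable h0 : R.
Hypothesis h0_ge0 : 0 <= h0.
Hypothesis hhE : forall p, gl hhI p = h0.
Hypothesis tb : forall p, 5 / 6 * (1 + h0) <= gl tI p <= 9 / 10 * (1 + h0).

Let c0 : 0 < 1 + h0. Proof. by rewrite ltr_pwDl. Qed.
Definition kc : R := (Num.sqrt (1 + h0))^-1.
Lemma kc_gt0 : 0 < kc. Proof. by rewrite invr_gt0 sqrtr_gt0. Qed.
Lemma kcK : kc ^+ 2 * (1 + h0) = 1.
Proof. by rewrite /kc exprVn sqr_sqrtr ?(ltW c0) // mulVf // gt_eqF. Qed.

Definition kap W : cx (AA W) := cxr (sfC At W kc).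
Lemma kap_real W : cj W (kap W) = kap W.
Proof. by apply: cx_eq => //=; exact: oppr0. Qed.
Lemma D_kap i : Z i (kap (Oc i)) = 0.
Proof.
apply: etrans (Zf_real (cderD _) _ _) _; rewrite !d_cst (_ : cxr 0 = 0) //.
by rewrite !mulr0 addr0.
Qed.

Lemma t_lt p : gl tI p < 1 + h0.
Proof. by case/andP: (tb p) => _ h; apply: le_lt_trans h _; rewrite gtr_pMl //; lra. Qed.

Lemma Q0 i : fr_Q (cj (Oc i)) (Z i) (cF' i) = 0.
Proof. exact: (Q_zero M_closed H_par hhE t_lt). Qed.

Lemma kapK i : kap (Oc i) ^+ 2 * (1 + fr_hh (cj (Oc i)) (Z i) (cF' i)) = 1.
Proof.
have gen (hh : cx (AA (Oc i))) : im hh = 0 -> (forall p, img i p -> re hh p = h0) ->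
    kap (Oc i) ^+ 2 * (1 + hh) = 1.
  move=> hi hr; have -> : hh = cxr (sfC At (Oc i) h0).
    apply: cx_eq => //=; apply: sfun_eq => p Op; rewrite (sfCE At h0 Op); exact: hr.
  have -> : 1 = cxr 1 :> cx (AA (Oc i)) by apply: cx_eq.
  rewrite -cxrD expr2 -!cxrM; congr cxr; apply: sfun_eq => p Op.
  rewrite (sfunM _ _ Op) (sfunM _ _ Op) (sfunD _ _ Op) (sfCE At _ Op) (sfCE At _ Op) (sfun1 At Op).
  by rewrite -expr2 kcK.
apply: gen; first exact: (hhI_real f_imm i).
by move=> p ip; exact: etrans (esym (gl_chart (@hhI_inv R N M At f f_imm) ip)) (hhE p).
Qed.

Definition qt i := kt (cj (Oc i)) (Z i) (kap (Oc i)) (cF' i).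
Definition qti i := kti (cj (Oc i)) (Z i) (kap (Oc i)) (cF' i).
Definition qr i := kr (cj (Oc i)) (Z i) (kap (Oc i)) (cF' i).
Definition qri i := kri (cj (Oc i)) (Z i) (kap (Oc i)) (cF' i).
Definition qN i := kN (cj (Oc i)) (Z i) (kap (Oc i)) (cF' i).
Definition qtau i := ktau (cj (Oc i)) (Z i) (kap (Oc i)) (cF' i).

Lemma im_qt i : im (qt i) = 0.
Proof. by apply: im_real; exact: (kt_real _ _ (Zc_CD f_imm i)). Qed.
Lemma im_qr i : im (qr i) = 0.
Proof. by apply: im_real; exact: (kr_real _ _ (Zc_CD f_imm i)). Qed.
Lemma im_qN i : im (qN i) = 0.
Proof. by apply: im_real; exact: (kN_real _ _ (Zc_CD f_imm i)). Qed.
Lemma im_qtau i : im (qtau i) = 0.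
Proof. by apply: im_real; exact: (ktau_real _ _ (Zc_CD f_imm i)). Qed.

Lemma qt_inv : invariant qt.
Proof.
move=> V j Vj; exists (kt (cj V) (ovD f_imm Vj) (kap V) (ovF f_imm V)) => i th lam FM th1 thF thc.
exact: (esym (th_kt (ovD_CD f_imm Vj) FM (esym thF) (f1c_unit f_imm i) th1 (esym (thc _)))).
Qed.

Lemma qt_val p : gl qt p = gl tI p / (1 + h0).
Proof.
set i := chart_at At p; have ip : img i p by exact: chart_atP.
have Op : oset (Oc i) p := ip.
have e : qt i = kap (Oc i) ^+ 2 * tI i.
  exact: (ktE (cF' i) (Zc_CD f_imm i) (kap_real (Oc i))).
have gen (x : cx (AA (Oc i))) : re (kap (Oc i) ^+ 2 * x) p = kc ^+ 2 * re x p.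
  rewrite -[LHS]/(re (evc p (kap (Oc i) ^+ 2 * x))) !expr2 !(evcM Op) (evc_r Op) (sfCE At kc Op).
  by rewrite !reimE /=; ring.
have kE : kc ^+ 2 = (1 + h0)^-1 by apply: (mulIf (lt0r_neq0 c0)); rewrite kcK mulVf // gt_eqF.
apply: etrans (congr1 (fun x : cx (AA (Oc i)) => re x p) e) _.
by apply: etrans (gen _) _; rewrite kE mulrC.
Qed.

Lemma qt_b p : 5 / 6 <= gl qt p <= 9 / 10.
Proof. by rewrite qt_val ler_pdivlMr // ler_pdivrMr. Qed.

Lemma inv_pos X i : invariant X -> im (X i) = 0 -> (forall p, gl X p != 0) ->
  exists y, X i * y = 1.
Proof.
move=> iX rX pX; have [|b ab] := @sfun_inv R M At (Oc i) (re (X i)).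
  move=> p Op; apply/eqP => e; move/eqP: (pX p); apply.
  exact: etrans (gl_chart iX Op) e.
exists (cxr b); rewrite (real_cxr rX) -cxrM ab; exact: cx_eq.
Qed.

Lemma qtK i : exists ti, qt i * ti = 1.
Proof.
apply: (inv_pos qt_inv (im_qt i)) => p; rewrite gt_eqF //.
by case/andP: (qt_b p) => h _; apply: lt_le_trans h; lra.
Qed.

Lemma im_qti i : im (qti i) = 0.
Proof. by apply: im_real; exact: (kti_real (Zc_CD f_imm i) (qtK i)). Qed.

Lemma qti_inv : invariant qti.
Proof.
move=> V j Vj; exists (kti (cj V) (ovD f_imm Vj) (kap V) (ovF f_imm V)) => i th lam FM th1 thF thc.
exact: (esym (th_kti (ovD_CD f_imm Vj) FM (esym thF) (f1c_unit f_imm i) th1 (esym (thc _)) (qtK i))).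
Qed.
Lemma qr_inv : invariant qr.
Proof.
move=> V j Vj; exists (kr (cj V) (ovD f_imm Vj) (kap V) (ovF f_imm V)) => i th lam FM th1 thF thc.
exact: (esym (th_kr (ovD_CD f_imm Vj) FM (esym thF) (f1c_unit f_imm i) th1 (esym (thc _)) (qtK i))).
Qed.
Lemma qN_inv : invariant qN.
Proof.
move=> V j Vj; exists (kN (cj V) (ovD f_imm Vj) (kap V) (ovF f_imm V)) => i th lam FM th1 thF thc.
exact: (esym (th_kN (ovD_CD f_imm Vj) FM (esym thF) (f1c_unit f_imm i) th1 (esym (thc _)) (qtK i))).
Qed.

(** [qri] inverts [qr], and [qtau] is built from it; both are transported by changes of frame once r
    has no zero. *)
Section Positive.
Hypothesis qr_gt0 : forall p, 0 < gl qr p.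

Lemma qrK i : exists ri, qr i * ri = 1.
Proof.
by apply: (inv_pos qr_inv (im_qr i)) => p; rewrite gt_eqF.
Qed.
Lemma im_qri i : im (qri i) = 0.
Proof. by apply: im_real; exact: (kri_real (Zc_CD f_imm i) (qrK i)). Qed.
Lemma qri_inv : invariant qri.
Proof.
move=> V j Vj; exists (kri (cj V) (ovD f_imm Vj) (kap V) (ovF f_imm V)) => i th lam FM th1 thF thc.
exact: (esym (th_kri (ovD_CD f_imm Vj) FM (esym thF) (f1c_unit f_imm i) th1 (esym (thc _)) (qtK i) (qrK i))).
Qed.
Lemma qtau_inv : invariant qtau.
Proof.
move=> V j Vj; exists (ktau (cj V) (ovD f_imm Vj) (kap V) (ovF f_imm V)) => i th lam FM th1 thF thc.
exact: (esym (th_ktau (ovD_CD f_imm Vj) FM (esym thF) (f1c_unit f_imm i) th1 (esym (thc _)) (qtK i) (qrK i))).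
Qed.
End Positive.
End Norm2.

(** * Numerical consequences of the oscillation bound *)

Section Arith.
Variable R : realFieldType.
Implicit Types t r N s : R.

(** t and r are the values at a maximum of t^3 r, s and u those at an arbitrary point. At the
    maximum r <= 9/10 t, and passing to the other point costs a factor t^4 / s^4 close to 1. *)
Lemma arith_ratio t r s u : 5 / 6 <= t <= 9 / 10 -> 5 / 6 <= s -> t - s <= 1 / 420 ->
  0 <= r -> s * (s * (s * u)) <= t * (t * (t * r)) ->
  (0 < r -> 9 * t - 12 * t ^+ 2 + 2 * r <= 0) -> u <= 23 / 25 * s.
Proof.
move=> /andP[tl tu] sl ts r0 h hr.
have s0 : 0 < s by lra.
have t0 : 0 < t by lra.
(* The condition at the maximum reads 2 r <= t (12 t - 9), and 12 t - 9 <= 9/5. *)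
have rt : r <= 9 / 10 * t.
  have [rp|] := ltP 0 r; last by lra.
  by have := hr rp; rewrite expr2; nra.
(* 1/420 is 5/6 of 1/350, and s >= 5/6. Below, the square of 351/350 is rounded up to 101/100, and
   9/10 times the square of 101/100 is less than 23/25. *)
have tk : t <= 351 / 350 * s by lra.
have e1 : t * (t * (t * r)) <= (9 / 10) * (t * t * (t * t)).
  have := ler_wpM2l (ltW (mulr_gt0 t0 (mulr_gt0 t0 t0))) rt; lra.
have t2 : t * t <= 101 / 100 * (s * s).
  apply: le_trans (ler_pM (ltW t0) (ltW t0) tk tk) _.
  by have := mulr_gt0 s0 s0; lra.
have t4 : t * t * (t * t) <= (101 / 100 * (s * s)) * (101 / 100 * (s * s)).
  by apply: ler_pM => //; rewrite mulr_ge0 // ltW.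
have s4 : 0 < s * s * (s * s) by rewrite !mulr_gt0.
have : s * (s * (s * u)) <= s * (s * (s * (23 / 25 * s))) by lra.
by rewrite !ler_pM2l.
Qed.

(** Unprimed values are those at the maximum of N + 6 r + 8 t. There r <= 207/250, so 4 + 6 r plus
    8/420 stays below 10. *)
Lemma arith_N t r N t' r' N' : 5 / 6 <= t <= 9 / 10 -> t - t' <= 1 / 420 -> 0 <= r' ->
  r <= 23 / 25 * t -> N <= 4 -> N' + r' *+ 6 + t' *+ 8 <= N + r *+ 6 + t *+ 8 -> N' <= 10.
Proof. by move=> /andP[tl tu] ts r0 rt N4 h; lra. Qed.

(** The primed point is a zero of r, the other one a minimum of r + 50 t; 50/420 is just below
    12/100. *)
Lemma arith_r t r t' r' : t' - t <= 1 / 420 -> r' <= 0 ->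
  - (r' + t' *+ 50) <= - (r + t *+ 50) -> r <= 12 / 100.
Proof. by move=> ts r0 h; lra. Qed.

Lemma arith_w t w k l : t <= 9 / 10 -> 0 < w -> 0 < k ->
  w ^+ 2 * (9 - 10 * t) <= w * (k ^+ 2 * l) -> 0 <= l.
Proof.
move=> tu w0 k0 h; have := le_trans (mulr_ge0 (sqr_ge0 w) _) h.
have -> : 0 <= 9 - 10 * t by lra.
by move=> /(_ isT); rewrite pmulr_rge0 // pmulr_rge0 // exprn_gt0.
Qed.

Lemma arith_w' t w k l : t <= 9 / 10 -> 0 < w -> l <= 0 ->
  w ^+ 2 * (9 - 10 * t) <= w * (k ^+ 2 * l) -> t = 9 / 10.
Proof.
move=> tu w0 l0 h; have h1 : w * (k ^+ 2 * l) <= 0.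
  by rewrite pmulr_rle0 // mulr_ge0_le0 // sqr_ge0.
have := le_trans h h1; rewrite pmulr_rle0 ?exprn_gt0 //; lra.
Qed.

Lemma arith_v t i k l G : 5 / 6 <= t -> 0 < i -> 0 < k -> 0 <= G ->
  k ^+ 2 * l = G + (6 * t - 5) * i -> 0 <= l.
Proof.
move=> tl i0 k0 G0 h; rewrite -(pmulr_rge0 _ (exprn_gt0 2 k0)) h addr_ge0 //.
by apply: mulr_ge0; [lra|exact: ltW].
Qed.

Lemma arith_v' t i k l : 5 / 6 <= t -> 0 < i -> l <= 0 ->
  k ^+ 2 * l = 0 + (6 * t - 5) * i -> t = 5 / 6.
Proof.
move=> tl i0 l0; rewrite add0r => h.
have : (6 * t - 5) * i <= 0 by rewrite -h mulr_ge0_le0 // sqr_ge0.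
rewrite pmulr_lle0 // => h1; lra.
Qed.
End Arith.

Section Norm3.
Variables (R : realType) (N : nat) (M : topologicalType) (At : surface_atlas R M).
Hypothesis M_closed : closed_surface M.
Variable f : M -> 'rV[R]_N.+1.
Hypothesis f_imm : smooth_immersion_in_sphere At f.
Hypothesis H_par : parallel_mean_curvature At f.
Notation AA W := (sfun At W).
Notation cj W := (@cjx (sfun At W)).
Notation Z i := (@Zc R N M At f f_imm i).
Notation cF' i := (@cFc R N M At f f_imm i).
Notation Oc i := (@Oi R M At i).
Notation rho i := (fr_rho (cj (Oc i)) (Z i) (cF' i)).
Notation L i := (lap (cj (Oc i)) (Z i) (rho i)).
Notation tI := (@tI R N M At f f_imm).
Notation hhI := (@hhI R N M At f f_imm).
Notation invariant := (@invariant R N M At f f_imm).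

Variable h0 : R.
Hypothesis h0_ge0 : 0 <= h0.
Hypothesis hhE : forall p, gl hhI p = h0.
Hypothesis tb : forall p, 5 / 6 * (1 + h0) <= gl tI p <= 9 / 10 * (1 + h0).
Notation qt := (@qt R N M At f f_imm h0).
Notation qr := (@qr R N M At f f_imm h0).
Notation qN := (@qN R N M At f f_imm h0).
Notation qti := (@qti R N M At f f_imm h0).
Notation qri := (@qri R N M At f f_imm h0).
Notation qtau := (@qtau R N M At f f_imm h0).
Notation kap := (@kap R M At h0).

Section Gl.
Variables X Y : forall i : chart At, cx (AA (Oc i)).
Lemma gl_mul p : im (X (chart_at At p)) = 0 -> im (Y (chart_at At p)) = 0 ->
  gl (fun i => X i * Y i) p = gl X p * gl Y p.
Proof.
have Op : oset (Oc (chart_at At p)) p := chart_atP At p.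
have gen (x y : cx (AA (Oc (chart_at At p)))) : im x = 0 -> im y = 0 ->
    re (x * y) p = re x p * re y p.
  move=> /real_cxr -> /real_cxr ->; rewrite -cxrM /=; exact: (sfunM _ _ Op).
exact: gen.
Qed.
Lemma gl_add p : gl (fun i => X i + Y i) p = gl X p + gl Y p.
Proof. by have Op : oset (Oc (chart_at At p)) p := chart_atP At p; exact: (sfunD _ _ Op). Qed.
Lemma gl_opp p : gl (fun i => - X i) p = - gl X p.
Proof. by have Op : oset (Oc (chart_at At p)) p := chart_atP At p; exact: (sfunN _ Op). Qed.
Lemma gl_Mn p k : gl (fun i => X i *+ k) p = gl X p *+ k.
Proof.
have Op : oset (Oc (chart_at At p)) p := chart_atP At p.
have gen (x : cx (AA (Oc (chart_at At p)))) : re (x *+ k) p = re x p *+ k.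
  by rewrite -[LHS]/(re (evc p (x *+ k))) (evcMn Op) reMn.
exact: gen.
Qed.
End Gl.

Lemma im_mul i (x y : cx (AA (Oc i))) : im x = 0 -> im y = 0 -> im (x * y) = 0.
Proof. by move=> /real_cxr -> /real_cxr ->; rewrite -cxrM. Qed.
Lemma im_add i (x y : cx (AA (Oc i))) : im x = 0 -> im y = 0 -> im (x + y) = 0.
Proof. by move=> /= -> ->; rewrite addr0. Qed.
Lemma im_opp i (x : cx (AA (Oc i))) : im x = 0 -> im (- x) = 0.
Proof. by move=> /= ->; rewrite oppr0. Qed.
Lemma im_Mn i (x : cx (AA (Oc i))) k : im x = 0 -> im (x *+ k) = 0.
Proof. by move=> /= h; rewrite imMn h mul0rn. Qed.

Let iqt : invariant qt := qt_inv f_imm h0.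
Let iqr : invariant qr := qr_inv h0_ge0 tb.
Let iqN : invariant qN := qN_inv h0_ge0 tb.
Let iqti : invariant qti := qti_inv h0_ge0 tb.
Let rqt i : im (qt i) = 0 := im_qt f_imm h0 i.
Let rqr i : im (qr i) = 0 := im_qr f_imm h0 i.
Let rqN i : im (qN i) = 0 := im_qN f_imm h0 i.
Let rqti i : im (qti i) = 0 := im_qti h0_ge0 tb i.
Let tbq p : 5 / 6 <= gl qt p <= 9 / 10 := qt_b h0_ge0 tb p.

Section At_point.
Variables (i : chart At) (p : M) (ip : img i p).
Let Op : oset (Oc i) p := ip.
Let CD := Zc_CD f_imm i.
Let half := @cx_sfun_half _ _ At (Oc i).
Let evk : evc p (kap (Oc i)) = cxr (kc h0).
Proof. by apply: etrans (evc_r Op _) _; rewrite (sfCE At _ Op). Qed.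
Let Q0i := Q0 M_closed H_par h0_ge0 hhE tb i.
Let kK := kapK h0_ge0 hhE i.

Lemma qt_qti : re (qt i) p * re (qti i) p = 1.
Proof. exact: (kt_inv CD (qtK h0_ge0 tb i) (evcM Op) (evc1 At Op) (evc_cj Op)). Qed.

Lemma qr_ge0 : 0 <= re (qr i) p.
Proof. exact: (kr_ge0 (Z i) (kap (Oc i)) (cF' i) (evcD Op) (evcM Op) (evc_cj Op)). Qed.

Lemma qtau_ge0 : 0 <= re (qtau i) p.
Proof. exact: (ktau_ge0 (Z i) (kap (Oc i)) (cF' i) (evcD Op) (evcM Op) (evc_cj Op)). Qed.

Lemma q_t3r_max : 0 < re (qt i) p -> 0 < re (qr i) p ->
  evc p (Z i (qt i * (qt i * (qt i * qr i)))) = 0 ->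
  re (L i (qt i * (qt i * (qt i * qr i)))) p <= 0 ->
  9 * re (qt i) p - 12 * re (qt i) p ^+ 2 + 2 * re (qr i) p <= 0.
Proof.
exact: (kt3r_max CD (kap_real At h0 (Oc i)) (D_kap f_imm h0 i) (Zc_comm f_imm (i := i)) half
 (cFc_real f_imm i) (cFc_unit f_imm i) (f1c_null f_imm i) (f1c_unit f_imm i)
 (chart_parallel f_imm H_par i) Q0i kK (qtK h0_ge0 tb i)
 (evcD Op) (evcM Op) (evc1 At Op) (evc_cj Op) evk (kc_gt0 h0_ge0)).
Qed.

Lemma q_N_max : 5 / 6 <= re (qt i) p <= 9 / 10 -> re (qr i) p <= 23 / 25 * re (qt i) p ->
  re (L i (qN i + qr i *+ 6 + qt i *+ 8)) p <= 0 -> re (qN i) p <= 4.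
Proof.
exact: (kN_max CD (kap_real At h0 (Oc i)) (D_kap f_imm h0 i) (Zc_comm f_imm (i := i)) half
 (cFc_real f_imm i) (cFc_unit f_imm i) (f1c_null f_imm i) (f1c_unit f_imm i)
 (chart_parallel f_imm H_par i) Q0i kK (qtK h0_ge0 tb i)
 (evcD Op) (evcM Op) (evc1 At Op) (evc_cj Op) evk (kc_gt0 h0_ge0)).
Qed.

Lemma q_r_min : 5 / 6 <= re (qt i) p <= 9 / 10 -> re (qr i) p <= 12 / 100 ->
  re (qN i) p <= 10 -> evc p (Z i (- (qr i + qt i *+ 50))) = 0 ->
  re (L i (- (qr i + qt i *+ 50))) p <= 0 -> False.
Proof.
exact: (kr_min CD (kap_real At h0 (Oc i)) (D_kap f_imm h0 i) (Zc_comm f_imm (i := i)) half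
 (cFc_real f_imm i) (cFc_unit f_imm i) (f1c_null f_imm i) (f1c_unit f_imm i)
 (chart_parallel f_imm H_par i) Q0i kK (qtK h0_ge0 tb i)
 (evcD Op) (evcM Op) (evc1 At Op) (evc_cj Op) evk (kc_gt0 h0_ge0)).
Qed.

Hypothesis rK : exists ri, qr i * ri = 1.

Lemma qr_qri : re (qr i) p * re (qri i) p = 1.
Proof. exact: (kr_inv CD (evcM Op) (evc1 At Op) (evc_cj Op) rK). Qed.

Lemma q_w_lap : 0 < re (qt i) p -> 0 < re (qr i) p -> 0 < re (qtau i) p ->
  (re (qt i) p * re (qr i) p * re (qtau i) p) ^+ 2 * (9 - 10 * re (qt i) p) <=
  (re (qt i) p * re (qr i) p * re (qtau i) p) * (kc h0 ^+ 2 * re (L i (qt i * qr i * qtau i)) p).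
Proof.
exact: (kw_lap CD (kap_real At h0 (Oc i)) (D_kap f_imm h0 i) (Zc_comm f_imm (i := i)) half
 (cFc_real f_imm i) (cFc_unit f_imm i) (f1c_null f_imm i) (f1c_unit f_imm i)
 (chart_parallel f_imm H_par i) Q0i kK (qtK h0_ge0 tb i)
 (evcD Op) (evcM Op) (evc1 At Op) (evc_cj Op) evk rK).
Qed.

Lemma q_v_lap : 0 < re (qt i) p -> 0 < re (qr i) p -> re (qtau i) p = 0 ->
  exists2 G, 0 <= G & kc h0 ^+ 2 * re (L i (qti i * qri i)) p =
     G + (6 * re (qt i) p - 5) * (re (qti i) p * re (qri i) p) /\
    (evc p (Z i (qti i * qri i)) = 0 -> G = 0).
Proof.
exact: (kv_lap CD (kap_real At h0 (Oc i)) (D_kap f_imm h0 i) (Zc_comm f_imm (i := i)) half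
 (cFc_real f_imm i) (cFc_unit f_imm i) (f1c_null f_imm i) (f1c_unit f_imm i)
 (chart_parallel f_imm H_par i) Q0i kK (qtK h0_ge0 tb i)
 (evcD Op) (evcM Op) (evc1 At Op) (evc_cj Op) evk rK).
Qed.
End At_point.
End Norm3.

Lemma prod_pos (R : realFieldType) (t r ta : R) : 0 < t -> 0 < r -> 0 < t * r * ta -> 0 < ta.
Proof. by move=> t0 r0; rewrite pmulr_rgt0 // mulr_gt0. Qed.

(** * Bounds on r and N and the final alternative *)

Section Norm4.
Variables (R : realType) (N : nat) (M : topologicalType) (At : surface_atlas R M).
Hypothesis M_closed : closed_surface M.
Variable f : M -> 'rV[R]_N.+1.
Hypothesis f_imm : smooth_immersion_in_sphere At f.
Hypothesis H_par : parallel_mean_curvature At f.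
Notation cj W := (@cjx (sfun At W)).
Notation Z i := (@Zc R N M At f f_imm i).
Notation cF' i := (@cFc R N M At f f_imm i).
Notation Oc i := (@Oi R M At i).
Notation rho i := (fr_rho (cj (Oc i)) (Z i) (cF' i)).
Notation L i := (lap (cj (Oc i)) (Z i) (rho i)).
Notation tI := (@tI R N M At f f_imm).
Notation hhI := (@hhI R N M At f f_imm).
Notation invariant := (@invariant R N M At f f_imm).

Variable h0 : R.
Hypothesis h0_ge0 : 0 <= h0.
Hypothesis hhE : forall p, gl hhI p = h0.
Hypothesis tb : forall p, 5 / 6 * (1 + h0) <= gl tI p <= 9 / 10 * (1 + h0).
Notation qt := (@qt R N M At f f_imm h0).
Notation qr := (@qr R N M At f f_imm h0).
Notation qN := (@qN R N M At f f_imm h0).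
Notation qti := (@qti R N M At f f_imm h0).
Notation qri := (@qri R N M At f f_imm h0).
Notation qtau := (@qtau R N M At f f_imm h0).

Let iqt : invariant qt := qt_inv f_imm h0.
Let iqr : invariant qr := qr_inv h0_ge0 tb.
Let iqN : invariant qN := qN_inv h0_ge0 tb.
Let iqti : invariant qti := qti_inv h0_ge0 tb.
Let rqt i : im (qt i) = 0 := im_qt f_imm h0 i.
Let rqr i : im (qr i) = 0 := im_qr f_imm h0 i.
Let rqN i : im (qN i) = 0 := im_qN f_imm h0 i.
Let rqti i : im (qti i) = 0 := im_qti h0_ge0 tb i.
Let tbq p : 5 / 6 <= gl qt p <= 9 / 10 := qt_b h0_ge0 tb p.

Hypothesis osc : forall p q, gl qt p - gl qt q <= 1 / 420.
Hypothesis M0 : M.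

Notation X1 := (fun i => qt i * (qt i * (qt i * qr i))).
Notation X2 := (fun i => qN i + qr i *+ 6 + qt i *+ 8).
Notation X3 := (fun i => - (qr i + qt i *+ 50)).

Let t_gt0 p : 0 < gl qt p.
Proof. by case/andP: (tbq p) => h _; apply: lt_le_trans h; rewrite divr_gt0. Qed.
Let ip p : img (chart_at At p) p. Proof. exact: chart_atP. Qed.

Lemma r_nonneg p : 0 <= gl qr p. Proof. exact: (qr_ge0 f_imm h0 (ip p)). Qed.

Lemma gl_X1 p : gl X1 p = gl qt p * (gl qt p * (gl qt p * gl qr p)).
Proof.
have a := rqt (chart_at At p); have b := rqr (chart_at At p).
pose e1 := @gl_mul R M At qt (fun i => qt i * (qt i * qr i)) p a (im_mul a (im_mul a b)).
pose e2 := @gl_mul R M At qt (fun i => qt i * qr i) p a (im_mul a b).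
pose e3 := @gl_mul R M At qt qr p a b.
exact: (etrans e1 (congr1 ( *%R (gl qt p)) (etrans e2 (congr1 ( *%R (gl qt p)) e3)))).
Qed.

Lemma gl_X2 p : gl X2 p = gl qN p + gl qr p *+ 6 + gl qt p *+ 8.
Proof.
pose e1 := @gl_add R M At (fun i => qN i + qr i *+ 6) (fun i => qt i *+ 8) p.
pose e2 := @gl_add R M At qN (fun i => qr i *+ 6) p.
exact: (etrans e1 (f_equal2 +%R (etrans e2 (congr1 (+%R (gl qN p)) (@gl_Mn R M At qr p 6))) (@gl_Mn R M At qt p 8))).
Qed.

Lemma gl_X3 p : gl X3 p = - (gl qr p + gl qt p *+ 50).
Proof.
pose e1 := @gl_opp R M At (fun i => qr i + qt i *+ 50) p.
pose e2 := @gl_add R M At qr (fun i => qt i *+ 50) p.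
exact: (etrans e1 (congr1 -%R (etrans e2 (congr1 (+%R (gl qr p)) (@gl_Mn R M At qt p 50))))).
Qed.

Lemma r_bound p : gl qr p <= 23 / 25 * gl qt p.
Proof.
have iX : invariant X1 := inv_mul iqt (inv_mul iqt (inv_mul iqt iqr)).
have rX i : im (X1 i) = 0 := im_mul (rqt i) (im_mul (rqt i) (im_mul (rqt i) (rqr i))).
have [q [qm qD qL]] := weak_max M_closed iX rX.
have h : gl X1 p <= gl X1 q := qm p.
apply: (arith_ratio (tbq q) (proj1 (andP (tbq p))) (osc q p) (r_nonneg q)).
  by rewrite -!gl_X1.
move=> r0; exact: (q_t3r_max M_closed H_par h0_ge0 hhE tb (ip q) (t_gt0 q) r0 (qD _ (ip q)) (qL _ (ip q))).
Qed.

Lemma N_bound p : gl qN p <= 10.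
Proof.
have iX : invariant X2 := inv_add (inv_add iqN (inv_Mn 6 iqr)) (inv_Mn 8 iqt).
have rX i : im (X2 i) = 0 := im_add (im_add (rqN i) (im_Mn 6 (rqr i))) (im_Mn 8 (rqt i)).
have [q [qm qD qL]] := weak_max M_closed iX rX.
have Nq : gl qN q <= 4.
  exact: (q_N_max M_closed H_par h0_ge0 hhE tb (ip q) (tbq q) (r_bound q) (qL _ (ip q))).
apply: (arith_N (tbq q) (osc q p) (r_nonneg p) (r_bound q) Nq).
by rewrite -!gl_X2; exact: qm.
Qed.

Lemma r_gt0 p : 0 < gl qr p.
Proof.
rewrite ltNge; apply/negP => r0.
have iX : invariant X3 := inv_opp (inv_add iqr (inv_Mn 50 iqt)).
have rX i : im (X3 i) = 0 := im_opp (im_add (rqr i) (im_Mn 50 (rqt i))).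
have [q [qm qD qL]] := weak_max M_closed iX rX.
have rq : gl qr q <= 12 / 100.
  by apply: (arith_r (osc p q) r0); rewrite -!gl_X3; exact: qm.
exact: (q_r_min M_closed H_par h0_ge0 hhE tb (ip q) (tbq q) rq (N_bound q) (qD _ (ip q)) (qL _ (ip q))).
Qed.

Let rK := qrK h0_ge0 tb r_gt0.
Let iqri : invariant qri := qri_inv h0_ge0 tb r_gt0.
Let iqtau : invariant qtau := qtau_inv h0_ge0 tb r_gt0.
Let rqri i : im (qri i) = 0 := im_qri h0_ge0 tb r_gt0 i.
Let rqtau i : im (qtau i) = 0 := im_qtau f_imm h0 i.

Lemma tau_ge0 p : 0 <= gl qtau p. Proof. exact: (qtau_ge0 f_imm h0 (ip p)). Qed.

Notation W := (fun i => qt i * qr i * qtau i).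
Notation V := (fun i => qti i * qri i).
Let iW : invariant W := inv_mul (inv_mul iqt iqr) iqtau.
Let rW i : im (W i) = 0 := im_mul (im_mul (rqt i) (rqr i)) (rqtau i).
Let iV : invariant V := inv_mul iqti iqri.
Let rV i : im (V i) = 0 := im_mul (rqti i) (rqri i).

Lemma gl_W p : gl W p = gl qt p * gl qr p * gl qtau p.
Proof.
have a := rqt (chart_at At p); have b := rqr (chart_at At p); have c := rqtau (chart_at At p).
pose e1 := @gl_mul R M At (fun i => qt i * qr i) qtau p (im_mul a b) c.
exact: (etrans e1 (congr1 (fun x => x * gl qtau p) (@gl_mul R M At qt qr p a b))).
Qed.

Lemma w_lap_ge i p : img i p -> 0 < gl W p ->
  (gl W p) ^+ 2 * (9 - 10 * gl qt p) <= gl W p * (kc h0 ^+ 2 * re (L i (W i)) p).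
Proof.
move=> Ip; rewrite gl_W => w0.
have ta0 := prod_pos (t_gt0 p) (r_gt0 p) w0.
have gen (t r ta l : R) : t = gl qt p -> r = gl qr p -> ta = gl qtau p ->
  (0 < t -> 0 < r -> 0 < ta -> (t * r * ta) ^+ 2 * (9 - 10 * t) <= t * r * ta * l) ->
  (gl qt p * gl qr p * gl qtau p) ^+ 2 * (9 - 10 * gl qt p) <= gl qt p * gl qr p * gl qtau p * l.
  by move=> -> -> -> h; exact: h (t_gt0 p) (r_gt0 p) ta0.
exact: gen (esym (gl_chart iqt Ip)) (esym (gl_chart iqr Ip)) (esym (gl_chart iqtau Ip))
  (q_w_lap M_closed H_par h0_ge0 hhE tb Ip (rK i)).
Qed.

Lemma gl_V p : gl V p = gl qti p * gl qri p.
Proof. exact: (@gl_mul R M At qti qri p (rqti _) (rqri _)). Qed.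

Lemma v_gt0 p : 0 < gl V p.
Proof.
rewrite gl_V; have e1 : gl qt p * gl qti p = 1 := qt_qti h0_ge0 tb (ip p).
have e2 : gl qr p * gl qri p = 1 := qr_qri (ip p) (rK _).
rewrite mulr_gt0 //; first by rewrite -(pmulr_rgt0 _ (t_gt0 p)) e1.
by rewrite -(pmulr_rgt0 _ (r_gt0 p)) e2.
Qed.

Lemma v_lap_ge i p : img i p -> gl qtau p = 0 ->
  exists2 G, 0 <= G & kc h0 ^+ 2 * re (L i (V i)) p = G + (6 * gl qt p - 5) * gl V p /\
    (evc p (Z i (V i)) = 0 -> G = 0).
Proof.
move=> Ip ta0; rewrite gl_V.
have gen (t r ta ti ri l : R) (P : Prop) : t = gl qt p -> r = gl qr p -> ta = gl qtau p ->
  ti = gl qti p -> ri = gl qri p ->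
  (0 < t -> 0 < r -> ta = 0 -> exists2 G, 0 <= G & l = G + (6 * t - 5) * (ti * ri) /\ (P -> G = 0)) ->
  exists2 G, 0 <= G & l = G + (6 * gl qt p - 5) * (gl qti p * gl qri p) /\ (P -> G = 0).
  by move=> -> -> -> -> -> h; exact: h (t_gt0 p) (r_gt0 p) ta0.
exact: gen (esym (gl_chart iqt Ip)) (esym (gl_chart iqr Ip)) (esym (gl_chart iqtau Ip))
  (esym (gl_chart iqti Ip)) (esym (gl_chart iqri Ip))
  (q_v_lap M_closed H_par h0_ge0 hhE tb Ip (rK i)).
Qed.

Lemma t_const : (forall p, gl qt p = 9 / 10) \/ (forall p, gl qt p = 5 / 6).
Proof.
have tu p : gl qt p <= 9 / 10 := proj2 (andP (tbq p)).
have tl p : 5 / 6 <= gl qt p := proj1 (andP (tbq p)).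
have [[p0 w0]|nw] := pselect (exists p, 0 < gl W p); [left=> p|right=> p].
  have wc : forall p q, gl W p = gl W q.
    (* The level is 0 because the inequality for the Laplacian of w holds only where w > 0. *)
    apply: (strong_max M_closed (c0 := 0) iW rW); last by exists p0.
    move=> i q iq wq; have wq' : 0 < gl W q by have e := gl_chart iW iq; exact: (eq_ind_r (fun x => 0 < x) wq e).
    exact: (arith_w (tu q) wq' (kc_gt0 h0_ge0) (w_lap_ge iq wq')).
  have wp : 0 < gl W p by rewrite (wc p p0).
  have pm q : gl W q <= gl W p by rewrite (wc q p).
  (* As w is constant, p is a maximum and the Laplacian is nonpositive there; together with the
     lower bound this forces 9 - 10 t = 0. *)
  have [_ Lw] := max_test iW (rW _) (ip p) pm.
  exact: (arith_w' (tu p) wp Lw (w_lap_ge (ip p) wp)).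
have ta0 q : gl qtau q = 0.
  apply/eqP; rewrite eq_le tau_ge0 andbT leNgt; apply/negP => h; apply: nw; exists q.
  by rewrite gl_W; exact: mulr_gt0 (mulr_gt0 (t_gt0 q) (r_gt0 q)) h.
have vc : forall p q, gl V p = gl V q.
  apply: (strong_max M_closed (c0 := 0) iV rV); last by exists p; exact: v_gt0.
  move=> i q iq _; have [G G0 [e _]] := v_lap_ge iq (ta0 q).
  exact: (arith_v (tl q) (v_gt0 q) (kc_gt0 h0_ge0) G0 e).
have pm q : gl V q <= gl V p by rewrite (vc q p).
(* Again every point is a maximum: the gradient term vanishes, and what remains forces 6 t - 5 =
   0. *)
have [Dv Lv] := max_test iV (rV _) (ip p) pm.
have [G G0 [e /(_ Dv) Gz]] := v_lap_ge (ip p) (ta0 p); rewrite Gz in e.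
exact: (arith_v' (tl p) (v_gt0 p) Lv e).
Qed.
End Norm4.

(** * The constant of the pinching condition *)

Lemma cubic_incr (R : realType) (a x : R) : 1 <= x -> x < a -> cubic x < cubic a.
Proof.
move=> x1 xa; rewrite -subr_gt0.
have -> : cubic a - cubic x = (a - x) *
    (1125 * ((a - 1) ^+ 2 + (a - 1) * (x - 1) + (x - 1) ^+ 2) + 6415).
  by rewrite /cubic; ring.
have b0 : 0 <= x - 1 by rewrite subr_ge0.
have a0 : 0 <= a - 1 by rewrite subr_ge0 (le_trans x1) // ltW.
apply: mulr_gt0; first by rewrite subr_gt0.
apply: ltr_wpDl; last by rewrite ltr0n.
apply: mulr_ge0; first exact: ler0n.
apply: addr_ge0; last exact: sqr_ge0.
by apply: addr_ge0; [exact: sqr_ge0|exact: mulr_ge0].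
Qed.

(** A rational lower bound for the root of [cubic], sharp enough for [eps0_lt]: the cubic is
    increasing beyond 1 and still negative at 357/200. *)
Lemma S_plus_ge (R : realType) : 357 / 200 <= S_plus R.
Proof.
have [/andP[x1 _]] := S_plusP R; move: (S_plus R) x1 => x x1 e.
rewrite leNgt; apply/negP => xa.
have x1' : 1 <= x by apply: le_trans (ltW x1); lra.
have := cubic_incr x1' xa; rewrite e.
have h4 : cubic (357 / 200 : R) < 0.
  clear; rewrite /cubic.
  have -> : (357 / 200 : R) ^+ 3 = 357 / 200 * (357 / 200) * (357 / 200) by ring.
  have -> : (357 / 200 : R) ^+ 2 = 357 / 200 * (357 / 200) by ring.
  lra.
by move=> h3; have := lt_trans h3 h4; rewrite ltxx.
Qed.

Lemma arith_eps (R : realFieldType) (a b c e : R) :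
  a * b * c <= 182 / 1000 -> 4600 <= e -> 120 * a * b * c < 1 / 210 * e.
Proof.
by rewrite -!mulrA; move: (a * (b * c)) => z h1 h2; lra.
Qed.

(** On [357/200, 9/5] the product of the factors of the numerator is at most 182/1000 and the
    denominator at least 4600; 120 times 182/1000 is 21.84, just below 4600/210. *)
Lemma eps0_lt (R : realType) : eps0 R < 1 / 210.
Proof.
have [/andP[_ x2] _] := S_plusP R; have := S_plus_ge R.
rewrite /eps0; move: (S_plus R) x2 => x x2 x1.
(* In the variable y >= 0 the non-constant coefficients of the numerator are all negative, so the
   bounds are linear in y and its powers. *)
have [y [y0 y1 ->]] : exists y, [/\ 0 <= y, y <= 3 / 200 & x = 357 / 200 + y].
  by exists (x - 357 / 200); split; lra.
have yy : 0 <= y ^+ 2 by exact: sqr_ge0.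
have yyy : 0 <= y ^+ 3 by exact: exprn_ge0.
have n1 : (357 / 200 + y) * (3 * (357 / 200 + y) - 4) * (9 - 5 * (357 / 200 + y)) <= 182 / 1000.
  have -> : (357 / 200 + y) * (3 * (357 / 200 + y) - 4) * (9 - 5 * (357 / 200 + y)) =
    (357 / 200) * (271 / 200) * (3 / 40) + (3 / 40 * (357 / 200 * 3 + 271 / 200) - 5 * (357 / 200) * (271 / 200)) * y
    + (9 / 40 - 5 * (357 / 200 * 3 + 271 / 200)) * y ^+ 2 - 15 * y ^+ 3 by field.
  lra.
have d1 : 4600 <= 2225 * (357 / 200 + y) ^+ 2 - 420 * (357 / 200 + y) - 1701.
  by rewrite (_ : (357 / 200 + y) ^+ 2 = (357 / 200) * (357 / 200) + 357 / 100 * y + y ^+ 2); [lra|field].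
rewrite ltr_pdivrMr; last by apply: lt_le_trans d1; lra.
exact: arith_eps n1 d1.
Qed.

(** The two-sided bound guarantees that [sup] and [inf] are those of a bounded set. *)
Lemma le_S_max (R : realType) (T : Type) (g : T -> R) a b : (forall p, a <= g p <= b) ->
  forall p q, g p - g q <= sup (range g) - inf (range g).
Proof.
move=> ab p q; apply: lerB.
  apply: ub_le_sup; last by exists p.
  by exists b => _ [y _ <-]; case/andP: (ab y).
apply: ge_inf; last by exists q.
by exists a => _ [y _ <-]; case/andP: (ab y).
Qed.

Lemma arith_bounds (R : realFieldType) (S t h : R) : S = (t + h) *+ 2 ->
  5 / 3 + 11 / 3 * h <= S <= 9 / 5 + 19 / 5 * h ->
  5 / 6 * (1 + h) <= t <= 9 / 10 * (1 + h).
Proof. by move=> -> /andP[h1 h2]; apply/andP; split; lra. Qed.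

(** S is twice t plus a constant, which turns 1/210 into 1/420. *)
Lemma arith_osc (R : realFieldType) (S S' t t' h d e : R) : S = (t + h) *+ 2 ->
  S' = (t' + h) *+ 2 -> S - S' <= d -> d < e * (1 + h) -> e < 1 / 210 -> 0 <= h ->
  t / (1 + h) - t' / (1 + h) <= 1 / 420.
Proof.
move=> -> -> h1 h2 h3 h4; have c0 : 0 < 1 + h by lra.
rewrite -mulrBl ler_pdivrMr //.
have : e * (1 + h) <= 1 / 210 * (1 + h) by rewrite ler_wpM2r // ltW.
lra.
Qed.

Lemma arith_end1 (R : realFieldType) (S h0 H t q : R) : 0 <= h0 -> S = (t + h0) *+ 2 ->
  H = h0 -> q = t / (1 + h0) -> q = 9 / 10 -> S = 9 / 5 + 19 / 5 * H.
Proof.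
move=> h0_ge0 -> -> -> e; have c0 : 1 + h0 != 0 by rewrite gt_eqF // ltr_pwDl.
have -> : t = 9 / 10 * (1 + h0) by rewrite -e divfK.
by field.
Qed.

Lemma arith_end2 (R : realFieldType) (S h0 H t q : R) : 0 <= h0 -> S = (t + h0) *+ 2 ->
  H = h0 -> q = t / (1 + h0) -> q = 5 / 6 -> S = 5 / 3 + 11 / 3 * H.
Proof.
move=> h0_ge0 -> -> -> e; have c0 : 1 + h0 != 0 by rewrite gt_eqF // ltr_pwDl.
have -> : t = 5 / 6 * (1 + h0) by rewrite -e divfK.
by field.
Qed.

Theorem theorem1p4 (R : realType) (N : nat)
  (M : topologicalType) (A : surface_atlas R M) (f : M -> 'rV[R]_N.+1)
  (M_closed : closed_surface M)
  (f_immersion : smooth_immersion_in_sphere A f)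
  (H_parallel : parallel_mean_curvature A f)
  (S_bounds : forall p : M,
     5 / 3 + 11 / 3 * H_ A f p ^+ 2 <= S_ A f p
       <= 9 / 5 + 19 / 5 * H_ A f p ^+ 2)
  (S_pinch : forall p : M,
     S_max A f - S_min A f < eps0 R * (1 + H_ A f p ^+ 2)) :
  (forall p : M, S_ A f p = 5 / 3 + 11 / 3 * H_ A f p ^+ 2) \/
  (forall p : M, S_ A f p = 9 / 5 + 19 / 5 * H_ A f p ^+ 2).
Proof.
have [[p0 _] _ _ _] := M_closed.
pose h0 := gl (hhI f_immersion) p0.
have hhE p : gl (hhI f_immersion) p = h0 := hh_const M_closed f_immersion H_parallel p p0.
have HE p : H_ A f p ^+ 2 = h0 := etrans (H_gl f_immersion p) (hhE p).
have h0_ge0 : 0 <= h0 := hh_ge0 f_immersion p0.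
have SE p : S_ A f p = (gl (tI f_immersion) p + h0) *+ 2 :=
  etrans (S_gl f_immersion p) (congr1 (fun x => (gl (tI f_immersion) p + x) *+ 2) (hhE p)).
have Sb p : 5 / 3 + 11 / 3 * h0 <= S_ A f p <= 9 / 5 + 19 / 5 * h0.
  have gen (h s : R) : h = h0 -> 5 / 3 + 11 / 3 * h <= s <= 9 / 5 + 19 / 5 * h ->
    5 / 3 + 11 / 3 * h0 <= s <= 9 / 5 + 19 / 5 * h0 by move=> ->.
  exact: gen (HE p) (S_bounds p).
have tb p : 5 / 6 * (1 + h0) <= gl (tI f_immersion) p <= 9 / 10 * (1 + h0) :=
  arith_bounds (SE p) (Sb p).
have Spinch : S_max A f - S_min A f < eps0 R * (1 + h0).
  have gen (h s : R) : h = h0 -> s < eps0 R * (1 + h) -> s < eps0 R * (1 + h0) by move=> ->.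
  exact: gen (HE p0) (S_pinch p0).
have qE p : gl (qt f_immersion h0) p = gl (tI f_immersion) p / (1 + h0) :=
  qt_val f_immersion h0_ge0 p.
have osc p q : gl (qt f_immersion h0) p - gl (qt f_immersion h0) q <= 1 / 420.
  have gen (a b a' b' : R) : a = a' -> b = b' -> a' - b' <= 1 / 420 -> a - b <= 1 / 420.
    by move=> -> ->.
  exact: gen (qE p) (qE q) (arith_osc (SE p) (SE q) (le_S_max Sb p q) Spinch (eps0_lt R) h0_ge0).
have [h|h] := t_const M_closed H_parallel h0_ge0 hhE tb osc; [right|left] => p.
  exact: arith_end1 h0_ge0 (SE p) (HE p) (qE p) (h p).
exact: arith_end2 h0_ge0 (SE p) (HE p) (qE p) (h p).
Qed.
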